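(* The group of outer automorphisms $\mathrm{Aut}_{\mathbb{R}}(\mathfrak{so}(4,4))/\mathrm{Int}(\mathfrak{so}(4,4))$ of the real Lie algebra $\mathfrak{so}(4,4)$ is isomorphic to the symmetric group $S_4$.
   Context: $\mathfrak{so}(4,4)=\{X\in\mathfrak{gl}(8,\mathbb{R})\mid X^*I_{4,4}+I_{4,4}X=0\}$, where $X^*$ is the transpose and $I_{4,4}=\mathrm{diag}(1,1,1,1,-1,-1,-1,-1)$. For a real Lie algebra $\mathfrak{g}_0$, $\mathrm{Aut}_{\mathbb{R}}(\mathfrak{g}_0)$ is the group of its real Lie algebra automorphisms and $\mathrm{Int}(\mathfrak{g}_0)$ is the subgroup of inner automorphisms, i.e. the connected subgroup of $\mathrm{Aut}_{\mathbb{R}}(\mathfrak{g}_0)$ generated by the $\exp(\mathrm{ad}\,X)$, $X\in\mathfrak{g}_0$. *)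

(* Defs.v *)
From HB Require Import structures.
From mathcomp Require Import all_boot all_order all_fingroup all_algebra.
From mathcomp Require Import generic_quotient.
From mathcomp Require Import all_classical all_reals all_analysis.

Set Implicit Arguments.
Unset Strict Implicit.
Unset Printing Implicit Defensive.

Import Order.TTheory GRing.Theory Num.Theory.
Import numFieldNormedType.Exports.

Local Open Scope classical_set_scope.

Definition generated_subgroup (G : groupType) (A : set G) : set G :=
  smallest [set H : set G | group_closed (mem H)] A.

Record normal_subgroup (G : groupType) := NormalSubgroup {
  nsub_set :> set G;
  nsub_closed : group_closed (mem nsub_set);
  nsub_normal : forall x y : G, x \in nsub_set -> (x ^ y)%g \in nsub_set }.

Section Quotient.
Local Open Scope group_scope.
Local Open Scope quotient_scope.
Context (G : groupType) (N : normal_subgroup G).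
Implicit Types x y z : G.

Lemma nsub1 : 1 \in nsub_set N.
Proof. exact: (nsub_closed N).1. Qed.

Lemma nsub_div x y : x \in nsub_set N -> y \in nsub_set N -> x * y^-1 \in nsub_set N.
Proof. exact: (nsub_closed N).2. Qed.

Lemma nsubV x : x \in nsub_set N -> x^-1 \in nsub_set N.
Proof. by move=> Nx; rewrite -div1g; apply: nsub_div => //; exact: nsub1. Qed.

Lemma nsubM x y : x \in nsub_set N -> y \in nsub_set N -> x * y \in nsub_set N.
Proof.
by move=> Nx Ny; rewrite -(invgK y); apply: nsub_div => //; exact: nsubV.
Qed.

Definition same_coset : rel G := fun x y => x^-1 * y \in nsub_set N.

Lemma same_coset_refl : reflexive same_coset.
Proof. by move=> x; rewrite /same_coset mulVg; exact: nsub1. Qed.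

Lemma same_coset_sym : symmetric same_coset.
Proof.
suff sym x y : same_coset x y -> same_coset y x.
  by move=> x y; apply/idP/idP; exact: sym.
by move=> /nsubV; rewrite invgM invgK.
Qed.

Lemma same_coset_trans : transitive same_coset.
Proof. by move=> y x z xy yz; have := nsubM xy yz; rewrite -mulgA mulKVg. Qed.

Canonical same_coset_equiv :=
  EquivRel same_coset same_coset_refl same_coset_sym same_coset_trans.

Definition quotient_group := {eq_quot same_coset_equiv}.

HB.instance Definition _ := Choice.on quotient_group.
HB.instance Definition _ := EqQuotient.on quotient_group.

Definition coset_class (x : G) : quotient_group := \pi x.

Lemma coset_classP x y :
  reflect (coset_class x = coset_class y) (x^-1 * y \in nsub_set N).
Proof. by apply: (iffP idP) => [H|/eqmodP //]; apply/eqmodP. Qed.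

Lemma repr_coset (a : quotient_group) : coset_class (repr a) = a.
Proof. exact: reprK. Qed.

Definition qone : quotient_group := coset_class 1.
Definition qmul (a b : quotient_group) : quotient_group :=
  coset_class (repr a * repr b).
Definition qinv (a : quotient_group) : quotient_group :=
  coset_class (repr a)^-1.

Lemma qmulE x y : qmul (coset_class x) (coset_class y) = coset_class (x * y).
Proof.
apply/coset_classP.
have /coset_classP Hx := repr_coset (coset_class x).
have /coset_classP Hy := repr_coset (coset_class y).
rewrite /=; set x' := repr _ in Hx *; set y' := repr _ in Hy *.
have -> : (x' * y')^-1 * (x * y) = (x'^-1 * x) ^ y' * (y'^-1 * y).
  by rewrite invgM conjgE !mulgA mulgK.
by apply: nsubM => //; exact: nsub_normal.
Qed.

Lemma qinvE x : qinv (coset_class x) = coset_class x^-1.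
Proof.
apply/coset_classP.
have /coset_classP Hx := repr_coset (coset_class x).
set x' := repr _ in Hx *.
rewrite invgK.
have -> : x' * x^-1 = ((x'^-1 * x) ^ x'^-1)^-1.
  by rewrite conjgE invgK !mulgA mulgV mul1g invgM invgK.
by apply: nsubV; exact: nsub_normal.
Qed.

Lemma qind (P : quotient_group -> Prop) :
  (forall x, P (coset_class x)) -> forall a, P a.
Proof. by move=> H a; rewrite -(repr_coset a). Qed.

Lemma qmulA : associative qmul.
Proof.
by elim/qind=> x; elim/qind=> y; elim/qind=> z; rewrite !qmulE mulgA.
Qed.
Lemma qmul1q : left_id qone qmul.
Proof. by elim/qind=> x; rewrite qmulE mul1g. Qed.
Lemma qmulq1 : right_id qone qmul.
Proof. by elim/qind=> x; rewrite qmulE mulg1. Qed.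
Lemma qmulVq : left_inverse qone qinv qmul.
Proof. by elim/qind=> x; rewrite qinvE qmulE mulVg. Qed.
Lemma qmulqV : right_inverse qone qinv qmul.
Proof. by elim/qind=> x; rewrite qinvE qmulE mulgV. Qed.

HB.instance Definition _ :=
  isGroup.Build quotient_group qmulA qmul1q qmulq1 qmulVq qmulqV.

End Quotient.

Definition group_isomorphic (G H : groupType) : Prop :=
  exists f : G -> H, bijective f /\ {morph f : x y / (x * y)%g}.

Local Open Scope ring_scope.

Definition I44 (R : realType) : 'M[R]_8 :=
  diag_mx (\row_(i < 8) (if (i < 4)%N then 1 else -1)).

Definition in_so44 (R : realType) : {pred 'M[R]_8} :=
  fun X => X^T *m I44 R + I44 R *m X == 0.

Lemma in_so44_submod (R : realType) : submod_closed (@in_so44 R).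
Proof.
split=> [|a X Y]; rewrite /in_mem /= /in_so44; first by rewrite trmx0 mul0mx mulmx0 addr0.
move=> /eqP HX /eqP HY; apply/eqP.
rewrite linearP /= mulmxDl mulmxDr -scalemxAl -scalemxAr addrACA -scalerDr.
by rewrite HX HY scaler0 addr0.
Qed.

HB.instance Definition _ (R : realType) :=
  GRing.isSubmodClosed.Build R 'M[R]_8 (@in_so44 R) (in_so44_submod R).

Record so44 (R : realType) :=
  So44 { so44_mx :> 'M[R]_8; so44P : in_so44 so44_mx }.

HB.instance Definition _ (R : realType) := [isSub for @so44_mx R].
HB.instance Definition _ (R : realType) := [Choice of so44 R by <:].
HB.instance Definition _ (R : realType) :=
  [SubChoice_isSubLmodule of so44 R by <:].

Definition mx_bracket (R : realType) (X Y : 'M[R]_8) : 'M[R]_8 :=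
  X *m Y - Y *m X.

Lemma mx_bracket_so44 (R : realType) (X Y : so44 R) :
  in_so44 (mx_bracket X Y).
Proof.
have /eqP HX := so44P X; have /eqP HY := so44P Y.
move/eqP: HX; rewrite addr_eq0 => /eqP HX.
move/eqP: HY; rewrite addr_eq0 => /eqP HY.
rewrite /in_so44 /mx_bracket linearB /= !trmx_mul mulmxBl mulmxBr.
rewrite -!mulmxA HX HY !mulmxN !mulmxA HX HY !mulNmx !opprK.
by rewrite addrA subrK subrr.
Qed.

Definition lie_bracket (R : realType) (X Y : so44 R) : so44 R :=
  So44 (mx_bracket_so44 X Y).

Definition is_lie_aut (R : realType) (f : so44 R -> so44 R) : Prop :=
  [/\ linear f, {morph f : X Y / lie_bracket X Y} & bijective f].

Record lie_aut (R : realType) :=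
  LieAut { lie_aut_fun :> so44 R -> so44 R;
           lie_autP : `[< is_lie_aut lie_aut_fun >] }.

HB.instance Definition _ (R : realType) := [isSub for @lie_aut_fun R].
HB.instance Definition _ (R : realType) := [Choice of lie_aut R by <:].

Section LieAutGroup.
Context (R : realType).
Implicit Types f g h : lie_aut R.

Lemma lie_aut_ext f g : f =1 g -> f = g.
Proof. by move=> fg; apply: val_inj; exact/funext. Qed.

Lemma lie_autL f : linear f.
Proof. by have /asboolP[] := lie_autP f. Qed.

Lemma lie_aut_bracket f : {morph f : X Y / lie_bracket X Y}.
Proof. by have /asboolP[] := lie_autP f. Qed.

Lemma lie_aut_bij f : bijective f.
Proof. by have /asboolP[] := lie_autP f. Qed.

Lemma lie_aut1_subproof : `[< is_lie_aut (@id (so44 R)) >].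
Proof. by apply/asboolP; split=> //; exists id. Qed.

Definition lie_aut1 := LieAut lie_aut1_subproof.

Lemma lie_autM_subproof f g : `[< is_lie_aut (f \o g) >].
Proof.
apply/asboolP; split=> [a X Y|X Y|] /=; first by rewrite !lie_autL.
  by rewrite !lie_aut_bracket.
by apply: bij_comp; exact: lie_aut_bij.
Qed.

Definition lie_autM f g := LieAut (lie_autM_subproof f g).

Lemma lie_aut_inv_exists f :
  exists g : so44 R -> so44 R, cancel f g /\ cancel g f.
Proof. by have [g fg gf] := lie_aut_bij f; exists g. Qed.

Definition lie_aut_inv f : so44 R -> so44 R := sval (cid (lie_aut_inv_exists f)).

Lemma lie_aut_invK f : cancel f (lie_aut_inv f).
Proof. by rewrite /lie_aut_inv; case: cid => g []. Qed.

Lemma lie_autK f : cancel (lie_aut_inv f) f.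
Proof. by rewrite /lie_aut_inv; case: cid => g []. Qed.

Lemma lie_autV_subproof f : `[< is_lie_aut (lie_aut_inv f) >].
Proof.
apply/asboolP; split=> [a X Y|X Y|].
- by apply: (can_inj (lie_aut_invK f)); rewrite lie_autL !lie_autK.
- by apply: (can_inj (lie_aut_invK f)); rewrite lie_aut_bracket !lie_autK.
- by exists f; [exact: lie_autK|exact: lie_aut_invK].
Qed.

Definition lie_autV f := LieAut (lie_autV_subproof f).

Lemma lie_autMA : associative lie_autM.
Proof. by move=> f g h; apply: lie_aut_ext. Qed.
Lemma lie_aut1M : left_id lie_aut1 lie_autM.
Proof. by move=> f; apply: lie_aut_ext. Qed.
Lemma lie_autM1 : right_id lie_aut1 lie_autM.
Proof. by move=> f; apply: lie_aut_ext. Qed.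
Lemma lie_autVM : left_inverse lie_aut1 lie_autV lie_autM.
Proof. by move=> f; apply: lie_aut_ext => X; exact: lie_aut_invK. Qed.
Lemma lie_autMV : right_inverse lie_aut1 lie_autV lie_autM.
Proof. by move=> f; apply: lie_aut_ext => X; exact: lie_autK. Qed.

HB.instance Definition _ :=
  isGroup.Build (lie_aut R) lie_autMA lie_aut1M lie_autM1 lie_autVM lie_autMV.

End LieAutGroup.

(* [g = exp (ad X)], the exponential series of [ad X = lie_bracket X] being
   summed pointwise in 'M[R]_8; on this finite-dimensional space that is the
   same as summing it for an operator norm.  Every [X] has such a [g], because
   [ad X] is a derivation. *)
Definition is_exp_ad (R : realType) (X : so44 R) (g : lie_aut R) : Prop :=
  forall Y : so44 R,
    series (fun k => (k`!%:R)^-1 *: so44_mx (iter k (lie_bracket X) Y)) @ \oo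
      --> so44_mx (g Y).

(* Each [exp (ad X)] is joined to the identity by the path [exp (t ad X)], so
   the subgroup they generate is the connected subgroup of the definition. *)
Definition inner_set (R : realType) : set (lie_aut R) :=
  generated_subgroup [set g | exists X : so44 R, is_exp_ad X g].
Arguments inner_set R : clear implicits.

Section InnerNormal.
Context (R : realType).

Definition so44_proj_mx (M : 'M[R]_8) : 'M[R]_8 :=
  2^-1 *: (M - I44 R *m M^T *m I44 R).

Lemma I44_sqr : I44 R *m I44 R = 1%:M.
Proof.
rewrite /I44 mulmx_diag -diag_const_mx; congr diag_mx.
apply/matrixP=> i j; rewrite !mxE; case: ifP => _; rewrite ?mulr1 //.
by rewrite mulrNN mulr1.
Qed.

Lemma I44_tr : (I44 R)^T = I44 R.
Proof. exact: tr_diag_mx. Qed.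

Lemma so44_proj_subproof M : in_so44 (so44_proj_mx M).
Proof.
rewrite /in_so44 /so44_proj_mx linearZ /= -scalemxAl -scalemxAr -scalerDr.
rewrite linearB /= !trmx_mul trmxK I44_tr mulmxBl mulmxBr !mulmxA I44_sqr mul1mx.
rewrite -!mulmxA I44_sqr mulmx1.
by rewrite -(opprB (I44 R *m M)) addNr scaler0.
Qed.

Definition so44_proj M := So44 (so44_proj_subproof M).

Lemma so44_projK (X : so44 R) : so44_proj X = X.
Proof.
apply: val_inj => /=; rewrite /so44_proj_mx.
have := so44P X; rewrite /in_so44 addr_eq0 => /eqP HX.
rewrite -mulmxA HX mulmxN mulmxA I44_sqr mul1mx opprK.
by rewrite -mulr2n -(@scaler_nat R _ 2 (so44_mx X)) scalerA mulVf ?scale1r //.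
Qed.

Lemma so44_proj_linear : linear so44_proj.
Proof.
move=> a X Y; apply: val_inj => /=; rewrite /so44_proj_mx.
rewrite [in LHS]linearP /= mulmxDr mulmxDl -scalemxAr -scalemxAl.
rewrite opprD addrACA -scalerBr scalerDr; congr (_ + _).
by rewrite !scalerA mulrC.
Qed.

Lemma linear_mx_continuous (f : 'M[R]_8 -> 'M[R]_8) :
  linear f -> continuous f.
Proof.
move=> fl.
pose F : {linear 'M[R]_8 -> 'M[R]_8} :=
  HB.pack f (GRing.isLinear.Build _ _ _ _ f fl).
have -> : f = fun M : 'M[R]_8 => \sum_i \sum_j M i j *: f (delta_mx i j).
  apply/funext=> M; rewrite -[f]/(F : _ -> _) {1}(matrix_sum_delta M) linear_sum.
  apply: eq_bigr => i _; rewrite linear_sum; apply: eq_bigr => j _.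
  by rewrite linearZ.
have addC : continuous (fun z : 'M[R]_8 * 'M[R]_8 => z.1 + z.2).
  exact: add_continuous.
have big (h : 'I_8 -> 'M[R]_8 -> 'M[R]_8) :
    (forall i, continuous (h i)) -> continuous (fun M => \sum_i h i M).
  by move=> ch; exact: (continuous_big addC (fun i _ => ch i)).
apply: (big (fun i M => \sum_j M i j *: f (delta_mx i j))) => i.
apply: (big (fun j M => M i j *: f (delta_mx i j))) => j M.
have ct : N i j @[N --> M] --> M i j by exact: coord_continuous.
exact: (@cvgZr_tmp R 'M[R]_8 'M[R]_8 (nbhs M) _ _ _ (f (delta_mx i j)) ct).
Qed.

Lemma is_exp_ad_conj (X : so44 R) (e g : lie_aut R) :
  is_exp_ad X e -> is_exp_ad ((g^-1)%g X) (e ^ g)%g.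
Proof.
move=> Xe Y.
pose h : lie_aut R := (g^-1)%g.
have hl : linear h := @lie_autL R h.
pose H : {linear so44 R -> so44 R} :=
  HB.pack (h : _ -> _) (GRing.isLinear.Build _ _ _ _ (h : _ -> _) hl).
pose P : {linear 'M[R]_8 -> so44 R} :=
  HB.pack so44_proj (GRing.isLinear.Build _ _ _ _ so44_proj so44_proj_linear).
pose F (M : 'M[R]_8) : 'M[R]_8 := so44_mx (H (P M)).
have Fl : linear F.
  by move=> a A B; rewrite /F !linearP.
pose FL : {linear 'M[R]_8 -> 'M[R]_8} :=
  HB.pack F (GRing.isLinear.Build _ _ _ _ F Fl).
have FE (Z : so44 R) : F Z = h Z by rewrite /F /= so44_projK.
have -> : so44_mx ((e ^ g)%g Y) = F (e (g Y)) by rewrite FE.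
have hg : h (g Y) = Y by exact: lie_aut_invK.
have it k : iter k (lie_bracket (h X)) Y = h (iter k (lie_bracket X) (g Y)).
  elim: k => [|k IH]; first by rewrite -{1}hg.
  by rewrite !iterS IH -(lie_aut_bracket h).
have -> : series (fun k => (k`!%:R)^-1 *: so44_mx (iter k (lie_bracket (h X)) Y))
  = F \o series (fun k => (k`!%:R)^-1 *: so44_mx (iter k (lie_bracket X) (g Y))).
  apply/funext=> n; rewrite /series /= -[F]/(FL : _ -> _) linear_sum.
  by apply: eq_bigr => k _; rewrite linearZ /= FE it.
apply: continuous_cvg; last exact: Xe.
exact: linear_mx_continuous.
Qed.

Lemma inner_closed : group_closed (mem (inner_set R)).
Proof.
split=> [|x y].
  by rewrite /= inE => H [[]]; rewrite /= inE.
rewrite /= !inE => Hx Hy H HH; have [[_ Hd] _] := HH.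
have := Hd x y; rewrite /= !inE; apply; [exact: Hx|exact: Hy].
Qed.

Lemma inner_normal (x y : lie_aut R) :
  x \in inner_set R -> (x ^ y)%g \in inner_set R.
Proof.
rewrite !inE => xI H [[H1 Hd] HA].
apply: (xI [set z | H (z ^ y)%g]); split=> [|z [X Xz]]; last first.
  by apply: HA; exists ((y^-1)%g X); exact: is_exp_ad_conj.
split=> [|a b]; rewrite /=.
  by rewrite inE /= conj1g; rewrite /= inE in H1.
rewrite !inE /= => Ha Hb.
by have := Hd (a ^ y)%g (b ^ y)%g; rewrite /= !inE conjMg conjVg; exact.
Qed.

End InnerNormal.

Definition inner_subgroup (R : realType) : normal_subgroup (lie_aut R) :=
  NormalSubgroup (@inner_closed R) (@inner_normal R).

Definition outer_aut (R : realType) : groupType :=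
  quotient_group (inner_subgroup R).

(* Main.v *)
Require Import Defs.
From HB Require Import structures.
From mathcomp Require Import all_boot all_order all_fingroup all_algebra.
From mathcomp Require Import spectral sesquilinear complex.
From mathcomp Require Import all_classical all_reals all_analysis.
From mathcomp Require Import ring lra.

(** Write theta(X) = - X^T for the Cartan involution of g = so(4,4) and
    g = k + p for its eigenspaces.  Here k = so(4) + so(4) is the sum of four
    ideals, each a copy of R^3 with (twice) the cross product, and p is the
    16-dimensional space of real 4 x 4 matrices, on which k acts as on a
    real form of the tensor product of the spin-1/2 representations of its four
    summands.  The symmetric group S_4 is the group of permutations of the four
    ideals.

    Every automorphism is f = k n with n inner and k commuting with theta
    (polar_decomposition).  Indeed theta itself is exp(ad X0), so its conjugate
    under f is exp(ad X) for another X, that is conjugation by a matrix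
    w = exp X of O(4,4).  Since f preserves the trace form tr(XY), a multiple
    of the Killing form, w is up to sign m I with m positive definite, and the
    exponential of - (log m) / 2 conjugates w to I.  Now k permutes the ideals
    of the compact part, because a morphism between copies of (R^3, x) is
    either zero or a rotation (theta_comm_permutes); this permutation is
    attached to f.  Three facts make it an isomorphism from Out(g) to S_4.

    - It depends only on f: an inner n that commutes with theta fixes each
      ideal (inner_permutes1).  Every exp(ad X) is conjugation by
      exp X = exp(X/2)^2, a square in O(4,4), and the sign of the determinant
      of the upper left block is multiplicative on O(4,4); so n is conjugation
      by a matrix u whose upper left block has positive determinant.  If n
      commutes with theta, then u is block diagonal, and a matrix of positive
      determinant cannot exchange the two ideals of so(4), because the Pfaffian
      is positive on one and negative on the other.  The remaining ideals
      reduce to the first one because the inner automorphisms form a normal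
      subgroup.

    - The kernel is inner (permutes1_inner): an automorphism that fixes each
      ideal acts on it by a rotation, a product of half-turns, which are
      exponentials; after removing them it is trivial on k, hence a scalar on p
      by a Schur argument, and the scalar is 1 or - 1: the automorphism is the
      identity or theta.

    - It is onto (perm_aut): the transpositions (0 1) and (2 3) come from
      orientation-reversing isometries of the two copies of R^4, and (1 2), a
      triality automorphism, from the exchange of two tensor factors of p. *)

Set Implicit Arguments.
Unset Strict Implicit.
Unset Printing Implicit Defensive.

Import Order.TTheory GRing.Theory Num.Theory.
Import numFieldNormedType.Exports.

Local Open Scope ring_scope.
Local Open Scope classical_set_scope.

(** * Real symmetric matrices *)

(** The complexification is Hermitian, so it is unitarily similar to a real
    diagonal matrix; two real matrices that are similar over the complex
    numbers are similar over the reals. *)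
Lemma symmetric_diagonalizable (R : rcfType) n (A : 'M[R]_n) :
  A^T = A -> exists P d, P \in unitmx /\ P *m A = diag_mx d *m P.
Proof.
move=> Asym.
pose c : {rmorphism R -> R[i]} := real_complex R.
have realc m p (B : 'M[R]_(m, p)) : map_mx c B \is a mxOver Num.real.
  apply/mxOverP => i j; rewrite mxE; apply/Creal_ImP.
  by rewrite -complexIm /=.
have cK m p (B : 'M[R[i]]_(m, p)) :
    B \is a mxOver Num.real -> map_mx c (map_mx (@complex.Re R) B) = B.
  move=> /mxOverP Br; apply/matrixP => i j; rewrite !mxE.
  by have /Creal_ReP := Br i j; rewrite -complexRe.
pose Ac := map_mx c A.
have Ach : Ac \is hermsymmx.
  apply: realsym_hermsym (realc _ _ _); rewrite is_hermitianmxE; apply/eqP.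
  by rewrite expr0 scale1r map_mx_id // map_trmx Asym.
have dr := hermitian_spectral_diag_real Ach.
have /hermitian_normalmx /orthomx_spectralP AE := Ach.
have sim : similar_in unitmx Ac (diag_mx (spectral_diag Ac)).
  exists (spectralmx Ac); first exact: spectral_unit.
  apply/similarP; first exact: spectral_unit.
  by rewrite {2}AE !mulmxA mulmxV ?spectral_unit// mul1mx.
have dr2 : diag_mx (spectral_diag Ac) \is a mxOver Num.real.
  apply/mxOverP => i j; rewrite mxE; apply: rpredMn; exact: (mxOverP dr).
have [P /andP[Preal Pu] /(similarP Pu) PA] := real_similar sim (realc _ _ _) dr2.
exists (map_mx (@complex.Re R) P), (map_mx (@complex.Re R) (spectral_diag Ac)).
split; first by rewrite -(map_unitmx c) cK.
apply: (map_mx_inj (f := c)); rewrite !map_mxM map_diag_mx !cK //.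
Qed.

(** * The exponential of a matrix *)

HB.instance Definition _ (R : realType) (m n : nat) :=
  Complete.on 'M[R]_(m.+1, n.+1).

(** Summation along the diagonals of a square covers only its lower left half:
    this isolates the tail that has to be estimated in a Cauchy product. *)
Lemma triangle_sum (V : nmodType) (F : nat -> nat -> V) n :
  \sum_(0 <= k < n) \sum_(0 <= i < k.+1) F i (k - i)%N =
  \sum_(0 <= i < n) \sum_(0 <= j < n | (i + j < n)%N) F i j.
Proof.
transitivity (\sum_(0 <= k < n) \sum_(0 <= i < n | (i < k.+1)%N) F i (k - i)%N).
  rewrite !big_mkord; apply: eq_bigr => k _.
  by rewrite (big_nat_widen _ _ n).
rewrite (exchange_big_dep_nat xpredT) //=.
apply: eq_big_nat => i /andP[_ ltin].
rewrite (eq_bigl (fun k => true && (i <= k)%N)) // -(big_nat_widenl i 0) //.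
rewrite -{1}(add0n i) big_addn.
rewrite (@big_nat_widen _ _ _ 0 (n - i) n) ?leq_subr //.
apply: eq_big => [j|j _]; first by rewrite ltn_subRL.
by rewrite addnK.
Qed.

Lemma mx_cvg (K : numFieldType) (T : Type) (F : set_system T) {FF : Filter F}
    m n (f : T -> 'M[K]_(m.+1, n.+1)) (l : 'M[K]_(m.+1, n.+1)) :
  (forall i j, f x i j @[x --> F] --> l i j) -> f x @[x --> F] --> l.
Proof.
move=> fl; rewrite (matrix_sum_delta l).
rewrite (_ : f = fun x => \sum_i \sum_j f x i j *: delta_mx i j); last first.
  by apply/funext => x; rewrite {1}(matrix_sum_delta (f x)).
apply: cvg_big => [|i _]; first exact: add_continuous.
apply: cvg_big => [|j _]; first exact: add_continuous.
exact: cvgZr_tmp.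
Qed.

Lemma mx_cvg_mul (K : numFieldType) (T : Type) (F : set_system T) {FF : Filter F}
    m n p (f : T -> 'M[K]_(m.+1, n.+1)) (g : T -> 'M[K]_(n.+1, p.+1))
    (a : 'M[K]_(m.+1, n.+1)) (b : 'M[K]_(n.+1, p.+1)) :
  f x @[x --> F] --> a -> g x @[x --> F] --> b ->
  f x *m g x @[x --> F] --> a *m b.
Proof.
move=> fa gb; apply: mx_cvg => i j; rewrite mxE.
under eq_fun do rewrite mxE.
apply: cvg_big => [|k _]; first exact: add_continuous.
apply: cvgM; first exact: (cvg_comp _ _ fa (@coord_continuous _ _ _ i k a)).
exact: (cvg_comp _ _ gb (@coord_continuous _ _ _ k j b)).
Qed.

Section MatrixExponential.
Context (R : realType) (n : nat).
Local Notation M := 'M[R]_n.+1.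
Implicit Types A B Y : M.

Definition exp_term A k : M := (k`!%:R)^-1 *: A ^+ k.

Definition mexp A : M := limn (series (exp_term A)).

Lemma norm_mulmx_le A B : `|A *m B| <= (n.+1%:R * `|A|) * `|B|.
Proof.
rewrite [leLHS]/Num.norm /= mx_normrE; apply: bigmax_le => [|[i j] _] /=.
  by rewrite !mulr_ge0.
rewrite mxE; apply: le_trans (ler_norm_sum _ _ _) _.
have -> : n.+1%:R * `|A| * `|B| = \sum_(k < n.+1) (`|A| * `|B|).
  by rewrite sumr_const card_ord -mulrA mulr_natl.
apply: ler_sum => k _.
have le_entry (C : M) a b : `|C a b| <= `|C|.
  by rewrite [leRHS]/Num.norm /= mx_normrE; exact: (le_bigmax _ _ (a, b)).
by rewrite normrM ler_pM.
Qed.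

Definition opnorm A : R := n.+1%:R * `|A|.

Lemma norm_mulXl_le A Y k : `|A ^+ k *m Y| <= opnorm A ^+ k * `|Y|.
Proof.
elim: k => [|k IH]; first by rewrite !expr0 mul1mx mul1r.
rewrite !exprS -mulmxE -mulmxA; apply: le_trans (norm_mulmx_le _ _) _.
by rewrite -[leRHS]mulrA ler_wpM2l // mulr_ge0.
Qed.

Lemma norm_mulXr_le A Y k : `|Y *m A ^+ k| <= `|Y| * opnorm A ^+ k.
Proof.
elim: k => [|k IH]; first by rewrite !expr0 mulmx1 mulr1.
rewrite !exprSr -mulmxE mulmxA; apply: le_trans (norm_mulmx_le _ _) _.
by rewrite mulrAC mulrA [leRHS]mulrC -/(opnorm A) ler_wpM2l // mulr_ge0.
Qed.

Lemma exp_series_cvg A : series (exp_term A) @ \oo --> mexp A.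
Proof.
suff : cvgn (series (exp_term A)) by [].
apply: normed_cvg.
apply: (@series_le_cvg _ _ (fun k => exp_coeff (opnorm A) k * `|1%:M : M|)) => k /=.
- exact: normr_ge0.
- by rewrite mulr_ge0 // exp_coeff_ge0 // /opnorm mulr_ge0.
- rewrite /exp_term normrZ ger0_norm ?invr_ge0 // /exp_coeff /= mulrAC mulrC.
  by rewrite ler_wpM2r ?invr_ge0 //; have := norm_mulXl_le A 1%:M k; rewrite mulmx1.
- rewrite (_ : series _ = fun m => series (exp_coeff (opnorm A)) m * `|1%:M : M|).
    by apply: is_cvgMr_tmp; exact: is_cvg_series_exp_coeff.
  by apply/funext => m; rewrite /series /= mulr_suml.
Qed.

(** The degree k part of exp(A) Y exp(B).  For B = A' commuting with A and Y = 1
    it is the k-th term of exp(A + A'), and for B = - A it is (ad A)^k Y / k!, so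
    that one Cauchy product serves both purposes. *)
Definition sandwich_term A Y B k : M :=
  \sum_(0 <= i < k.+1) exp_term A i *m Y *m exp_term B (k - i)%N.

(** The binomial formula, in the form in which it bounds a Cauchy product. *)
Lemma exp_coeff_cauchy (a b : R) k :
  \sum_(0 <= i < k.+1) exp_coeff a i * exp_coeff b (k - i)%N = exp_coeff (a + b) k.
Proof.
rewrite /exp_coeff /= addrC exprDn mulr_suml big_mkord; apply: eq_bigr => i _.
rewrite -[in LHS]mulr_natr -mulr_natr.
have fn0 j : (j`!%:R : R) != 0 by rewrite pnatr_eq0 -lt0n fact_gt0.
have := bin_fact (leq_ord i) => /(congr1 (fun m => m%:R : R)); rewrite !natrM => <-.
rewrite !invfM; field.
by rewrite !fn0 pnatr_eq0 -lt0n bin_gt0 leq_ord.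
Qed.

Lemma norm_sandwich_le A Y B i j :
  `|exp_term A i *m Y *m exp_term B j| <=
    exp_coeff (opnorm A) i * exp_coeff (opnorm B) j * `|Y|.
Proof.
rewrite /exp_term -scalemxAl -scalemxAl -scalemxAr !normrZ.
rewrite !ger0_norm ?invr_ge0 // /exp_coeff /=.
rewrite -mulmxA.
have le1 := norm_mulXl_le A (Y *m B ^+ j) i.
have le2 := norm_mulXr_le B Y j.
apply: (@le_trans _ _ ((i`!%:R)^-1 * ((j`!%:R)^-1 *
    (opnorm A ^+ i * (`|Y| * opnorm B ^+ j))))).
  rewrite !ler_wpM2l ?invr_ge0 //; apply: le_trans le1 _.
  by rewrite ler_wpM2l // exprn_ge0 // mulr_ge0.
rewrite le_eqVlt; apply/orP; left; apply/eqP; ring.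
Qed.

(** A Cauchy product.  The difference between the product of the partial sums
    and the partial sum of the product is a sum over i, j < m with i + j >= m;
    it is bounded by the same difference for the scalar series of exp a and
    exp b, where a and b are the norms, and that one tends to 0 because
    exp (a + b) = exp a * exp b. *)
Lemma sandwich_cvg A Y B :
  series (sandwich_term A Y B) @ \oo --> mexp A *m Y *m mexp B.
Proof.
pose S := fun m => series (exp_term A) m *m Y *m series (exp_term B) m.
have Scvg : S m @[m --> \oo] --> mexp A *m Y *m mexp B.
  apply: mx_cvg_mul; last exact: exp_series_cvg.
  apply: mx_cvg_mul; [exact: exp_series_cvg|exact: cvg_cst].
pose a := opnorm A; pose b := opnorm B.
pose e (x : R) := series (exp_coeff x).
pose d m := (e a m * e b m - e (a + b) m) * `|Y|.
have ecvg x : e x m @[m --> \oo] --> expR x by exact: is_cvg_series_exp_coeff.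
have d0 : d m @[m --> \oo] --> (0 : R).
  rewrite -(mul0r `|Y|) -(subrr (expR (a + b))) {1}expRD.
  by apply: cvgMr_tmp; apply: cvgB => //; apply: cvgM.
have bound m : `|S m - series (sandwich_term A Y B) m| <= d m.
  pose F i j : M := exp_term A i *m Y *m exp_term B j.
  pose f i j : R := exp_coeff a i * exp_coeff b j.
  have SE : S m = \sum_(0 <= i < m) \sum_(0 <= j < m) F i j.
    rewrite /S /series /= mulmx_suml mulmx_suml; apply: eq_bigr => i _.
    by rewrite mulmx_sumr.
  have eE : e a m * e b m = \sum_(0 <= i < m) \sum_(0 <= j < m) f i j.
    rewrite /e /series /= mulr_suml; apply: eq_bigr => i _.
    by rewrite mulr_sumr.
  have eE2 : e (a + b) m =
      \sum_(0 <= i < m) \sum_(0 <= j < m | (i + j < m)%N) f i j.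
    rewrite -triangle_sum /e /series /=; apply: eq_bigr => k _.
    by rewrite exp_coeff_cauchy.
  have SE2 : series (sandwich_term A Y B) m =
      \sum_(0 <= i < m) \sum_(0 <= j < m | (i + j < m)%N) F i j.
    by rewrite -triangle_sum.
  rewrite /d SE eE eE2 SE2 -!sumrB.
  apply: le_trans (ler_norm_sum _ _ _) _; rewrite mulr_suml; apply: ler_sum => i _.
  rewrite !(bigID (fun j => (i + j < m)%N) xpredT) /= ![_ + _ - _]addrAC !subrr !add0r.
  apply: le_trans (ler_norm_sum _ _ _) _; rewrite mulr_suml; apply: ler_sum => j _.
  exact: norm_sandwich_le.
have diff0 : S m - series (sandwich_term A Y B) m @[m --> \oo] --> (0 : M).
  apply: norm_cvg0; apply: (squeeze_cvgr (f := fun=> 0) (h := d) _ (cvg_cst _) d0).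
  by near=> m; rewrite normr_ge0 bound.
rewrite -[X in _ --> X]subr0.
rewrite (_ : series _ = fun m => S m - (S m - series (sandwich_term A Y B) m)).
  exact: cvgB.
by apply/funext => m; rewrite subKr.
Unshelve. all: by end_near.
Qed.

Lemma exp_termS A k : k.+1%:R *: exp_term A k.+1 = A *m exp_term A k.
Proof.
rewrite /exp_term scalerA factS natrM invfM mulrA mulfV ?pnatr_eq0 // mul1r.
by rewrite exprS -scalemxAr.
Qed.

Lemma exp_termSr A k : k.+1%:R *: exp_term A k.+1 = exp_term A k *m A.
Proof.
rewrite /exp_term scalerA factS natrM invfM mulrA mulfV ?pnatr_eq0 // mul1r.
by rewrite exprSr -scalemxAl.
Qed.

(** The weight k + 1 of a term of degree (i, k + 1 - i) is split accordingly: the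
    part i strips a factor A on the left, the other part a factor B on the
    right.  This recursion determines the terms without binomial identities. *)
Lemma sandwich_termS A Y B k :
  k.+1%:R *: sandwich_term A Y B k.+1 =
  A *m sandwich_term A Y B k + sandwich_term A Y B k *m B.
Proof.
rewrite {1}/sandwich_term scaler_sumr.
have -> : \sum_(0 <= i < k.+2) k.+1%:R *: (exp_term A i *m Y *m exp_term B (k.+1 - i)%N) =
  \sum_(0 <= i < k.+2) ((i%:R *: exp_term A i) *m Y *m exp_term B (k.+1 - i)%N) +
  \sum_(0 <= i < k.+2) (exp_term A i *m Y *m ((k.+1 - i)%:R *: exp_term B (k.+1 - i)%N)).
  rewrite -big_split /=; apply: eq_big_nat => i /andP[_]; rewrite ltnS => ik.
  move: (exp_term A i) (exp_term B _) => E1 E2.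
  rewrite -!scalemxAl -scalemxAr -scalerDl; congr (_ *: _).
  by rewrite -natrD subnKC.
congr (_ + _).
  rewrite big_nat_recl //= scale0r !mul0mx add0r mulmx_sumr.
  by apply: eq_bigr => i _; rewrite exp_termS subSS !mulmxA.
rewrite big_nat_recr //= subnn scale0r mulmx0 addr0 mulmx_suml.
apply: eq_big_nat => i /andP[_]; rewrite ltnS => ik.
by rewrite subSn // exp_termSr !mulmxA.
Qed.

Lemma sandwich_term0 A Y B : sandwich_term A Y B 0 = Y.
Proof.
by rewrite /sandwich_term big_nat1 /exp_term !expr0 fact0 invr1 !scale1r mul1mx mulmx1.
Qed.

Lemma mexp_unique A l : series (exp_term A) @ \oo --> l -> mexp A = l.
Proof. by move=> Al; apply: cvg_lim => //; exact: norm_hausdorff. Qed.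

Lemma mexpD A B : A *m B = B *m A -> mexp (A + B) = mexp A *m mexp B.
Proof.
move=> AB; apply: mexp_unique.
rewrite -(mulmx1 (mexp A)).
rewrite (_ : exp_term (A + B) = sandwich_term A 1%:M B); first exact: sandwich_cvg.
apply/funext => k.
have comm j : sandwich_term A 1%:M B j *m B = B *m sandwich_term A 1%:M B j.
  rewrite /sandwich_term mulmx_suml mulmx_sumr; apply: eq_bigr => i _.
  rewrite mulmx1 /exp_term -!scalemxAl -!scalemxAr -!scalemxAl; congr (_ *: (_ *: _)).
  have cB : GRing.comm B (A ^+ i * B ^+ (j - i)%N).
    by apply: commrM; apply: commrX => //; rewrite /GRing.comm -!mulmxE AB.
  exact: esym.
elim: k => [|k IH]; first by rewrite sandwich_term0 /exp_term expr0 fact0 invr1 scale1r.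
have k0 : (k.+1%:R : R) != 0 by rewrite pnatr_eq0.
apply: (scalerI k0); rewrite exp_termS sandwich_termS IH comm -mulmxDl //.
Qed.

Lemma mexp0 : mexp 0 = 1%:M.
Proof.
apply: mexp_unique.
apply: cvg_near_cst; near=> m.
rewrite /series /= big_ltn; last by near: m; exists 1%N.
rewrite big_nat_cond big1 => [|[|k] //= _].
  by rewrite addr0 /exp_term expr0 fact0 invr1 scale1r.
by rewrite /exp_term expr0n scaler0.
Unshelve. all: by end_near.
Qed.

Lemma mexpN A : mexp A *m mexp (- A) = 1%:M.
Proof. by rewrite -mexpD ?mulNmx ?mulmxN // subrr mexp0. Qed.

End MatrixExponential.

Section MexpFacts.
Context (R : realType) (n : nat).
Local Notation M := 'M[R]_n.+1.
Implicit Types A B Z J P : M.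

Lemma mexp_intertwine A B Z : A *m Z = Z *m B -> mexp A *m Z = Z *m mexp B.
Proof.
move=> AZ.
have EZ k : exp_term A k *m Z = Z *m exp_term B k.
  rewrite /exp_term -scalemxAl -scalemxAr; congr (_ *: _).
  elim: k => [|k IH]; first by rewrite !expr0 mul1mx mulmx1.
  by rewrite exprS -mulmxE -mulmxA IH mulmxA AZ -mulmxA mulmxE -exprS.
have l1 : series (exp_term A) m *m Z @[m --> \oo] --> mexp A *m Z.
  by apply: mx_cvg_mul; [exact: exp_series_cvg|exact: cvg_cst].
have l2 : series (exp_term A) m *m Z @[m --> \oo] --> Z *m mexp B.
  rewrite (_ : (fun m => _) = fun m => Z *m series (exp_term B) m).
    by apply: mx_cvg_mul; [exact: cvg_cst|exact: exp_series_cvg].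
  apply/funext => m; rewrite /series /= mulmx_suml mulmx_sumr.
  by apply: eq_bigr => k _.
by rewrite -(cvg_lim _ l1) ?(cvg_lim _ l2) //; exact: norm_hausdorff.
Qed.

Lemma mexp_tr A : (mexp A)^T = mexp A^T.
Proof.
have trX k : A^T ^+ k = (A ^+ k)^T.
  elim: k => [|k IH]; first by rewrite !expr0 trmx1.
  by rewrite exprS IH exprSr -!mulmxE trmx_mul.
apply/esym/mexp_unique; apply: mx_cvg => i j; rewrite mxE.
have := cvg_comp _ _ (@exp_series_cvg _ _ A) (@coord_continuous _ _ _ j i (mexp A)).
apply: cvg_trans; rewrite (_ : (fun m => _) = fun m => series (exp_term A) m j i) //.
apply/funext => m; rewrite /series /= !summxE; apply: eq_bigr => k _.
by rewrite /exp_term trX !mxE.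
Qed.

Lemma mexp_diag (d : 'rV[R]_n.+1) : mexp (diag_mx d) = diag_mx (map_mx expR d).
Proof.
apply: mexp_unique; apply: mx_cvg => i j.
have dX k : diag_mx d ^+ k = diag_mx (\row_i (d 0 i ^+ k)) :> M.
  elim: k => [|k IH].
    rewrite expr0 -[LHS]/(1%:M : M) -diag_const_mx; congr diag_mx.
    by apply/rowP => a; rewrite !mxE expr0.
  rewrite exprS IH -mulmxE mulmx_diag; congr diag_mx.
  by apply/rowP => a; rewrite !mxE exprS.
rewrite !mxE (_ : (fun m => _) = fun m => series (exp_coeff (d 0 i)) m *+ (i == j)).
  case: (i == j) => /=; last by rewrite mulr0n; exact: cvg_cst.
  by rewrite !mulr1n; exact: is_cvg_series_exp_coeff.
apply/funext => m; rewrite /series /= summxE -sumrMnl; apply: eq_bigr => k _.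
by rewrite /exp_term dX !mxE mulrC mulrnAl.
Qed.

Lemma mexp_conj_diag P A d : P \in unitmx -> P *m A = diag_mx d *m P ->
  mexp A = invmx P *m diag_mx (map_mx expR d) *m P.
Proof.
move=> Pu PA; rewrite -mexp_diag -mulmxA.
by rewrite (mexp_intertwine (esym PA)) mulKmx.
Qed.

(** Rodrigues' formula: the powers of J alternate between J and J^2 up to sign,
    so the series splits into those of the sine and of the cosine. *)
Lemma mexp_rotation J t : J *m J *m J = - J ->
  mexp (t *: J) = 1%:M + sin t *: J + (1 - cos t) *: (J *m J).
Proof.
move=> J3.
have Jodd k : J ^+ k.*2.+1 = (-1) ^+ k *: J.
  elim: k => [|k IH]; first by rewrite expr0 scale1r.
  rewrite doubleS exprS exprS IH -!scalerAr mulrA !mulmxE in J3 *.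
  by rewrite J3 exprS mulN1r scaleNr scalerN.
have Jeven k : J ^+ k.*2 = (k == 0%N)%:R *: (1%:M + J *m J) - (-1) ^+ k *: (J *m J).
  case: k => [|k]; first by rewrite !expr0 !scale1r addrK.
  rewrite doubleS exprS Jodd scale0r sub0r exprS mulN1r scaleNr opprK.
  by rewrite -scalerAr.
have TE k : exp_term (t *: J) k =
    sin_coeff t k *: J - cos_coeff t k *: (J *m J) + (k == 0%N)%:R *: (1%:M + J *m J).
  rewrite /exp_term exprZn scalerA /sin_coeff /cos_coeff /=.
  move: (odd_double_half k); case: (odd k) (k./2) => j /= <-.
    rewrite add1n Jodd !mul0r !mul1r !scale0r subr0 addr0.
    by rewrite /= doubleK scalerA; congr (_ *: _); ring.
  rewrite add0n Jeven -exprnP !mul0r !mul1r scale0r sub0r double_eq0.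
  case: eqP => [->|_].
    rewrite double0 fact0 !expr0 invr1 !mul1r !scale1r.
    by rewrite addrC.
  rewrite !scale0r sub0r addr0 scalerN scalerA; congr (- (_ *: _)); ring.
apply: mexp_unique.
have -> : series (exp_term (t *: J)) = fun m => series (sin_coeff t) m *: J
   - series (cos_coeff t) m *: (J *m J)
   + (series (fun k => (k == 0%N)%:R) m : R) *: (1%:M + J *m J).
  apply/funext => m; rewrite /series /= !scaler_suml -sumrB -big_split /=.
  by apply: eq_bigr.
rewrite (_ : _ + _ + _ = sin t *: J - cos t *: (J *m J) + 1 *: (1%:M + J *m J)).
  apply: cvgD; first apply: cvgB.
  - by apply: cvgZr_tmp; rewrite sin.unlock; exact: is_cvg_series_sin_coeff.
  - by apply: cvgZr_tmp; rewrite cos.unlock; exact: is_cvg_series_cos_coeff.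
  - apply: cvgZr_tmp; apply: cvg_near_cst; near=> m.
    rewrite /series /= big_ltn; last by near: m; exists 1%N.
    by rewrite big_nat_cond big1 ?addr0 => // -[|k].
by apply/matrixP => i j; move: (J *m J) => J2; rewrite !mxE; ring.
Unshelve. all: by end_near.
Qed.

End MexpFacts.

(** * The group O(4,4) and its adjoint action *)

Section Conjugation.
Context (R : realType).
Local Notation M := 'M[R]_8.
Local Notation I := (I44 R).
Implicit Types (u v w : M) (X Y Z : so44 R) (f g h : lie_aut R).

Lemma so44_mx_inj : injective (@so44_mx R).
Proof. exact: val_inj. Qed.

Lemma so44_trmx X : (so44_mx X)^T = - (I *m X *m I).
Proof.
have := so44P X; rewrite /in_so44 addr_eq0 => /eqP /(congr1 (mulmx^~ I)).
by rewrite -mulmxA I44_sqr mulmx1 mulNmx.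
Qed.

Lemma in_so44_tr (A : M) : A^T = - (I *m A *m I) -> in_so44 A.
Proof.
by move=> AT; rewrite /in_so44 AT mulNmx -!mulmxA I44_sqr mulmx1 addNr.
Qed.

Definition in_O44 u := u^T *m I *m u = I.

(** The inverse of a matrix of O(4,4), written without a matrix inversion so
    that conjugation by any matrix preserves so(4,4). *)
Definition O44_inv u := I *m u^T *m I.

Lemma O44_mulVmx u : in_O44 u -> O44_inv u *m u = 1%:M.
Proof. by rewrite /in_O44 /O44_inv -!mulmxA => ->; exact: I44_sqr. Qed.

Lemma O44_mulmxV u : in_O44 u -> u *m O44_inv u = 1%:M.
Proof. by move/O44_mulVmx/mulmx1C. Qed.

Lemma in_O44_tr u : in_O44 u -> u *m I *m u^T = I.
Proof.
move/O44_mulmxV; rewrite /O44_inv !mulmxA => /(congr1 (mulmx^~ I)).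
by rewrite -mulmxA I44_sqr mulmx1 mul1mx.
Qed.

Lemma in_O44_1 : in_O44 1%:M.
Proof. by rewrite /in_O44 trmx1 mul1mx mulmx1. Qed.

Lemma in_O44_mul u v : in_O44 u -> in_O44 v -> in_O44 (u *m v).
Proof.
move=> Hu Hv; rewrite /in_O44 trmx_mul -!mulmxA (mulmxA I) (mulmxA u^T).
by rewrite (mulmxA _ I) Hu mulmxA.
Qed.

Lemma in_O44_invmx u : in_O44 u -> in_O44 (O44_inv u).
Proof.
move=> Hu; rewrite /in_O44 /O44_inv !trmx_mul I44_tr trmxK !mulmxA.
rewrite -(mulmxA _ I I) I44_sqr mulmx1 -(mulmxA _ u) -(mulmxA I).
by rewrite in_O44_tr // I44_sqr mul1mx.
Qed.

Lemma O44_invM u v : O44_inv (u *m v) = O44_inv v *m O44_inv u.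
Proof. by rewrite /O44_inv trmx_mul !mulmxA -(mulmxA _ I I) I44_sqr mulmx1. Qed.

Lemma conj_in_so44 u X : in_so44 (u *m so44_mx X *m O44_inv u).
Proof.
apply: in_so44_tr; rewrite /O44_inv !trmx_mul I44_tr trmxK so44_trmx.
rewrite !(mulmxN, mulNmx) !mulmxA -[in LHS](mulmxA (I *m u) I I) I44_sqr mulmx1.
by rewrite -[in RHS](mulmxA _ I I) I44_sqr mulmx1.
Qed.

Definition conj_so u X : so44 R := So44 (conj_in_so44 u X).

Lemma conj_so_aut u : in_O44 u -> `[< is_lie_aut (conj_so u) >].
Proof.
move=> Hu; apply/asboolP; split.
- move=> a X Y; apply: so44_mx_inj => /=.
  by rewrite mulmxDr mulmxDl -scalemxAr -scalemxAl.
- move=> X Y; apply: so44_mx_inj; rewrite /= /mx_bracket mulmxBr mulmxBl.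
  have E (A B : M) : u *m (A *m B) *m O44_inv u =
      u *m A *m O44_inv u *m (u *m B *m O44_inv u).
    move: (O44_inv u) (O44_mulVmx Hu) => v vu.
    by rewrite !mulmxA -(mulmxA _ v u) vu mulmx1.
  by rewrite !E.
- have inv1 : O44_inv 1%:M = 1%:M by rewrite /O44_inv trmx1 mulmx1 I44_sqr.
  have E (v w : M) X : v *m w = 1%:M -> v *m (w *m X *m O44_inv w) *m O44_inv v = X.
    move=> vw; rewrite -[RHS]mulmx1 -inv1 -vw O44_invM.
    by move: (O44_inv v) (O44_inv w) => v' w'; rewrite !mulmxA vw mul1mx.
  exists (conj_so (O44_inv u)) => X; apply: so44_mx_inj => /=; apply: E.
    exact: O44_mulVmx.
  exact: O44_mulmxV.
Qed.

Definition Ad u (Hu : in_O44 u) : lie_aut R := LieAut (conj_so_aut Hu).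

(** The automorphism f is conjugation by u.  A relation rather than a function,
    because u is determined by f only up to a scalar. *)
Definition is_Ad u f :=
  in_O44 u /\ forall X, so44_mx (f X) = u *m X *m O44_inv u.

Lemma is_Ad_Ad u (Hu : in_O44 u) : is_Ad u (Ad Hu).
Proof. by []. Qed.

Lemma is_Ad_inj u f g : is_Ad u f -> is_Ad u g -> f = g.
Proof.
by move=> [_ Hf] [_ Hg]; apply: lie_aut_ext => X; apply: so44_mx_inj; rewrite Hf Hg.
Qed.

Lemma is_Ad1 : is_Ad 1%:M 1%g.
Proof.
split; first exact: in_O44_1.
by move=> X; rewrite /O44_inv trmx1 mulmx1 I44_sqr mul1mx mulmx1.
Qed.

Lemma is_AdM u v f g : is_Ad u f -> is_Ad v g -> is_Ad (u *m v) (f * g)%g.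
Proof.
move=> [Hu Hf] [Hv Hg]; split; first exact: in_O44_mul.
move=> X; rewrite [LHS]Hf Hg O44_invM.
by move: (O44_inv u) (O44_inv v) => u' v'; rewrite !mulmxA.
Qed.

Lemma is_AdV u f : is_Ad u f -> is_Ad (O44_inv u) (f^-1)%g.
Proof.
move=> [Hu Hf]; have H := is_Ad_Ad (in_O44_invmx Hu).
suff -> : (f^-1 = Ad (in_O44_invmx Hu))%g by exact: H.
apply: (mulgI f); rewrite mulgV; apply: is_Ad_inj is_Ad1 _.
by rewrite -(O44_mulmxV Hu); apply: is_AdM H.
Qed.

Lemma mexp_O44 X : in_O44 (mexp X).
Proof.
rewrite /in_O44 mexp_tr so44_trmx.
have /mexp_intertwine -> : - (I *m X *m I) *m I = I *m (- so44_mx X).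
  by rewrite mulNmx -!mulmxA I44_sqr mulmx1 mulmxN.
by rewrite -mulmxA (mulmx1C (mexpN _)) mulmx1.
Qed.

Lemma O44_inv_unique u v : in_O44 u -> u *m v = 1%:M -> O44_inv u = v.
Proof.
move=> Hu uv; by rewrite -[LHS]mulmx1 -uv mulmxA O44_mulVmx // mul1mx.
Qed.

Lemma O44_inv_mexp X : O44_inv (mexp X) = mexp (- so44_mx X).
Proof. by apply: O44_inv_unique; [exact: mexp_O44|exact: mexpN]. Qed.

Lemma iter_ad X Y k :
  (k`!%:R)^-1 *: so44_mx (iter k (lie_bracket X) Y) = sandwich_term X Y (- so44_mx X) k.
Proof.
elim: k => [|k IH]; first by rewrite fact0 invr1 scale1r sandwich_term0.
have k0 : (k.+1%:R : R) != 0 by rewrite pnatr_eq0.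
apply: (scalerI k0); rewrite sandwich_termS -IH scalerA factS natrM invfM mulrA.
rewrite mulfV // mul1r iterS /= /mx_bracket mulmxN -scalemxAl -scalemxAr.
by rewrite -scalerBr.
Qed.

Lemma exp_ad_cvg X Y :
  series (fun k => (k`!%:R)^-1 *: so44_mx (iter k (lie_bracket X) Y)) @ \oo
    --> mexp X *m Y *m O44_inv (mexp X).
Proof.
rewrite O44_inv_mexp (_ : (fun k => _) = sandwich_term X Y (- so44_mx X)).
  exact: sandwich_cvg.
by apply/funext => k; rewrite iter_ad.
Qed.

(** (ad X)^k Y / k! is the part of degree k of exp(X) Y exp(- X). *)
Lemma is_exp_adP X f : is_exp_ad X f <-> is_Ad (mexp X) f.
Proof.
split=> [Xf|[_ Xf] Y]; last by rewrite Xf; exact: exp_ad_cvg.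
split=> [|Y]; first exact: mexp_O44.
have H := norm_hausdorff (V := M).
by rewrite -(cvg_lim H (Xf Y)) (cvg_lim H (@exp_ad_cvg X Y)).
Qed.

End Conjugation.

(** * The sign of the upper left block on O(4,4) *)

Section SquaredNorm.
Context (R : realType).

Definition sqn n (x : 'rV[R]_n) : R := (x *m x^T) 0 0.

Lemma sqnE n (x : 'rV[R]_n) : sqn x = \sum_i x 0 i ^+ 2.
Proof. by rewrite /sqn mxE; apply: eq_bigr => i _; rewrite mxE expr2. Qed.

Lemma sqn_ge0 n (x : 'rV[R]_n) : 0 <= sqn x.
Proof. by rewrite sqnE sumr_ge0 // => i _; exact: sqr_ge0. Qed.

Lemma sqn_eq0 n (x : 'rV[R]_n) : (sqn x == 0) = (x == 0).
Proof.
apply/idP/eqP => [|->]; last by rewrite /sqn mul0mx mxE.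
rewrite sqnE psumr_eq0 => [/allP x0|i _]; last exact: sqr_ge0.
apply/rowP => i; rewrite mxE; apply/eqP.
by have := x0 i (mem_index_enum i); rewrite sqrf_eq0.
Qed.

Lemma sqnZ n a (x : 'rV[R]_n) : sqn (a *: x) = a ^+ 2 * sqn x.
Proof. by rewrite /sqn linearZ /= -scalemxAl -scalemxAr !mxE mulrA. Qed.

End SquaredNorm.

Section Sign.
Context (R : realType).
Local Notation M := 'M[R]_8.
Local Notation I := (I44 R).
Implicit Types (u v w : M) (X : so44 R).

Definition ulblock u : 'M[R]_4 := @ulsubmx R 4 4 4 4 u.
Definition urblock u : 'M[R]_4 := @ursubmx R 4 4 4 4 u.
Definition dlblock u : 'M[R]_4 := @dlsubmx R 4 4 4 4 u.
Definition drblock u : 'M[R]_4 := @drsubmx R 4 4 4 4 u.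

Lemma blockK u : @block_mx R 4 4 4 4 (ulblock u) (urblock u) (dlblock u) (drblock u) = u.
Proof. exact: (@submxK R 4 4 4 4). Qed.

Lemma I44E : I = @block_mx R 4 4 4 4 1%:M 0 0 (- 1%:M).
Proof.
have -> : - 1%:M = diag_mx (const_mx (-1)) :> 'M[R]_4 by rewrite diag_const_mx raddfN.
rewrite -diag_const_mx -diag_mx_row /I44; congr diag_mx; apply/rowP => i.
case: (@split_ordP 4 4 i) => j ->; rewrite mxE /=.
  by rewrite (@row_mxEl _ 1 4 4) mxE ltn_ord.
by rewrite (@row_mxEr _ 1 4 4) mxE.
Qed.

Lemma O44_rows (g : M) : in_O44 g ->
  ulblock g *m (ulblock g)^T - urblock g *m (urblock g)^T = 1%:M.
Proof.
move=> /in_O44_tr; rewrite -[in LHS](blockK g) I44E.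
rewrite (@tr_block_mx _ 4 4 4 4) !(@mulmx_block _ 4 4 4 4 4 4).
case/(@eq_block_mx _ 4 4 4 4) => <- _ _ _.
by rewrite !mulmx1 !mulmx0 addr0 add0r mulmxN mulmx1 mulNmx.
Qed.

Lemma I44_form (x y : 'rV[R]_4) :
  ((@row_mx R 1 4 4 x y : 'rV_8) *m I *m (@row_mx R 1 4 4 x y : 'rV_8)^T) 0 0 = sqn x - sqn y.
Proof.
rewrite I44E (@mul_row_block _ 1 4 4 4 4) !mulmx0 mulmx1 addr0 add0r mulmxN mulmx1.
by rewrite (@tr_row_mx _ 1 4 4) (@mul_row_col _ 1 4 4 1) mulNmx mxE [X in _ + X]mxE.
Qed.

(** If x is killed by this matrix, the row (x g11, t x g12) is sent by h to a row
    (0, q), so |x g11|^2 - t^2 |x g12|^2 = - |q|^2 <= 0; but g preserves the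
    form, so |x g11|^2 - |x g12|^2 = |x|^2 and x = 0. *)
Lemma det_pencil_neq0 (g h : M) (t : R) : in_O44 g -> in_O44 h -> 0 <= t <= 1 ->
  \det (ulblock g *m ulblock h + t *: (urblock g *m dlblock h)) != 0.
Proof.
move=> Hg Hh /andP[t0 t1]; apply/det0P => -[x x0 xK].
pose y := x *m ulblock g; pose z := x *m urblock g.
have xyz : sqn y - sqn z = sqn x.
  have := congr1 (fun A => (x *m A *m x^T) 0 0) (O44_rows Hg).
  by rewrite mulmxBr mulmxBl mulmx1 mxE [X in _ + X]mxE /sqn !trmx_mul !mulmxA.
pose q := y *m urblock h + t *: z *m drblock h.
have vh : (@row_mx R 1 4 4 y (t *: z) : 'rV_8) *m h = @row_mx R 1 4 4 0 q.
  rewrite -[in LHS](blockK h) (@mul_row_block _ 1 4 4 4 4); congr (@row_mx R 1 4 4 _ _).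
  by rewrite -xK mulmxDr -scalemxAr -scalemxAl !mulmxA.
have := I44_form y (t *: z).
rewrite -(in_O44_tr Hh) !mulmxA vh -[_ *m h^T *m _]mulmxA -trmx_mul vh I44_form.
rewrite sqnZ /sqn mul0mx [X in X - _]mxE -!/(sqn _) => E.
have q0 := sqn_ge0 q; have x1 : 0 < sqn x.
  by rewrite lt_def sqn_eq0 x0 sqn_ge0.
have : 0 <= (1 - t ^+ 2) * sqn z by rewrite mulr_ge0 ?sqn_ge0 // subr_ge0 expr_le1.
by rewrite mulrBl mul1r; lra.
Qed.

(** The upper left block of g h is the value at t = 1 of a pencil that is
    g11 h11 at t = 0 and never singular in between; the intermediate value
    theorem for the determinant gives equal signs. *)
Lemma det_ulblockM_gt0 (g h : M) : in_O44 g -> in_O44 h ->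
  0 < \det (ulblock g) * \det (ulblock h) -> 0 < \det (ulblock (g *m h)).
Proof.
move=> Hg Hh; rewrite -det_mulmx => det0.
have -> : ulblock (g *m h) = ulblock g *m ulblock h + urblock g *m dlblock h.
  rewrite -[in LHS](blockK g) -[in LHS](blockK h) (@mulmx_block _ 4 4 4 4 4 4).
  by rewrite /ulblock block_mxKul.
set A := ulblock g *m _ in det0 *; set B := urblock g *m _.
(* the determinant of the pencil, as a polynomial in its parameter *)
pose p := \det (map_mx polyC A + 'X *: map_mx polyC B).
have pE t : p.[t] = \det (A + t *: B).
  rewrite -horner_evalE -det_map_mx map_mxD map_mxZ /= horner_evalE hornerX.
  by rewrite -!map_mx_comp !map_mx_id // => x; rewrite /= horner_evalE hornerC.
rewrite ltNge; apply/negP => p1.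
have [t t01 /eqP] : exists2 t, 0 <= t <= 1 & root (- p) t.
  apply: poly_ivt => //; rewrite !hornerN !pE scale0r addr0 scale1r.
  by rewrite oppr_le0 oppr_ge0 p1 ltW.
rewrite hornerN pE => /eqP; rewrite oppr_eq0; apply/negP; exact: det_pencil_neq0.
Qed.

Lemma ulblock1 : ulblock 1%:M = 1%:M.
Proof. by rewrite /ulblock (@scalar_mx_block _ 4 4) block_mxKul. Qed.

Lemma det_ulblock_neq0 (g : M) : in_O44 g -> \det (ulblock g) != 0.
Proof.
move=> Hg; have /(_ 0) := det_pencil_neq0 Hg (in_O44_1 R).
by rewrite lexx ler01 scale0r addr0 ulblock1 mulmx1; exact.
Qed.

Lemma det_ulblock_inv (g : M) : \det (ulblock (O44_inv g)) = \det (ulblock g).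
Proof.
have -> : ulblock (O44_inv g) = (ulblock g)^T; last by rewrite det_tr.
rewrite /O44_inv I44E -[in LHS](blockK g) (@tr_block_mx _ 4 4 4 4).
rewrite !(@mulmx_block _ 4 4 4 4 4 4) /ulblock block_mxKul.
by rewrite !mul1mx !mul0mx !mulmx1 !mulmx0 !addr0.
Qed.

Lemma inner_ind (P : lie_aut R -> Prop) :
  P 1%g -> (forall f g, P f -> P g -> P (f * g^-1)%g) ->
  (forall X f, is_exp_ad X f -> P f) -> forall f, inner_set R f -> P f.
Proof.
move=> P1 PM Pexp f; apply; split=> [|g [X]]; last exact: Pexp.
split=> [|x y]; rewrite !inE //.
exact: PM.
Qed.

(** exp X is the square of exp (X / 2), so its upper left block has positive
    determinant; this sign is multiplicative. *)
Lemma inner_Ad_pos (f : lie_aut R) :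
  inner_set R f -> exists u, is_Ad u f /\ 0 < \det (ulblock u).
Proof.
move: f; apply: inner_ind.
- by exists 1%:M; split; [exact: is_Ad1|rewrite ulblock1 det1].
- move=> f g [u [Hf pf]] [v [Hg pg]]; exists (u *m O44_inv v); split.
    by apply: is_AdM Hf _; exact: is_AdV.
  apply: det_ulblockM_gt0; [by case: Hf|by apply: in_O44_invmx; case: Hg|].
  by rewrite det_ulblock_inv mulr_gt0.
- move=> X f /is_exp_adP Hf; exists (mexp X); split=> //.
  have E : so44_mx X = 2^-1 *: X + 2^-1 *: X :> 'M[R]_8.
    by rewrite -scalerDl -[LHS]scale1r; congr (_ *: _); field.
  have Hu := mexp_O44 (2^-1 *: X).
  rewrite [in X in mexp X]E mexpD //.
  apply: det_ulblockM_gt0 => //.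
  by rewrite -expr2 exprn_even_gt0 //= det_ulblock_neq0.
Qed.

Lemma inner_exp X (f : lie_aut R) : is_exp_ad X f -> inner_set R f.
Proof. by move=> Xf H [_ HA]; apply: HA; exists X. Qed.

Lemma inner_Ad_mexp (X : so44 R) (f : lie_aut R) : is_Ad (mexp X) f -> inner_set R f.
Proof. by move/is_exp_adP; exact: inner_exp. Qed.

Lemma inner1 : inner_set R 1%g.
Proof. by have := nsub1 (inner_subgroup R); rewrite inE. Qed.

Lemma innerM (f g : lie_aut R) : inner_set R f -> inner_set R g -> inner_set R (f * g)%g.
Proof.
by move=> Hf Hg; have := @nsubM _ (inner_subgroup R) f g; rewrite !inE; apply.
Qed.

Lemma innerV (f : lie_aut R) : inner_set R f -> inner_set R (f^-1)%g.
Proof. by move=> Hf; have := @nsubV _ (inner_subgroup R) f; rewrite !inE; apply. Qed.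

Lemma innerJ (f g : lie_aut R) : inner_set R f -> inner_set R (f ^ g)%g.
Proof. by move=> Hf; have := @inner_normal R f g; rewrite !inE; apply. Qed.

End Sign.

(** * Invariance of the trace form *)

Section OperatorTrace.
Context (R : comNzRingType) (n : nat).
Local Notation M := 'M[R]_n.
Implicit Types (A B Z : M) (L K : M -> M).

Definition op_trace L : R := \sum_i \sum_j L (delta_mx i j) i j.

Lemma eq_op_trace L K : L =1 K -> op_trace L = op_trace K.
Proof. by move=> LK; do 2![apply: eq_bigr => ? _]; rewrite LK. Qed.

Lemma op_traceC L K : linear L -> linear K ->
  op_trace (fun Z => L (K Z)) = op_trace (fun Z => K (L Z)).
Proof.
have expand (F : M -> M) (Flin : linear F) Z : F Z = \sum_k \sum_l Z k l *: F (delta_mx k l).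
  pose G : {linear M -> M} := HB.pack F (GRing.isLinear.Build _ _ _ _ F Flin).
  rewrite -[F]/(G : M -> M) {1}(matrix_sum_delta Z) linear_sum; apply: eq_bigr => k _.
  by rewrite linear_sum; apply: eq_bigr => l _; rewrite linearZ.
move=> Ll Kl.
have E (F G : M -> M) (Flin : linear F) : op_trace (fun Z => F (G Z)) =
    \sum_i \sum_j \sum_k \sum_l G (delta_mx i j) k l * F (delta_mx k l) i j.
  do 2![apply: eq_bigr => ? _]; rewrite expand // summxE; apply: eq_bigr => k _.
  by rewrite summxE; apply: eq_bigr => l _; rewrite mxE.
rewrite !E //.
under eq_bigr do rewrite exchange_big /=.
rewrite exchange_big /=; apply: eq_bigr => k _.
under eq_bigr do rewrite exchange_big /=.
rewrite exchange_big /=; apply: eq_bigr => l _.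
by do 2![apply: eq_bigr => ? _]; rewrite mulrC.
Qed.

Lemma op_traceD L K : op_trace (fun Z => L Z + K Z) = op_trace L + op_trace K.
Proof.
rewrite /op_trace -big_split; apply: eq_bigr => i _; rewrite -big_split.
by apply: eq_bigr => j _; rewrite mxE.
Qed.

Lemma op_traceZ a L : op_trace (fun Z => a *: L Z) = a * op_trace L.
Proof.
rewrite /op_trace mulr_sumr; apply: eq_bigr => i _; rewrite mulr_sumr.
by apply: eq_bigr => j _; rewrite mxE.
Qed.

Lemma mul_delta_entry A B i j k l :
  (A *m delta_mx i j *m B) k l = A k i * B j l.
Proof.
rewrite mxE (bigD1 j) //= big1 ?addr0 => [|a aj].
  rewrite mxE (bigD1 i) //= big1 ?addr0 => [|b bi]; rewrite !mxE.
    by rewrite !eqxx mulr1.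
  by rewrite (negPf bi) mulr0.
rewrite mxE big1 ?mul0r // => b _; rewrite mxE (negPf aj) andbF mulr0 //.
Qed.

Lemma op_trace_sandwich A B : op_trace (fun Z => A *m Z *m B) = \tr A * \tr B.
Proof.
rewrite /op_trace /mxtrace mulr_suml; apply: eq_bigr => i _; rewrite mulr_sumr.
by apply: eq_bigr => j _; rewrite mul_delta_entry.
Qed.

Lemma op_trace_sandwich_tr A B : op_trace (fun Z => A *m Z^T *m B) = \tr (A *m B^T).
Proof.
rewrite /op_trace /mxtrace; apply: eq_bigr => i _; rewrite mxE.
by apply: eq_bigr => j _; rewrite trmx_delta mul_delta_entry mxE.
Qed.

End OperatorTrace.

Section Killing.
Context (R : realType).
Local Notation M := 'M[R]_8.
Local Notation I := (I44 R).
Implicit Types (X Y : so44 R) (f : lie_aut R).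

Lemma so44_tr0 X : \tr (so44_mx X) = 0.
Proof.
have : \tr (so44_mx X) = - \tr (so44_mx X).
  rewrite -{1}mxtrace_tr so44_trmx raddfN /= mxtrace_mulC mulmxA I44_sqr mul1mx //.
by move=> ?; lra.
Qed.

(** The trace over g is taken as a trace over all matrices, after projecting onto
    g by Z |-> (Z - I Z^T I) / 2; the terms in Z contribute 8 tr(XY) and those
    in Z^T contribute - 2 tr(XY).  So the Killing form is 6 tr(XY). *)
Lemma killing_trace X Y :
  op_trace (fun Z : M => mx_bracket X (mx_bracket Y (so44_proj_mx Z))) =
  6 * \tr (so44_mx X *m so44_mx Y).
Proof.
have IYI (W : so44 R) : I *m (so44_mx W)^T *m I = - so44_mx W.
  by rewrite so44_trmx mulmxN mulNmx !mulmxA I44_sqr mul1mx -mulmxA I44_sqr mulmx1.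
set x := so44_mx X; set y := so44_mx Y.
pose t (A B : M) := fun Z : M => A *m Z *m B.
pose s (A B : M) := fun Z : M => A *m Z^T *m B.
pose d (A B C D E F G H : M) (u : (M -> M -> M -> M)) := fun Z =>
  u A B Z + (-1) *: u C D Z + (-1) *: u E F Z + u G H Z.
have E : (fun Z : M => mx_bracket x (mx_bracket y (so44_proj_mx Z))) =1
  (fun Z => 2^-1 *: (d (x *m y) 1%:M x y y x 1%:M (y *m x) t Z +
            (-1) *: d (x *m y *m I) I (x *m I) (I *m y) (y *m I) (I *m x)
              I (I *m y *m x) s Z)).
  move=> Z; rewrite /so44_proj_mx /mx_bracket /d /t /s.
  rewrite !mulmx1 !mul1mx -!scalemxAl -!scalemxAr -!scalerBr -!scalemxAl -!scalemxAr.
  rewrite -scalerBr; congr (_ *: _).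
  rewrite !(mulmxBl, mulmxBr) !mulmxA; apply/matrixP => i j.
  move: (x *m y *m Z) (x *m Z *m y) (y *m Z *m x) (Z *m y *m x) => ? ? ? ?.
  rewrite !scaleN1r !opprD !opprK.
  move: (x *m y *m I *m Z^T *m I) (x *m I *m Z^T *m I *m y)
   (y *m I *m Z^T *m I *m x) (I *m Z^T *m I *m y *m x) => ? ? ? ?.
  by rewrite !mxE; ring.
rewrite (eq_op_trace E) op_traceZ op_traceD op_traceZ /d !(op_traceD, op_traceZ) /t /s.
rewrite !op_trace_sandwich !op_trace_sandwich_tr !trmx_mul !I44_tr.
rewrite !so44_tr0 mxtrace1 !mul0r.
have -> : \tr (x *m y *m I *m I) = \tr (x *m y) by rewrite -mulmxA I44_sqr mulmx1.
have -> : \tr (x *m I *m (y^T *m I)) = - \tr (x *m y).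
  by rewrite -mulmxA (mulmxA I) IYI mulmxN raddfN.
have -> : \tr (y *m I *m (x^T *m I)) = - \tr (x *m y).
  by rewrite -mulmxA (mulmxA I) IYI mulmxN raddfN mxtrace_mulC.
have -> : \tr (I *m (x^T *m (y^T *m I))) = \tr (x *m y).
  rewrite mulmxA mxtrace_mulC -mulmxA (mulmxA I) I44_sqr mul1mx.
  by rewrite -mxtrace_tr trmx_mul !trmxK.
by rewrite (mxtrace_mulC y x); field.
Qed.

(** ad (f X) is conjugate to ad X by f, and the trace of an operator does not
    change under conjugation: the Killing form is invariant. *)
Lemma lie_aut_trace f X Y :
  \tr (so44_mx (f X) *m so44_mx (f Y)) = \tr (so44_mx X *m so44_mx Y).
Proof.
suff : 6 * \tr (so44_mx (f X) *m so44_mx (f Y)) = 6 * \tr (so44_mx X *m so44_mx Y).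
  by move=> ?; lra.
rewrite -!killing_trace.
pose F (g : so44 R -> so44 R) (Z : M) : M := so44_mx (g (so44_proj Z)).
pose D (Z : M) := mx_bracket X (mx_bracket Y (so44_proj_mx Z)).
have Fl (g : lie_aut R) : linear (F g).
  by move=> a A B; rewrite /F so44_proj_linear lie_autL.
have brl (W : M) : linear (mx_bracket W).
  move=> a A B; rewrite /mx_bracket mulmxDr mulmxDl -scalemxAr -scalemxAl opprD addrACA.
  by rewrite scalerBr.
have Dl : linear D.
  move=> a A B; rewrite /D.
  by rewrite -[so44_proj_mx _]/(so44_mx (so44_proj _)) so44_proj_linear /= !brl.
have projE (Z : so44 R) : so44_proj_mx Z = Z.
  by rewrite -[LHS]/(so44_mx (so44_proj Z)) so44_projK.
pose DF Z := D (F (lie_autV f) Z).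
have DFl : linear DF by move=> a A B; rewrite /DF (Fl (lie_autV f)) Dl.
have FDF : op_trace (fun Z => F f (DF Z)) = op_trace (fun Z => DF (F f Z)).
  exact: op_traceC (Fl f) DFl.
transitivity (op_trace (fun Z => F f (DF Z))).
  apply: eq_op_trace => Z; rewrite /DF /F /D.
  rewrite -[so44_proj_mx Z]/(so44_mx (so44_proj Z)) projE.
  set W := so44_proj Z.
  rewrite -[mx_bracket Y _]/(so44_mx (lie_bracket Y _)).
  rewrite -[mx_bracket X _]/(so44_mx (lie_bracket X _)) so44_projK.
  by rewrite !lie_aut_bracket [f (lie_autV f _)]lie_autK.
rewrite FDF; apply: eq_op_trace => Z.
by rewrite /DF /D /F so44_projK [lie_autV f _]lie_aut_invK projE.
Qed.

End Killing.

(** * Quaternions and the Lie algebra so(4) *)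

Definition i0 : 'I_4 := @Ordinal 4 0 isT.
Definition i1 : 'I_4 := @Ordinal 4 1 isT.
Definition i2 : 'I_4 := @Ordinal 4 2 isT.
Definition i3 : 'I_4 := @Ordinal 4 3 isT.
Definition c0 : 'I_3 := @Ordinal 3 0 isT.
Definition c1 : 'I_3 := @Ordinal 3 1 isT.
Definition c2 : 'I_3 := @Ordinal 3 2 isT.

Lemma forall_ord4 (P : 'I_4 -> Prop) : P i0 -> P i1 -> P i2 -> P i3 -> forall i, P i.
Proof.
move=> P0 P1 P2 P3 [[|[|[|[|//]]]] lti]; [move: P0|move: P1|move: P2|move: P3];
  by congr P; exact: val_inj.
Qed.

Lemma forall_ord3 (P : 'I_3 -> Prop) : P c0 -> P c1 -> P c2 -> forall i, P i.
Proof.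
by move=> P0 P1 P2 [[|[|[|//]]] lti]; [move: P0|move: P1|move: P2];
  congr P; exact: val_inj.
Qed.

Lemma sum_ord4 (V : nmodType) (F : 'I_4 -> V) : \sum_i F i = F i0 + F i1 + F i2 + F i3.
Proof.
rewrite !big_ord_recl big_ord0 addr0 !addrA.
by congr (F _ + F _ + F _ + F _); apply: val_inj.
Qed.

Lemma sum_ord3 (V : nmodType) (F : 'I_3 -> V) : \sum_i F i = F c0 + F c1 + F c2.
Proof.
rewrite !big_ord_recl big_ord0 addr0 !addrA.
by congr (F _ + F _ + F _); apply: val_inj.
Qed.

Ltac mxring4 := apply/matrixP; apply: forall_ord4; apply: forall_ord4;
  rewrite !mxE ?sum_ord4 /= ?mxE ?sum_ord4 /= ?mxE /= ?mulr1n ?mulr0n; try ring.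

Section Quaternions.
Context (R : realType).
Implicit Types (v w : 'rV[R]_3) (A B : 'M[R]_4).

Definition mx4 (s : seq (seq R)) : 'M[R]_4 := \matrix_(i, j) nth 0 (nth [::] s i) j.

(** Left multiplication by the imaginary quaternion v on R^4 = H. *)
Definition lquat v : 'M[R]_4 :=
  let a := v 0 c0 in let b := v 0 c1 in let c := v 0 c2 in
  mx4 [:: [:: 0; - a; - b; - c];
          [:: a;   0; - c;   b];
          [:: b;   c;   0; - a];
          [:: c; - b;   a;   0]].

(** Right multiplication by the conjugate of v, that is q |-> - q v; with this
    sign the same relations hold as for left multiplication. *)
Definition rquat v : 'M[R]_4 :=
  let a := v 0 c0 in let b := v 0 c1 in let c := v 0 c2 in
  mx4 [:: [::   0;   a;   b;   c];
          [:: - a;   0; - c;   b];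
          [:: - b;   c;   0; - a];
          [:: - c; - b;   a;   0]].

Definition cross v w : 'rV[R]_3 :=
  \row_j nth 0 [:: v 0 c1 * w 0 c2 - v 0 c2 * w 0 c1;
                   v 0 c2 * w 0 c0 - v 0 c0 * w 0 c2;
                   v 0 c0 * w 0 c1 - v 0 c1 * w 0 c0] j.

Lemma crossC v w : cross w v = - cross v w.
Proof. by apply/rowP; apply: forall_ord3; rewrite !mxE /=; ring. Qed.

Lemma crossvv v : cross v v = 0.
Proof. by apply/rowP; apply: forall_ord3; rewrite !mxE /=; ring. Qed.

Definition dot v w : R := (v *m w^T) 0 0.

Lemma dotE v w : dot v w = v 0 c0 * w 0 c0 + v 0 c1 * w 0 c1 + v 0 c2 * w 0 c2.
Proof. by rewrite /dot mxE sum_ord3 !mxE. Qed.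

Lemma lquatM v w : lquat v *m lquat w = lquat (cross v w) - (dot v w)%:M.
Proof. rewrite dotE; mxring4. Qed.

Lemma rquatM v w : rquat v *m rquat w = rquat (cross v w) - (dot v w)%:M.
Proof. rewrite dotE; mxring4. Qed.

Lemma lrquatC v w : lquat v *m rquat w = rquat w *m lquat v.
Proof. mxring4. Qed.

Lemma lquat_tr v : (lquat v)^T = - lquat v.
Proof. mxring4. Qed.

Lemma rquat_tr v : (rquat v)^T = - rquat v.
Proof. mxring4. Qed.

Lemma lquat_linear : linear lquat.
Proof. by move=> a v w; mxring4. Qed.

Lemma rquat_linear : linear rquat.
Proof. by move=> a v w; mxring4. Qed.

Definition lpart A : 'rV[R]_3 :=
  \row_j nth 0 [:: (A i3 i2 + A i1 i0) / 2; (A i1 i3 + A i2 i0) / 2;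
                   (A i2 i1 + A i3 i0) / 2] j.

Definition rpart A : 'rV[R]_3 :=
  \row_j nth 0 [:: (A i3 i2 - A i1 i0) / 2; (A i1 i3 - A i2 i0) / 2;
                   (A i2 i1 - A i3 i0) / 2] j.

(** so(4) is the sum of the two ideals of left and right multiplications. *)
Lemma antisym_quat A : A^T = - A -> A = lquat (lpart A) + rquat (rpart A).
Proof.
move=> AT; have E i j : A i j = - A j i.
  by have /matrixP/(_ j i) := AT; rewrite !mxE => ->.
have D i : A i i = 0 by have := E i i => ?; lra.
apply/matrixP; apply: forall_ord4; apply: forall_ord4; rewrite !mxE /= ?mxE /= ?D.
all: rewrite ?(E i0 i1) ?(E i0 i2) ?(E i0 i3) ?(E i1 i2) ?(E i3 i1) ?(E i2 i3); by field.
Qed.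

Lemma lpartK v w : lpart (lquat v + rquat w) = v.
Proof.
by apply/rowP; apply: forall_ord3; rewrite !mxE /= ; field.
Qed.

Lemma rpartK v w : rpart (lquat v + rquat w) = w.
Proof.
by apply/rowP; apply: forall_ord3; rewrite !mxE /= ; field.
Qed.

End Quaternions.

(** * The Cartan decomposition *)

Section CartanDecomposition.
Context (R : realType).
Local Notation M := 'M[R]_8.
Local Notation I := (I44 R).
Local Notation blk := (@block_mx R 4 4 4 4).
Implicit Types (x y : 'M[R]_(4, 3)) (B C : 'M[R]_4) (X Y : so44 R).

(** A 4 x 3 matrix stands for an element of k: its rows are the components in
    the four ideals, the first two in the upper left so(4), the last two in the
    lower right one. *)
Definition k_left x : 'M[R]_4 := lquat (row i0 x) + rquat (row i1 x).
Definition k_right x : 'M[R]_4 := lquat (row i2 x) + rquat (row i3 x).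

Lemma k_left_tr x : (k_left x)^T = - k_left x.
Proof. by rewrite linearD /= lquat_tr rquat_tr -opprD. Qed.

Lemma k_right_tr x : (k_right x)^T = - k_right x.
Proof. by rewrite linearD /= lquat_tr rquat_tr -opprD. Qed.

Lemma k_left_linear : linear k_left.
Proof.
by move=> a x y; rewrite /k_left !linearP /= lquat_linear rquat_linear scalerDr addrACA.
Qed.

Lemma k_right_linear : linear k_right.
Proof.
by move=> a x y; rewrite /k_right !linearP /= lquat_linear rquat_linear scalerDr addrACA.
Qed.

Lemma I44_conj_blk (A B C D : 'M[R]_4) : I *m blk A B C D *m I = blk A (- B) (- C) D.
Proof.
rewrite I44E !(@mulmx_block _ 4 4 4 4 4 4) !mul1mx !mul0mx !mulmx0 !addr0 !add0r.
by rewrite !mulNmx !mul1mx !mulmxN !mulmx1 opprK.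
Qed.

Lemma in_k_subproof x : in_so44 (blk (k_left x) 0 0 (k_right x)).
Proof.
apply: in_so44_tr; rewrite I44_conj_blk (@tr_block_mx _ 4 4 4 4) k_left_tr k_right_tr.
by rewrite (@opp_block_mx _ 4 4 4 4) !trmx0 !oppr0.
Qed.

Definition in_k x : so44 R := So44 (in_k_subproof x).

Lemma in_p_subproof B : in_so44 (blk 0 B B^T 0).
Proof.
apply: in_so44_tr; rewrite I44_conj_blk (@tr_block_mx _ 4 4 4 4) trmxK.
by rewrite (@opp_block_mx _ 4 4 4 4) !trmx0 !oppr0 !opprK.
Qed.

Definition in_p B : so44 R := So44 (in_p_subproof B).

Lemma in_k_linear : linear in_k.
Proof.
move=> a x y; apply: so44_mx_inj; rewrite /= k_left_linear k_right_linear.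
by rewrite (@scale_block_mx _ 4 4 4 4) (@add_block_mx _ 4 4 4 4) !scaler0 !addr0.
Qed.

Lemma in_p_linear : linear in_p.
Proof.
move=> a x y; apply: so44_mx_inj; rewrite /= linearP /=.
by rewrite (@scale_block_mx _ 4 4 4 4) (@add_block_mx _ 4 4 4 4) !scaler0 !addr0.
Qed.

HB.instance Definition _ := GRing.isLinear.Build _ _ _ _ in_k in_k_linear.
HB.instance Definition _ := GRing.isLinear.Build _ _ _ _ in_p in_p_linear.

Definition k_coord X : 'M[R]_(4, 3) :=
  \matrix_(i, j) (nth 0 [:: lpart (ulblock X); rpart (ulblock X);
                            lpart (drblock X); rpart (drblock X)] i) 0 j.

Definition p_coord X : 'M[R]_4 := urblock X.

Lemma k_coordK x B : k_coord (in_k x + in_p B) = x.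
Proof.
rewrite /k_coord /= (@add_block_mx _ 4 4 4 4) /ulblock /drblock.
rewrite (@block_mxKul _ 4 4 4 4) (@block_mxKdr _ 4 4 4 4) !addr0.
rewrite /k_left /k_right !lpartK !rpartK.
by apply/matrixP; apply: forall_ord4 => j; rewrite !mxE.
Qed.

Lemma p_coordK x B : p_coord (in_k x + in_p B) = B.
Proof.
by rewrite /p_coord /urblock /= (@add_block_mx _ 4 4 4 4) (@block_mxKur _ 4 4 4 4) add0r.
Qed.

Lemma so44_decomp X : X = in_k (k_coord X) + in_p (p_coord X).
Proof.
apply: so44_mx_inj; rewrite /= (@add_block_mx _ 4 4 4 4) !addr0 !add0r.
have := so44_trmx X; rewrite -[in LHS](blockK X) -[in RHS](blockK X) I44_conj_blk.
rewrite (@tr_block_mx _ 4 4 4 4) (@opp_block_mx _ 4 4 4 4) !opprK.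
case/(@eq_block_mx _ 4 4 4 4) => EA EC EB ED.
have -> : k_left (k_coord X) = ulblock X.
  rewrite [RHS](antisym_quat EA) /k_left; congr (lquat _ + rquat _);
  by apply/rowP => j; rewrite !mxE.
have -> : k_right (k_coord X) = drblock X.
  rewrite [RHS](antisym_quat ED) /k_right; congr (lquat _ + rquat _);
  by apply/rowP => j; rewrite !mxE.
by rewrite /p_coord EB blockK.
Qed.

Lemma in_k_in_p_inj x y B C : in_k x + in_p B = in_k y + in_p C -> x = y /\ B = C.
Proof.
move=> E; split; [have := k_coordK x B|have := p_coordK x B];
  by rewrite E ?k_coordK ?p_coordK.
Qed.

Definition rcross x y : 'M[R]_(4, 3) := \matrix_(i, j) cross (row i x) (row i y) 0 j.

Lemma row_rcross i x y : row i (rcross x y) = cross (row i x) (row i y).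
Proof. by apply/rowP => j; rewrite !mxE. Qed.

Lemma quat_comm (v w v' w' : 'rV[R]_3) :
  (lquat v + rquat w) *m (lquat v' + rquat w') - (lquat v' + rquat w') *m (lquat v + rquat w)
  = 2 *: (lquat (cross v v') + rquat (cross w w')).
Proof.
have lN (a : 'rV[R]_3) : lquat (- a) = - lquat a by mxring4.
have rN (a : 'rV[R]_3) : rquat (- a) = - rquat a by mxring4.
have dotC (a b : 'rV[R]_3) : dot b a = dot a b by rewrite !dotE; ring.
rewrite !mulmxDl !mulmxDr !lquatM !rquatM (crossC v v') (crossC w w') lN rN.
rewrite !(dotC v') (dotC w') !lrquatC.
move: (lquat _) (rquat _) (rquat _ *m _) (rquat _ *m _) => A B C D.
by apply/matrixP => i j; rewrite !mxE; ring.
Qed.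

Lemma bracket_kk x y : lie_bracket (in_k x) (in_k y) = in_k (2 *: rcross x y).
Proof.
apply: so44_mx_inj; rewrite linearZ /= /mx_bracket !(@mulmx_block _ 4 4 4 4 4 4).
rewrite !mulmx0 !mul0mx !addr0 !add0r (@opp_block_mx _ 4 4 4 4) (@add_block_mx _ 4 4 4 4).
rewrite !quat_comm (@scale_block_mx _ 4 4 4 4) !oppr0 !addr0 !scaler0.
by rewrite /k_left /k_right !row_rcross.
Qed.

Lemma bracket_kp x B : lie_bracket (in_k x) (in_p B) = in_p (k_left x *m B - B *m k_right x).
Proof.
apply: so44_mx_inj; rewrite /= /mx_bracket !(@mulmx_block _ 4 4 4 4 4 4).
rewrite !mulmx0 !mul0mx !addr0 !add0r (@opp_block_mx _ 4 4 4 4) (@add_block_mx _ 4 4 4 4).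
rewrite linearB /= !trmx_mul k_left_tr k_right_tr mulmxN mulNmx opprK.
by congr (@block_mx R 4 4 4 4 _ _ _ _); rewrite ?oppr0 ?addr0 ?add0r // addrC.

Qed.

Lemma in_O44_I : in_O44 I.
Proof. by rewrite /in_O44 I44_tr I44_sqr mul1mx. Qed.

(** The Cartan involution X |-> - X^T. *)
Definition theta : lie_aut R := Ad in_O44_I.

Lemma theta_mx X : so44_mx (theta X) = I *m X *m I.
Proof. by rewrite /= /O44_inv I44_tr I44_sqr mul1mx. Qed.

Lemma theta_tr X : so44_mx (theta X) = - (so44_mx X)^T.
Proof. by rewrite theta_mx so44_trmx opprK. Qed.

Lemma thetaE x B : theta (in_k x + in_p B) = in_k x - in_p B.
Proof.
apply: so44_mx_inj; rewrite theta_mx /= (@add_block_mx _ 4 4 4 4) I44_conj_blk.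
rewrite (@opp_block_mx _ 4 4 4 4) (@add_block_mx _ 4 4 4 4).
by rewrite !oppr0 !addr0 !add0r.
Qed.

Lemma theta_in_k x : theta (in_k x) = in_k x.
Proof. by have := thetaE x 0; rewrite linear0 addr0 subr0. Qed.

Lemma theta_in_p B : theta (in_p B) = - in_p B.
Proof. by have := thetaE 0 B; rewrite linear0 !add0r. Qed.

Lemma thetaK X : theta (theta X) = X.
Proof.
apply: so44_mx_inj; rewrite !theta_mx !mulmxA I44_sqr mul1mx.
by rewrite -mulmxA I44_sqr mulmx1.
Qed.

Lemma trace_theta X : \tr (so44_mx X *m so44_mx (theta X)) = - \sum_i \sum_j so44_mx X i j ^+ 2.
Proof.
rewrite theta_tr mulmxN raddfN; congr (- _); rewrite /mxtrace; apply: eq_bigr => i _.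
by rewrite mxE; apply: eq_bigr => j _; rewrite mxE expr2.
Qed.

Lemma sum_sqr_eq0 m n (A : 'M[R]_(m, n)) : \sum_i \sum_j A i j ^+ 2 <= 0 -> A = 0.
Proof.
have p i : 0 <= \sum_j A i j ^+ 2 by rewrite sumr_ge0 // => j _; exact: sqr_ge0.
rewrite le_eqVlt ltNge sumr_ge0 // orbF psumr_eq0 // => /allP H.
apply/matrixP => i j; have := H i (mem_index_enum _); rewrite psumr_eq0 => [/allP|k _].
  by move=> /(_ j (mem_index_enum _)); rewrite sqrf_eq0 mxE => /eqP.
exact: sqr_ge0.
Qed.

Lemma trace_bracket X Y Z :
  \tr (mx_bracket X Y *m so44_mx Z) = \tr (so44_mx X *m mx_bracket Y Z).
Proof.
rewrite /mx_bracket mulmxBl mulmxBr !raddfB /= !mulmxA; congr (_ - _).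
by rewrite -(mulmxA (so44_mx Y)) (mxtrace_mulC (so44_mx Y)).
Qed.

Lemma trace_kp x B : \tr (so44_mx (in_k x) *m so44_mx (in_p B)) = 0.
Proof.
rewrite /= (@mulmx_block _ 4 4 4 4 4 4) (@mxtrace_block _ 4 4).
by rewrite !mulmx0 !mul0mx !addr0 !mxtrace0 addr0.
Qed.

Lemma trace_pp B C : \tr (so44_mx (in_p B) *m so44_mx (in_p C)) = 2 * \tr (B^T *m C).
Proof.
rewrite /= (@mulmx_block _ 4 4 4 4 4 4) (@mxtrace_block _ 4 4).
rewrite !mul0mx add0r addr0 mxtrace_mulC -[X in X + _]mxtrace_tr trmx_mul trmxK.
ring.
Qed.

Lemma quat_trace (v w v' w' : 'rV[R]_3) :
  \tr ((lquat v + rquat w) *m (lquat v' + rquat w')) = - (4 * (dot v v' + dot w w')).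
Proof.
have tr_l (u : 'rV[R]_3) : \tr (lquat u) = 0.
  by rewrite /mxtrace sum_ord4 !mxE /= !addr0.
have tr_r (u : 'rV[R]_3) : \tr (rquat u) = 0.
  by rewrite /mxtrace sum_ord4 !mxE /= !addr0.
have tr_lr (a b : 'rV[R]_3) : \tr (lquat a *m rquat b) = 0.
  by rewrite /mxtrace sum_ord4 !mxE !sum_ord4 !mxE /=; ring.
rewrite mulmxDl !mulmxDr lquatM rquatM -lrquatC !raddfD /= !raddfN /= !tr_lr !tr_l !tr_r.
rewrite !mxtrace_scalar; ring.
Qed.

Lemma trace_kk x y :
  \tr (so44_mx (in_k x) *m so44_mx (in_k y)) = - (4 * \sum_i \sum_j x i j * y i j).
Proof.
rewrite /= (@mulmx_block _ 4 4 4 4 4 4) (@mxtrace_block _ 4 4) !mul0mx addr0 add0r.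
rewrite /k_left /k_right !quat_trace /dot.
have E i : (row i x *m (row i y)^T) 0 0 = \sum_j x i j * y i j.
  by rewrite mxE; apply: eq_bigr => j _; rewrite !mxE.
rewrite !E sum_ord4; ring.
Qed.

End CartanDecomposition.

(** * The polar decomposition of an automorphism *)

HB.instance Definition _ (R : realType) (f : lie_aut R) :=
  GRing.isLinear.Build R (so44 R) (so44 R) _ f (@lie_autL R f).

Section Polar.
Context (R : realType).
Local Notation M := 'M[R]_8.
Local Notation I := (I44 R).
Implicit Types (u w m z D : M) (X Y : so44 R) (f g : lie_aut R).

Definition sgn_row : 'rV[R]_8 := \row_i (if (i < 4)%N then 1 else -1).

Lemma sgn_row_neq0 i : sgn_row 0 i != 0.
Proof. by rewrite mxE; case: ifP => _; rewrite ?oppr_eq0 oner_eq0. Qed.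

Lemma skew_in_so44 (x y : 'rV[R]_8) : in_so44 (I *m (x^T *m y - y^T *m x)).
Proof.
have ST : (x^T *m y - y^T *m x)^T = - (x^T *m y - y^T *m x).
  by rewrite linearB /= !trmx_mul !trmxK opprB.
by apply: in_so44_tr; rewrite trmx_mul I44_tr ST mulmxA I44_sqr mul1mx mulNmx.
Qed.

(** Elements of so(4,4) of rank two, on which the twisted trace form can be
    computed by hand. *)
Definition skew (x y : 'rV[R]_8) : so44 R := So44 (skew_in_so44 x y).

(** Comparison of the entries of z X and X z for X = I (E_ij - E_ji). *)
Lemma commutant_so44_scalar z : (forall X, z *m X = so44_mx X *m z) -> exists c, z = c%:M.
Proof.
move=> zC.
have E i j a b :=
  congr1 (fun A : M => A a b) (zC (skew (delta_mx 0 i) (delta_mx 0 j))).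
have S i j a b : i != j -> z a i * sgn_row 0 i *+ (j == b) - z a j * sgn_row 0 j *+ (i == b)
    = sgn_row 0 a * (z j b *+ (a == i) - z i b *+ (a == j)).
  move=> ij; have := E i j a b; rewrite /= !trmx_delta !mul_delta_mx.
  rewrite mulmxA -[I]/(diag_mx sgn_row) mul_mx_diag -mulmxA mul_diag_mx mulmxBl mulmxBr.
  rewrite [RHS]mxE.
  have dl (A : M) k l : (A *m delta_mx k l) a b = A a k *+ (l == b).
    by rewrite -[_ *m _]mulmx1 mul_delta_entry !mxE mulr_natr.
  have dr (A : M) k l : (delta_mx k l *m A) a b = A l b *+ (a == k).
    by rewrite -[delta_mx _ _]mul1mx mul_delta_entry !mxE mulr_natl.
  by rewrite [in LHS]mxE [X in _ + X]mxE !dl [X in _ * X]mxE [X in _ * (_ + X)]mxE !dr !mxE.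
have off a i : a != i -> z a i = 0.
  move=> ai; have [j /andP[ja ji]] : exists j, (j != a) && (j != i).
    have : (1 < #|[predC pred2 a i]|)%N.
      by rewrite -(ltn_add2l #|pred2 a i|) cardC card2 ai card_ord.
    by move=> /ltnW /card_gt0P[j]; rewrite !inE negb_or => H; exists j.
  have ij : (i == j) = false by rewrite eq_sym; exact: negbTE.
  have aj : (a == j) = false by rewrite eq_sym; exact: negbTE.
  have := S i j a j; rewrite ij aj (negbTE ai) eqxx mulr1n !mulr0n !subr0 mulr0.
  move=> /(_ isT) /eqP.
  by rewrite mulf_eq0 (negPf (sgn_row_neq0 i)) orbF => /eqP.
have diag i j : z i i = z j j.
  have [->//|ij] := eqVneq i j.
  have := S i j i j ij; rewrite !eqxx (negPf ij) !mulr1n !mulr0n !subr0 mulrC.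
  by move=> /(mulfI (sgn_row_neq0 i)).
exists (z 0 0); apply/matrixP => i j; rewrite mxE.
by have [->|ij] := eqVneq i j; [rewrite (diag j 0)|rewrite off].
Qed.

Definition bform m (x y : 'rV[R]_8) : R := (x *m m *m y^T) 0 0.

Lemma bform_tr m x y : bform m x y = bform m^T y x.
Proof.
rewrite /bform; transitivity ((x *m m *m y^T)^T 0 0); first by rewrite [RHS]mxE.
by rewrite !trmx_mul trmxK mulmxA.
Qed.

Lemma trace_rank1 (x y : 'rV[R]_8) : \tr (x^T *m y) = (y *m x^T) 0 0.
Proof. by rewrite mxtrace_mulC /mxtrace big_ord1. Qed.

Lemma trace_skew m x y :
  \tr ((x^T *m y - y^T *m x) *m m *m (x^T *m y - y^T *m x) *m m) =
  bform m y x ^+ 2 + bform m x y ^+ 2 - 2 * bform m x x * bform m y y.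
Proof.
have E (a b c d : 'rV[R]_8) :
    \tr (a^T *m b *m m *m (c^T *m d) *m m) = bform m b c * bform m d a.
  rewrite -!mulmxA trace_rank1 /bform.
  have -> : b *m (m *m (c^T *m (d *m m))) *m a^T = (b *m m *m c^T) *m (d *m m *m a^T).
    by rewrite !mulmxA.
  by rewrite mxE big_ord1.
rewrite !mulmxBl !mulmxBr !mulmxBl !raddfB /= !E; ring.
Qed.

Lemma skew_neq0 (x y : 'rV[R]_8) i j :
  x 0 i * y 0 j - y 0 i * x 0 j != 0 -> skew x y != 0.
Proof.
apply: contra_neq => /(congr1 (fun X : so44 R => (I *m X) i j)).
rewrite /= mulmxA I44_sqr mul1mx mulmx0 => E.
by move: E; rewrite !mxE !big_ord1 !mxE.
Qed.

Lemma trace_theta_lt0 X : X != 0 -> \tr (so44_mx X *m so44_mx (theta R X)) < 0.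
Proof.
move=> X0; rewrite trace_theta oppr_lt0 lt_def; apply/andP; split.
  apply: contra_neq X0 => E; apply: so44_mx_inj; apply: sum_sqr_eq0.
  by rewrite E.
by rewrite sumr_ge0 // => i _; rewrite sumr_ge0 // => j _; exact: sqr_ge0.
Qed.

Lemma theta_sqr : (theta R * theta R = 1)%g.
Proof. by apply: lie_aut_ext => X; exact: thetaK. Qed.

(** The strict Cauchy-Schwarz inequality makes the values of the quadratic form
    at independent vectors have the same sign. *)
Lemma bform_definite m : m^T = m ->
  (forall (x y : 'rV[R]_8) i j, x 0 i * y 0 j - y 0 i * x 0 j != 0 ->
     bform m x y ^+ 2 < bform m x x * bform m y y) ->
  exists e : R, e ^+ 2 = 1 /\ forall x, x != 0 -> 0 < bform (e *: m) x x.
Proof.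
move=> msym H; pose d (k : 'I_8) : 'rV[R]_8 := delta_mx 0 k.
have prod_gt0 (x y : 'rV[R]_8) i j :
    x 0 i * y 0 j - y 0 i * x 0 j != 0 -> 0 < bform m x x * bform m y y.
  by move=> /H; apply: le_lt_trans; exact: sqr_ge0.
pose q0 := bform m (d 0) (d 0).
have q0_neq0 : q0 != 0.
  have : 0 < q0 * bform m (d 1) (d 1).
    by apply: (prod_gt0 _ _ 0 1); rewrite !mxE /= mulr1 mulr0 subr0 oner_eq0.
  by apply: contraTneq => ->; rewrite mul0r ltxx.
have pos x : x != 0 -> 0 < q0 * bform m x x.
  move=> x0; have [/existsP[j /andP[j0 xj]]|/existsPn H0] :=
      boolP [exists j, (j != 0) && (x 0 j != 0)].
    apply: (prod_gt0 _ _ 0 j); by rewrite !mxE !eqxx (negbTE j0) mul1r mulr0 subr0.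
  have xE : x = x 0 0 *: d 0.
    apply/rowP => j; rewrite !mxE; have [->|j0] := eqVneq j 0.
      by rewrite !eqxx mulr1.
    by have := H0 j; rewrite j0 /= negbK => /eqP ->; rewrite mulr0.
  have a0 : x 0 0 != 0 by apply: contra_neq x0 => a0; rewrite xE a0 scale0r.
  have -> : bform m x x = x 0 0 ^+ 2 * q0.
    by rewrite {1 2}xE /bform linearZ /= -!scalemxAl -scalemxAr scalerA mxE expr2.
  by rewrite mulrCA -expr2 mulr_gt0 // exprn_even_gt0.
exists (Num.sg q0); split; first by rewrite sqr_sg q0_neq0.
move=> x /pos; have -> : bform (Num.sg q0 *: m) x x = Num.sg q0 * bform m x x.
  by rewrite /bform -scalemxAr -scalemxAl mxE.
rewrite -sgr_gt0 sgrM => H1; rewrite -sgr_gt0 sgrM sgr_id //.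
Qed.

(** In a basis that diagonalizes m, take the logarithms of the eigenvalues.  The
    relations m^T = m and m I m = I pass to the logarithm entrywise: for
    instance d_i d_j c_ij = c_ij means that c_ij = 0 or d_i d_j = 1, hence
    that (ln d_i + ln d_j) c_ij = 0. *)
Lemma posdef_log m : m^T = m -> (forall x, x != 0 -> 0 < bform m x x) -> m *m I *m m = I ->
  exists X, (so44_mx X)^T = so44_mx X /\ mexp X = m.
Proof.
move=> msym mpos mIm; have [P [d [Pu PmE]]] := symmetric_diagonalizable msym.
have d_gt0 i : 0 < d 0 i.
  have rP0 : row i P != 0.
    apply: contraTneq Pu => r0; rewrite unitmxE unitfE negbK; apply/det0P.
    exists (delta_mx 0 i); last by rewrite -rowE.
    by apply/eqP => /rowP /(_ i) /eqP; rewrite !mxE !eqxx oner_eq0.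
  have E : bform m (row i P) (row i P) = d 0 i * sqn (row i P).
    have rE : row i (diag_mx d *m P) = d 0 i *: row i P.
      by apply/rowP => k; rewrite mxE mul_diag_mx !mxE.
    by rewrite /bform -row_mul PmE rE -scalemxAl mxE.
  have := mpos _ rP0; rewrite E pmulr_lgt0 // lt_def sqn_eq0 rP0; exact: sqn_ge0.
pose e : 'rV[R]_8 := map_mx (@ln R) d.
have expe : map_mx expR e = d.
  by apply/rowP => i; rewrite !mxE lnK // posrE.
pose D := invmx P *m diag_mx e *m P.
have PD : P *m D = diag_mx e *m P by rewrite /D !mulmxA mulmxV // mul1mx.
have DP : D *m invmx P = invmx P *m diag_mx e.
  by rewrite /D -mulmxA mulmxV // mulmx1.
have Dexp : mexp D = m.
  by rewrite (mexp_conj_diag Pu PD) expe -mulmxA -PmE mulKmx.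
clearbody D.
have ln_mul i j : d 0 i * d 0 j = 1 -> e 0 i + e 0 j = 0.
  by move=> dd; rewrite !mxE -lnM ?posrE // dd ln1.
have Dsym : D^T = D.
  pose G := P *m P^T.
  have dG : diag_mx d *m G = G *m diag_mx d.
    rewrite /G mulmxA -PmE -!mulmxA; congr (_ *m _).
    by have /(congr1 trmx) := PmE; rewrite !trmx_mul tr_diag_mx msym.
  have eG : diag_mx e *m G = G *m diag_mx e.
    apply/matrixP => i j; have /matrixP/(_ i j) := dG.
    rewrite !mul_diag_mx !mul_mx_diag !mxE; set g := \sum_k _ => E.
    have : (d 0 i - d 0 j) * g = 0 by rewrite mulrBl E mulrC subrr.
    move=> /eqP; rewrite mulf_eq0 subr_eq0 => /orP[/eqP ->|/eqP ->].
      by rewrite mulrC.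
    by rewrite mulr0 mul0r.
  have PTu : P^T \in unitmx by rewrite unitmx_tr.
  apply: (can_inj (mulKmx Pu)); apply: (can_inj (mulmxK PTu)).
  rewrite PD -[RHS]mulmxA -/G eG -[LHS]mulmxA -trmx_mul.
  by rewrite -[P *m _]/(P *m _) PD trmx_mul tr_diag_mx mulmxA.
have DI : D *m I = - (I *m D).
  pose C := P *m I *m invmx P.
  have mP : m *m invmx P = invmx P *m diag_mx d.
    by apply: (can_inj (mulKmx Pu)); rewrite mulmxA PmE mulmxK // mulKVmx.
  have dC : diag_mx d *m C *m diag_mx d = C.
    rewrite /C !mulmxA -PmE -!mulmxA -mP !mulmxA.
    by rewrite -(mulmxA P) -(mulmxA P) mIm.
  have eC : diag_mx e *m C + C *m diag_mx e = 0.
    move: C dC => C dC; apply/matrixP => i j; have /matrixP/(_ i j) := dC.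
    rewrite !mul_mx_diag !mul_diag_mx !mxE; set g := C i j => E.
    have : (d 0 i * d 0 j - 1) * g = 0.
      by rewrite mulrBl mul1r -[X in _ - X]E; ring.
    move=> /eqP; rewrite mulf_eq0 subr_eq0 => /orP[/eqP /ln_mul|/eqP ->].
      by rewrite !mxE => E2; rewrite [g * _]mulrC -mulrDl E2 mul0r.
    by rewrite mulr0 mul0r addr0.
  apply/eqP; rewrite -addr_eq0; apply/eqP.
  have iPu : invmx P \in unitmx by rewrite unitmx_inv.
  apply: (can_inj (mulKmx Pu)); apply: (can_inj (mulmxK iPu)).
  rewrite mulmx0 mul0mx -eC /C mulmxDr mulmxDl !mulmxA PD; congr (_ + _).
  by rewrite -!mulmxA DP.
have Dso : in_so44 D.
  by apply: in_so44_tr; rewrite -mulmxA DI mulmxN opprK mulmxA I44_sqr mul1mx.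
by exists (So44 Dso).
Qed.

(** The conjugate of theta by f is again an exponential, so it is conjugation by
    a matrix w of O(4,4) with w^2 = c, c = 1 or - 1.  As f preserves the trace
    form, tr(X . w X w^-1) is negative definite.  Tested on elements of rank
    two, this excludes c = - 1 and shows that the symmetric matrix w I is
    definite; its logarithm D then gives the inner automorphism
    exp(- ad D / 2), which conjugates w to I. *)
Lemma polar_decomposition X0 f : is_exp_ad X0 (theta R) ->
  exists k n, [/\ f = (k * n)%g, inner_set R n & (theta R * k = k * theta R)%g].
Proof.
move=> X0theta; set th := theta R.
have thth : (th * th = 1)%g := theta_sqr.
have /is_exp_adP := @is_exp_ad_conj R X0 th f X0theta.
set w := mexp _ => -[wO wE].
pose tf := (th ^ f)%g.
have wV := O44_mulmxV wO; have Vw := O44_mulVmx wO.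
have tf2 : (tf * tf = 1)%g by rewrite /tf -conjMg thth conj1g.
have w2X X : w *m w *m X = so44_mx X *m (w *m w).
  have : so44_mx ((tf * tf)%g X) = X by rewrite tf2.
  rewrite -[(tf * tf)%g X]/(tf (tf X)) !wE => /(congr1 (fun A => A *m w *m w)).
  move: (O44_inv w) wV Vw => w' wV Vw.
  by rewrite -!mulmxA (mulmxA w' w) Vw mul1mx Vw mulmx1 !mulmxA.
have [c w2] := commutant_so44_scalar w2X.
have c2 : c ^+ 2 = 1.
  have : in_O44 (w *m w) by exact: in_O44_mul.
  rewrite w2 /in_O44 tr_scalar_mx mul_scalar_mx mul_mx_scalar scalerA -expr2.
  move/matrixP/(_ 0 0); rewrite !mxE eqxx mulr1n /= mulr1; exact.
have w'E : O44_inv w = c *: w.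
  apply: O44_inv_unique => //; rewrite -scalemxAr w2 scale_scalar_mx -expr2 c2 //.
pose m := w *m I.
have mT : m^T = c *: m.
  rewrite /m trmx_mul I44_tr.
  have : O44_inv w *m I = c *: w *m I by rewrite w'E.
  by rewrite /O44_inv -mulmxA I44_sqr mulmx1 -scalemxAl.
have neg X : X != 0 -> \tr (so44_mx X *m so44_mx (tf X)) < 0.
  move=> Xn0; rewrite -(lie_aut_trace f).
  have -> : f (tf X) = th (f X).
    rewrite -[f (tf X)]/((f * tf)%g X) -[RHS]/((th * f)%g X) /tf conjgE.
    by rewrite !mulgA mulgV mul1g.
  apply: trace_theta_lt0; apply: contra_neq Xn0 => fX0.
  by apply: (bij_inj (lie_aut_bij f)); rewrite fX0 linear0.
have skewE x y : \tr (so44_mx (skew x y) *m so44_mx (tf (skew x y))) =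
    c * (bform m y x ^+ 2 + bform m x y ^+ 2 - 2 * bform m x x * bform m y y).
  rewrite -trace_skew wE w'E /= /m; set A := _ - _.
  rewrite -!scalemxAr mxtraceZ; congr (c * _).
  by rewrite -!mulmxA (mxtrace_mulC I) !mulmxA.
have ineq (x y : 'rV[R]_8) i j : x 0 i * y 0 j - y 0 i * x 0 j != 0 ->
    c * (bform m y x ^+ 2 + bform m x y ^+ 2 - 2 * bform m x x * bform m y y) < 0.
  by move=> /skew_neq0 /neg; rewrite skewE.
have qfC x y : bform m y x = c * bform m x y.
  by rewrite bform_tr mT /bform -scalemxAr -scalemxAl mxE.
(* if c = - 1 the form is alternating, so it vanishes at some pair of
   independent vectors, where the strict inequality fails *)
have c1 : c = 1.
  move/eqP: c2; rewrite sqrf_eq1 => /orP[/eqP //|/eqP cN].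
  pose d (k : 'I_8) : 'rV[R]_8 := delta_mx 0 k.
  have qfxx x : bform m x x = 0 by have := qfC x x; rewrite cN => ?; lra.
  have qfDr x a b (u v : 'rV[R]_8) :
      bform m x (a *: u + b *: v) = a * bform m x u + b * bform m x v.
    by rewrite /bform linearP linearZ /= mulmxDr -!scalemxAr !mxE.
  have bad (x z : 'rV[R]_8) i j : x 0 i * z 0 j - z 0 i * x 0 j != 0 -> bform m x z != 0.
    move=> /ineq; rewrite qfC !qfxx cN => E; apply: contraTneq E => ->.
    by rewrite -leNgt; lra.
  have q01 : bform m (d 0) (d 1) != 0.
    by apply: (bad _ _ 0 1); rewrite !mxE /= mulr1 mulr0 subr0 oner_eq0.
  have : bform m (d 0) (bform m (d 0) (d 2) *: d 1 + (- bform m (d 0) (d 1)) *: d 2) != 0.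
    apply: (bad _ _ 0 2); rewrite !mxE /= !(mulr0, mulr1, mul1r, add0r, mul0r, subr0).
    by rewrite oppr_eq0.
  by rewrite qfDr mulNr mulrC subrr eqxx.
move: mT w2 w'E ineq qfC; rewrite c1 scale1r scale1r => msym w2' w'w ineq qfC.
have [|e [e2 epos]] := @bform_definite m msym.
  move=> x y i j /ineq; rewrite qfC !mul1r => ?; lra.
have emsym : (e *: m)^T = e *: m by rewrite linearZ /= msym.
have emI : e *: m *m I *m (e *: m) = I.
  rewrite -!scalemxAl -scalemxAr scalerA -expr2 e2 scale1r /m.
  by rewrite -!mulmxA (mulmxA I I) I44_sqr mul1mx mulmxA w2' mul1mx.
have [D [Dsym De]] := posdef_log emsym epos emI.
(* conjugation by exp E carries m I to I, since D anticommutes with I *)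
pose E : so44 R := - (2^-1 *: D).
pose n := Ad (mexp_O44 E).
have ninner : inner_set R n by apply: (@inner_Ad_mexp R E); exact: is_Ad_Ad.
have EI : so44_mx E *m I = I *m - so44_mx E.
  rewrite /= mulNmx opprK -scalemxAl -scalemxAr -scalerN; congr (_ *: _).
  have := so44_trmx D; rewrite Dsym => {1}->.
  by rewrite mulNmx opprK -(mulmxA _ I I) I44_sqr mulmx1.
have tfE : (tf = n^-1 * th * n)%g.
  have H1 : is_Ad (e *: w) tf.
    split=> [|X].
      rewrite /in_O44 [(e *: w)^T]linearZ /= -!scalemxAl -scalemxAr.
      by rewrite scalerA -expr2 e2 scale1r.
    have -> : O44_inv (e *: w) = e *: O44_inv w.
      by rewrite /O44_inv [(e *: w)^T]linearZ /= -scalemxAr -scalemxAl.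
    by rewrite wE -!scalemxAl -scalemxAr scalerA -expr2 e2 scale1r.
  have H2 : is_Ad (O44_inv (mexp E) *m I *m mexp E) (n^-1 * th * n)%g.
    apply: is_AdM; last exact: is_Ad_Ad.
    by apply: is_AdM; [apply: is_AdV; exact: is_Ad_Ad|exact: is_Ad_Ad].
  apply: is_Ad_inj H1 _; suff -> : e *: w = O44_inv (mexp E) *m I *m mexp E by [].
  have -> : e *: w = mexp D *m I by rewrite De -scalemxAl /m -mulmxA I44_sqr mulmx1.
  rewrite O44_inv_mexp.
  have EI' : - so44_mx E *m I = I *m so44_mx E by rewrite mulNmx EI mulmxN opprK.
  have DE : so44_mx D = - so44_mx E - so44_mx E.
    by rewrite /= opprK -scalerDl -[LHS]scale1r; congr (_ *: _); field.
  by rewrite DE (mexpD (erefl _)) -mulmxA [in LHS](mexp_intertwine EI') mulmxA.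
exists (f * n^-1)%g, n; split=> //; first by rewrite mulgKV.
have -> : (th * (f * n^-1) = f * tf * n^-1)%g.
  by rewrite /tf conjgE !mulgA mulgV mul1g.
by rewrite tfE !mulgA mulgK.
Qed.

End Polar.

(** * Endomorphisms of the cross product *)

Section CrossProduct.
Context (R : realType).
Implicit Types (u v w z : 'rV[R]_3).

Definition basis3 (a : 'I_3) : 'rV[R]_3 := delta_mx 0 a.

Lemma row3_basis v : v = v 0 c0 *: basis3 c0 + v 0 c1 *: basis3 c1 + v 0 c2 *: basis3 c2.
Proof. by rewrite {1}[v]row_sum_delta sum_ord3. Qed.

Lemma dotC v w : dot v w = dot w v. Proof. by rewrite !dotE; ring. Qed.
Lemma dotDl u v w : dot (u + v) w = dot u w + dot v w.
Proof. by rewrite /dot mulmxDl mxE. Qed.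
Lemma dotZl a v w : dot (a *: v) w = a * dot v w.
Proof. by rewrite /dot -scalemxAl mxE. Qed.
Lemma dotDr u v w : dot u (v + w) = dot u v + dot u w.
Proof. by rewrite !(dotC u) dotDl. Qed.
Lemma dotZr a v w : dot v (a *: w) = a * dot v w.
Proof. by rewrite !(dotC v) dotZl. Qed.
Lemma dotvv v : dot v v = sqn v. Proof. by []. Qed.

Lemma dot_cross_l v w : dot (cross v w) v = 0.
Proof. by rewrite dotE !mxE /=; ring. Qed.
Lemma dot_cross_r v w : dot (cross v w) w = 0.
Proof. by rewrite dotE !mxE /=; ring. Qed.
Lemma sqn_cross v w : sqn (cross v w) = sqn v * sqn w - dot v w ^+ 2.
Proof. by rewrite -!dotvv !dotE !mxE /=; ring. Qed.
Lemma cross_cross z v w : cross z (cross v w) = dot z w *: v - dot z v *: w.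
Proof. by apply/rowP; apply: forall_ord3; rewrite !dotE !mxE /= ?mxE /=; ring. Qed.
Lemma cross0r v : cross v 0 = 0.
Proof. by apply/rowP; apply: forall_ord3; rewrite !mxE /= ?mxE; ring. Qed.
Lemma cross0l v : cross 0 v = 0.
Proof. by apply/rowP; apply: forall_ord3; rewrite !mxE /= ?mxE; ring. Qed.

Lemma cross_basis : [/\ cross (basis3 c0) (basis3 c1) = basis3 c2,
  cross (basis3 c1) (basis3 c2) = basis3 c0 & cross (basis3 c2) (basis3 c0) = basis3 c1].
Proof. by split; apply/rowP; apply: forall_ord3; rewrite !mxE /= ?mxE /=; ring. Qed.

Definition isometry3 (F : 'rV[R]_3 -> 'rV[R]_3) := forall v w, dot (F v) (F w) = dot v w.

(** The images u0, u1, u2 of the basis satisfy u0 x u1 = u2 and its cyclic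
    shifts.  So they are orthogonal and |u2| = |u0| |u1|, and so on: the three
    lengths are all 0 or all 1. *)
Lemma cross_morphism_dichotomy (F : 'rV[R]_3 -> 'rV[R]_3) : linear F ->
  {morph F : v w / cross v w} -> (forall v, F v = 0) \/ isometry3 F.
Proof.
move=> Fl Fx; pose G : {linear 'rV[R]_3 -> 'rV[R]_3} :=
  HB.pack F (GRing.isLinear.Build _ _ _ _ F Fl).
have FE v : F v = v 0 c0 *: F (basis3 c0) + v 0 c1 *: F (basis3 c1) + v 0 c2 *: F (basis3 c2).
  by rewrite -[F]/(G : _ -> _) {1}(row3_basis v) !linearD !linearZ.
have [b01 b12 b20] := cross_basis.
move: (Fx (basis3 c0) (basis3 c1)) (Fx (basis3 c1) (basis3 c2)) (Fx (basis3 c2) (basis3 c0)).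
rewrite b01 b12 b20.
move: (F (basis3 c0)) (F (basis3 c1)) (F (basis3 c2)) FE => u0 u1 u2 FE E2 E0 E1.
have d20 : dot u2 u0 = 0 by rewrite E2 dot_cross_l.
have d21 : dot u2 u1 = 0 by rewrite E2 dot_cross_r.
have d01 : dot u0 u1 = 0 by rewrite E0 dot_cross_l.
have s2 : sqn u2 = sqn u0 * sqn u1 by rewrite E2 sqn_cross d01 expr0n subr0.
have s0 : sqn u0 = sqn u1 * sqn u2 by rewrite E0 sqn_cross dotC d21 expr0n subr0.
have s1 : sqn u1 = sqn u2 * sqn u0 by rewrite E1 sqn_cross d20 expr0n subr0.
have p0 := sqn_ge0 u0; have p1 := sqn_ge0 u1; have p2 := sqn_ge0 u2.
have [u00|u0n] := eqVneq (sqn u0) 0.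
  move/eqP: u00; rewrite sqn_eq0 => /eqP u00; left=> v.
  have u20 : u2 = 0 by rewrite E2 u00 cross0l.
  have u10 : u1 = 0 by rewrite E1 u20 cross0l.
  by rewrite FE u00 u10 u20 !scaler0 !addr0.
right=> v w.
have q1 : sqn u1 = 1.
  have : sqn u1 ^+ 2 = 1 by apply: (mulfI u0n); rewrite mulr1 {2}s0 s2; ring.
  by move=> /eqP; rewrite sqrf_eq1 => /orP[/eqP //|/eqP E]; move: p1; rewrite E; lra.
have q2 : sqn u2 = sqn u0 by rewrite s2 q1 mulr1.
have q0 : sqn u0 = 1.
  have : sqn u0 ^+ 2 = 1 by rewrite expr2 -{1}q2 -s1.
  by move=> /eqP; rewrite sqrf_eq1 => /orP[/eqP //|/eqP E]; move: p0; rewrite E; lra.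
have d02 := d20; have d12 := d21; have d10 := d01; rewrite dotC in d02.
rewrite dotC in d12; rewrite dotC in d10.
rewrite !FE !(dotDl, dotDr, dotZl, dotZr) d01 d02 d12 d10 d20 d21 !dotvv q2 q0 q1 dotE; ring.
Qed.

(** From z x (F v x F w) = 0 the vector z is orthogonal to F e0; then
    |z|^2 = |z x F e0|^2 = 0. *)
Lemma isometry3_cross_eq0 F : linear F -> {morph F : v w / cross v w} -> isometry3 F ->
  forall z, (forall v, cross z (F v) = 0) -> z = 0.
Proof.
move=> Fl Fx iso z zF; have [b01 b12 b20] := cross_basis.
have E v w : dot z (F w) *: F v = dot z (F v) *: F w.
  by apply/eqP; rewrite -subr_eq0 -cross_cross -Fx zF.
have zF0 v w : dot v w = 0 -> sqn v = 1 -> dot z (F w) = 0.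
  move=> vw v1; have /(congr1 (dot (F v))) := E v w.
  by rewrite !dotZr !iso dotvv v1 vw mulr1 mulr0.
have z0 : dot z (F (basis3 c0)) = 0.
  by apply: (zF0 (basis3 c1)); rewrite ?sqnE ?dotE ?sum_ord3 !mxE /=; ring.
have := sqn_cross z (F (basis3 c0)).
rewrite zF z0 -!dotvv iso expr0n subr0.
have -> : dot (basis3 c0) (basis3 c0) = 1 by rewrite dotE !mxE /=; ring.
rewrite mulr1 => /esym /eqP; rewrite dotvv /dot mul0mx mxE sqn_eq0 => /eqP //.
Qed.

End CrossProduct.

(** * The permutation of the four ideals *)

Section Permutation.
Context (R : realType).
Implicit Types (x y : 'M[R]_(4, 3)) (v w : 'rV[R]_3) (f g : lie_aut R).

Definition single_row (i : 'I_4) v : 'M[R]_(4, 3) := \matrix_(a, j) (v 0 j *+ (a == i)).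

Lemma row_single_row i j v : row j (single_row i v) = if j == i then v else 0.
Proof.
by apply/rowP => k; rewrite !mxE; case: eqP => _; rewrite ?mulr1n ?mulr0n ?mxE.
Qed.

Lemma single_row_linear i : linear (single_row i).
Proof.
by move=> a v w; apply/matrixP => b j; rewrite !mxE mulrnDl mulrnAr.
Qed.

Lemma sum_single_row x : x = \sum_i single_row i (row i x).
Proof.
apply/matrixP => a j; rewrite summxE (bigD1 a) //= big1 => [|i ia].
  by rewrite !mxE eqxx mulr1n addr0.
by rewrite mxE eq_sym (negbTE ia) mulr0n.
Qed.

Lemma single_row_eq0 i v : (single_row i v == 0) = (v == 0).
Proof.
apply/eqP/eqP => [/(congr1 (row i))|->].
  by rewrite row_single_row eqxx linear0.
by apply/matrixP => a j; rewrite !mxE mul0rn.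
Qed.

Lemma rcross_single_row i j v w :
  rcross (single_row i v) (single_row j w) = if i == j then single_row i (cross v w) else 0.
Proof.
apply/row_matrixP => a; rewrite row_rcross !row_single_row.
have [->|ij] := eqVneq i j.
  by rewrite row_single_row; case: eqP => _ //; rewrite cross0l.
rewrite row0; case: eqP => [->|_]; last by rewrite cross0l.
by rewrite (negbTE ij) cross0r.
Qed.

Definition permutes f (s : 'S_4) :=
  forall i v, exists w, f (in_k (single_row i v)) = in_k (single_row (s i) w).

(** Lifts of permutations that also preserve the coordinates in R^3: conjugation
    by them is explicit. *)
Definition moves_rows f (s : 'S_4) :=
  forall i v, f (in_k (single_row i v)) = in_k (single_row (s i) v).

Lemma moves_rows_permutes f s : moves_rows f s -> permutes f s.
Proof. by move=> fs i v; exists v. Qed.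

Lemma moves_rowsM f g s t : moves_rows f s -> moves_rows g t -> moves_rows (f * g)%g (t * s)%g.
Proof. by move=> fs gt i v; rewrite permM -fs -gt. Qed.

Lemma in_k_inj : injective (@in_k R).
Proof. by move=> x y E; have [] := @in_k_in_p_inj R x y 0 0; rewrite ?E. Qed.

Lemma lie_aut_inj f : injective f. Proof. exact: bij_inj (lie_aut_bij f). Qed.

Lemma basis3_neq0 a : basis3 R a != 0.
Proof. by apply/eqP => /rowP/(_ a)/eqP; rewrite !mxE !eqxx oner_eq0. Qed.

Lemma permutes_unique f s t : permutes f s -> permutes f t -> s = t.
Proof.
move=> fs ft; apply/permP => i.
have [w Ew] := fs i (basis3 R c0); have [w' Ew'] := ft i (basis3 R c0).
have E : single_row (s i) w = single_row (t i) w' by apply: in_k_inj; rewrite -Ew -Ew'.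
have w0 : w != 0.
  apply: contra_neq (basis3_neq0 c0) => w0; apply/eqP; rewrite -(single_row_eq0 i); apply/eqP.
  apply: in_k_inj; apply: (@lie_aut_inj f); rewrite Ew w0.
  have /eqP -> : single_row (s i) (0 : 'rV[R]_3) == 0 by rewrite single_row_eq0.
  by rewrite !linear0.
apply/eqP; apply: contraNT w0 => st.
by have /(congr1 (row (s i))) := E; rewrite !row_single_row eqxx (negbTE st) => ->; rewrite eqxx.
Qed.

Lemma permutes1 : permutes 1%g 1%g.
Proof. by move=> i v; exists v; rewrite perm1. Qed.

(** The order is reversed because products in 'S_4 are composed from left to
    right, and products of automorphisms from right to left. *)
Lemma permutesM f g s t : permutes f s -> permutes g t -> permutes (f * g)%g (t * s)%g.
Proof.
move=> fs gt i v; have [w E] := gt i v; have [w' E'] := fs (t i) w.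
by exists w'; rewrite permM -E' -E.
Qed.

Lemma in_p_eqN (B : 'M[R]_4) : in_p B = - in_p B -> B = 0.
Proof.
move=> E; have := @in_k_in_p_inj R 0 0 B (- B); rewrite linear0 !add0r linearN.
move=> /(_ E) [_ BN]; apply/matrixP => i j; have /matrixP/(_ i j) := BN.
by rewrite !mxE => ?; lra.
Qed.

Definition k_restr f x : 'M[R]_(4, 3) := k_coord (f (in_k x)).

Section CommutesWithTheta.
Variable f : lie_aut R.
Hypothesis fth : (theta R * f = f * theta R)%g.

Lemma theta_comm X : theta R (f X) = f (theta R X).
Proof. by rewrite -[LHS]/((theta R * f)%g X) fth. Qed.

Lemma k_restrE x : f (in_k x) = in_k (k_restr f x).
Proof.
have := theta_comm (in_k x); rewrite theta_in_k /k_restr.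
have [y [B ->]] : exists y B, f (in_k x) = in_k y + in_p B.
  by exists (k_coord (f (in_k x))), (p_coord (f (in_k x))); exact: so44_decomp.
rewrite k_coordK thetaE => /addrI E; rewrite (@in_p_eqN B) ?linear0 ?addr0 //.
Qed.

Lemma k_restr_linear : linear (k_restr f).
Proof.
move=> a x y; apply: in_k_inj.
by rewrite -k_restrE !linearP /= !k_restrE.
Qed.

Lemma k_restr0 : k_restr f 0 = 0.
Proof.
rewrite /k_restr !linear0 -(addr0 0) -{1}(linear0 (@in_k R)).
by rewrite -(linear0 (@in_p R)) k_coordK.
Qed.

Lemma k_restr_rcross x y : k_restr f (rcross x y) = rcross (k_restr f x) (k_restr f y).
Proof.
have two : (2 : R) != 0 by rewrite pnatr_eq0.
apply: (scalerI two); apply: in_k_inj.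
rewrite -bracket_kk -!k_restrE -lie_aut_bracket bracket_kk.
by rewrite !linearZ /= k_restrE.
Qed.

Lemma k_restr_eq0 x : k_restr f x = 0 -> x = 0.
Proof.
move=> E; apply: in_k_inj; apply: (@lie_aut_inj f).
by rewrite k_restrE E !linear0.
Qed.

End CommutesWithTheta.

Lemma k_restr_surj f (fth : (theta R * f = f * theta R)%g) y : exists x, k_restr f x = y.
Proof.
have gth : (theta R * f^-1 = f^-1 * theta R)%g.
  by apply: (mulgI f); apply: (mulIg f); rewrite !mulgA mulgV mul1g mulgKV fth.
exists (k_restr (f^-1)%g y); apply: in_k_inj; rewrite -!k_restrE //.
exact: lie_autK.
Qed.

Section ThetaPermutation.
Variable f : lie_aut R.
Hypothesis fth : (theta R * f = f * theta R)%g.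

Let comp i j v := row j (k_restr f (single_row i v)).

Let comp_linear i j : linear (comp i j).
Proof. by move=> a v w; rewrite /comp single_row_linear k_restr_linear // linearP. Qed.

Let comp_cross i j : {morph comp i j : v w / cross v w}.
Proof.
move=> v w; rewrite /comp -row_rcross -k_restr_rcross //.
by rewrite rcross_single_row eqxx.
Qed.

Let comp_cross0 i i' j v w : i != i' -> cross (comp i j v) (comp i' j w) = 0.
Proof.
move=> ii'; rewrite /comp -row_rcross -k_restr_rcross // rcross_single_row (negbTE ii').
by rewrite k_restr0 row0.
Qed.

Let comp_sum j x : row j (k_restr f x) = \sum_i comp i j (row i x).
Proof.
pose G : {linear 'M[R]_(4, 3) -> 'M[R]_(4, 3)} :=
  HB.pack (k_restr f) (GRing.isLinear.Build _ _ _ _ (k_restr f) (k_restr_linear fth)).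
by rewrite -[k_restr f]/(G : _ -> _) {1}(sum_single_row x) !linear_sum.
Qed.

Let comp_source j : exists i, isometry3 (comp i j).
Proof.
have [x xE] := k_restr_surj fth (single_row j (basis3 R c0)).
have [//|H] := pselect (exists i, isometry3 (comp i j)).
have : row j (k_restr f x) = 0.
  rewrite comp_sum big1 // => i _.
  case: (cross_morphism_dichotomy (comp_linear i j) (comp_cross i j)) => [->//|iso].
  by case: H; exists i.
by rewrite xE row_single_row eqxx => /eqP; rewrite (negbTE (basis3_neq0 c0)).
Qed.

Let comp_eq0 i i' j : isometry3 (comp i j) -> i != i' -> forall v, comp i' j v = 0.
Proof.
move=> iso ii' v.
apply: (isometry3_cross_eq0 (comp_linear i j) (comp_cross i j) iso) => w.
by apply: comp_cross0; rewrite eq_sym.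
Qed.

(** The components from different ideals to the same one commute with each other.
    A nonzero component is a rotation, and only 0 commutes with its image: so
    each ideal receives exactly one other, and by injectivity of f every ideal
    is the source of one. *)
Lemma theta_comm_permutes : exists s, permutes f s.
Proof.
(* the ideal that f maps onto the j-th one *)
pose src j := sval (cid (comp_source j)).
have srcP j : isometry3 (comp (src j) j) by rewrite /src; case: cid.
have src_surj i : exists j, src j = i.
  have [//|H] := pselect (exists j, src j = i).
  have : k_restr f (single_row i (basis3 R c0)) = 0.
    apply/row_matrixP => j; rewrite row0; apply: (comp_eq0 (srcP j)).
    by apply/eqP => E; apply: H; exists j.
  by move/(k_restr_eq0 fth)/eqP; rewrite single_row_eq0 (negbTE (basis3_neq0 c0)).
pose tgt i := sval (cid (src_surj i)).
have tgtK : cancel tgt src by move=> i; rewrite /tgt; case: cid.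
exists (perm (can_inj tgtK)) => i v; exists (comp i (tgt i) v).
rewrite permE k_restrE //; congr in_k; apply/row_matrixP => j; rewrite row_single_row.
have [->//|ji] := eqVneq j (tgt i); apply: (comp_eq0 (srcP j)).
apply: contra_neq ji => E.
have tgtI : bijective tgt by apply: injF_bij; exact: can_inj tgtK.
by rewrite -E; have [h _ hK] := tgtI; rewrite -{1}(hK j) -(tgtK (h j)) hK.
Qed.

Lemma theta_comm_isometry i : permutes f 1%g ->
  exists F, [/\ linear F, {morph F : v w / cross v w}, isometry3 F &
     forall v, f (in_k (single_row i v)) = in_k (single_row i (F v))].
Proof.
move=> f1; exists (comp i i); split.
- exact: comp_linear.
- exact: comp_cross.
- case: (cross_morphism_dichotomy (comp_linear i i) (comp_cross i i)) => // F0.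
  have [w] := f1 i (basis3 R c0); rewrite perm1 => E.
  have := F0 (basis3 R c0); rewrite /comp.
  have -> : k_restr f (single_row i (basis3 R c0)) = single_row i w.
    by apply: in_k_inj; rewrite -k_restrE.
  rewrite row_single_row eqxx => w0; move: E; rewrite w0.
  have /eqP -> : single_row i (0 : 'rV[R]_3) == 0 by rewrite single_row_eq0.
  rewrite linear0 => E; have := basis3_neq0 c0; rewrite -(single_row_eq0 i).
  suff -> : single_row i (basis3 R c0) = 0 by rewrite eqxx.
  by apply: in_k_inj; apply: (@lie_aut_inj f); rewrite E !linear0.
- move=> v; have [w E] := f1 i v; rewrite perm1 in E; rewrite E.
  have -> : comp i i v = w; last by [].
  rewrite /comp; have -> : k_restr f (single_row i v) = single_row i w.
    by apply: in_k_inj; rewrite -k_restrE.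
  by rewrite row_single_row eqxx.
Qed.

End ThetaPermutation.
End Permutation.

(** * Automorphisms that permute the ideals *)

Section Builder.
Context (R : realType).
Implicit Types (x y z : 'M[R]_(4, 3)) (B C : 'M[R]_4) (X Y Z : so44 R).

Lemma lie_bracketDl X Y Z : lie_bracket (X + Y) Z = lie_bracket X Z + lie_bracket Y Z.
Proof.
apply: so44_mx_inj; rewrite /= /mx_bracket mulmxDl mulmxDr opprD.
by rewrite addrACA.
Qed.

Lemma lie_bracketDr X Y Z : lie_bracket Z (X + Y) = lie_bracket Z X + lie_bracket Z Y.
Proof.
apply: so44_mx_inj; rewrite /= /mx_bracket mulmxDl mulmxDr opprD.
by rewrite addrACA.
Qed.

Lemma lie_bracketC X Y : lie_bracket X Y = - lie_bracket Y X.
Proof. by apply: so44_mx_inj; rewrite /= /mx_bracket opprB. Qed.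

Lemma theta_fixed X : theta R X = X -> exists z, X = in_k z.
Proof.
have [y [B ->]] : exists y B, X = in_k y + in_p B.
  by exists (k_coord X), (p_coord X); exact: so44_decomp.
rewrite thetaE => /addrI E; exists y.
by rewrite (@in_p_eqN R B) ?linear0 ?addr0.
Qed.

(** theta changes the sign of both factors, so it fixes the bracket. *)
Lemma bracket_pp_in_k B C : exists z, lie_bracket (in_p B) (in_p C) = in_k z.
Proof.
have E : theta R (lie_bracket (in_p B) (in_p C)) = lie_bracket (in_p B) (in_p C).
  rewrite lie_aut_bracket !theta_in_p; apply: so44_mx_inj => /=.
  by rewrite /mx_bracket !mulNmx !mulmxN !opprK.
exact: theta_fixed.
Qed.

Variables (s : 'S_4) (T : 'M[R]_4 -> 'M[R]_4).
Hypothesis ss : (s * s = 1)%g.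
Hypothesis Tl : linear T.
Hypothesis TT : forall B, T (T B) = B.
Hypothesis Torth : forall B C, \tr ((T B)^T *m T C) = \tr (B^T *m C).
Hypothesis Tequiv : forall x B, T (k_left x *m B - B *m k_right x) =
  k_left (row_perm s x) *m T B - T B *m k_right (row_perm s x).

Definition perm_fun X : so44 R := in_k (row_perm s (k_coord X)) + in_p (T (p_coord X)).

Lemma perm_funE x B : perm_fun (in_k x + in_p B) = in_k (row_perm s x) + in_p (T B).
Proof. by rewrite /perm_fun k_coordK p_coordK. Qed.

Let T0 : T 0 = 0.
Proof. by have := Tl (-1) 0 0; rewrite scaler0 addr0 scaleN1r addNr. Qed.

Lemma perm_fun_in_k x : perm_fun (in_k x) = in_k (row_perm s x).
Proof. by have := perm_funE x 0; rewrite T0 !linear0 !addr0. Qed.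

Lemma perm_fun_in_p B : perm_fun (in_p B) = in_p (T B).
Proof. by have := perm_funE 0 B; rewrite !linear0 !add0r. Qed.

Lemma perm_fun_linear : linear perm_fun.
Proof.
move=> a X Y; rewrite [X]so44_decomp [Y]so44_decomp.
have -> : a *: (in_k (k_coord X) + in_p (p_coord X)) + (in_k (k_coord Y) + in_p (p_coord Y)) =
    in_k (a *: k_coord X + k_coord Y) + in_p (a *: p_coord X + p_coord Y).
  by rewrite !linearP /= scalerDr addrACA.
by rewrite !perm_funE Tl !linearP /= scalerDr addrACA.
Qed.

Lemma perm_funK : cancel perm_fun perm_fun.
Proof.
move=> X; rewrite [X in RHS]so44_decomp [X in LHS]so44_decomp !perm_funE TT.
by rewrite -row_permM ss row_perm1.
Qed.

Let F : {linear so44 R -> so44 R} :=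
  HB.pack perm_fun (GRing.isLinear.Build _ _ _ _ perm_fun perm_fun_linear).

Let perm_funD : {morph perm_fun : X Y / X + Y}.
Proof. exact: (linearD F). Qed.

Let perm_funN : {morph perm_fun : X / - X}.
Proof. exact: (linearN F). Qed.

Lemma row_row_perm i x : row i (row_perm s x) = row (s i) x.
Proof. by apply/rowP => j; rewrite !mxE. Qed.

Lemma rcross_row_perm x y : rcross (row_perm s x) (row_perm s y) = row_perm s (rcross x y).
Proof.
by apply/row_matrixP => i; rewrite row_rcross !row_row_perm row_rcross.
Qed.

(** On [k, k] and [k, p] this is the equivariance of T.  A bracket [p, p] lies in
    k, where it is determined by its traces against k; invariance of the trace
    form turns these into brackets [k, p]. *)
Lemma perm_fun_bracket : {morph perm_fun : X Y / lie_bracket X Y}.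
Proof.
have kk x y : perm_fun (lie_bracket (in_k x) (in_k y)) =
    lie_bracket (perm_fun (in_k x)) (perm_fun (in_k y)).
  rewrite bracket_kk !perm_fun_in_k bracket_kk rcross_row_perm; congr in_k.
  by apply/matrixP => i j; rewrite !mxE.
have kp x B : perm_fun (lie_bracket (in_k x) (in_p B)) =
    lie_bracket (perm_fun (in_k x)) (perm_fun (in_p B)).
  by rewrite bracket_kp perm_fun_in_k !perm_fun_in_p bracket_kp Tequiv.
have pk x B : perm_fun (lie_bracket (in_p B) (in_k x)) =
    lie_bracket (perm_fun (in_p B)) (perm_fun (in_k x)).
  by rewrite lie_bracketC perm_funN kp -lie_bracketC.
have ppb B C : perm_fun (lie_bracket (in_p B) (in_p C)) =
    lie_bracket (perm_fun (in_p B)) (perm_fun (in_p C)).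
  have [z E] := bracket_pp_in_k B C; rewrite !perm_fun_in_p.
  have [z' E'] := bracket_pp_in_k (T B) (T C); rewrite E E' perm_fun_in_k; congr in_k.
  pose dif := z' - row_perm s z.
  have key y : \tr (so44_mx (in_k z') *m so44_mx (in_k (row_perm s y))) =
      \tr (so44_mx (in_k (row_perm s z)) *m so44_mx (in_k (row_perm s y))).
    have cW : lie_bracket (in_p C) (in_k y) = in_p (- (k_left y *m C - C *m k_right y)).
      by rewrite lie_bracketC bracket_kp linearN.
    rewrite -E' -[so44_mx (lie_bracket _ _)]/(mx_bracket (in_p (T B)) (in_p (T C))) trace_bracket.
    rewrite -[mx_bracket _ _]/(so44_mx (lie_bracket (in_p (T C)) (in_k (row_perm s y)))).
    rewrite -!perm_fun_in_p -perm_fun_in_k -pk cW !perm_fun_in_p.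
    rewrite trace_pp Torth -trace_pp -cW.
    rewrite -[so44_mx (lie_bracket _ _)]/(mx_bracket (in_p C) (in_k y)) -trace_bracket.
    rewrite -[mx_bracket _ _]/(so44_mx (lie_bracket (in_p B) (in_p C))) E.
    rewrite perm_fun_in_k !trace_kk; congr (- (_ * _)).
    rewrite [LHS](reindex_inj (@perm_inj _ s)) /=; apply: eq_bigr => i _.
    by apply: eq_bigr => j _; rewrite !mxE.
  apply/eqP; rewrite eq_sym -subr_eq0 -/dif; apply/eqP.
  apply: sum_sqr_eq0; have := key (row_perm s dif).
  rewrite -row_permM ss row_perm1 !trace_kk => H.
  have -> : \sum_i \sum_j dif i j ^+ 2 =
    \sum_i \sum_j z' i j * dif i j - \sum_i \sum_j row_perm s z i j * dif i j.
    rewrite -sumrB; apply: eq_bigr => i _; rewrite -sumrB; apply: eq_bigr => j _.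
    by rewrite -mulrBl expr2 {1}/dif; congr (_ * _); rewrite !mxE.
  by lra.
move=> X Y; rewrite [X]so44_decomp [Y]so44_decomp.
move: (perm_fun) perm_funD kk kp pk ppb => G GD kk kp pk ppb.
by rewrite lie_bracketDl !lie_bracketDr !GD lie_bracketDl !lie_bracketDr kk kp pk ppb.
Qed.

Lemma perm_fun_aut : `[< is_lie_aut perm_fun >].
Proof.
apply/asboolP; split; [exact: perm_fun_linear|exact: perm_fun_bracket|].
by exists perm_fun; exact: perm_funK.
Qed.

Lemma row_perm_single_row i (v : 'rV[R]_3) : row_perm s (single_row i v) = single_row (s i) v.
Proof.
have sK : involutive s by move=> j; rewrite -permM ss perm1.
apply/row_matrixP => j; rewrite row_row_perm !row_single_row.
by rewrite -(inj_eq (@perm_inj _ s) _ i) sK.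
Qed.

Lemma perm_aut_exists : exists2 t : lie_aut R, moves_rows t s & (theta R * t = t * theta R)%g.
Proof.
exists (LieAut perm_fun_aut) => [i v|].
  by rewrite /= perm_fun_in_k row_perm_single_row.
apply: lie_aut_ext => X.
change (theta R (perm_fun X) = perm_fun (theta R X)).
rewrite [X]so44_decomp perm_funE !thetaE perm_funD perm_funN.
by rewrite perm_fun_in_k perm_fun_in_p.
Qed.

End Builder.

Section Transpositions.
Context (R : realType).
Implicit Types (x y z : 'M[R]_(4, 3)) (B C : 'M[R]_4) (v w : 'rV[R]_3).

Definition quat_conj : 'M[R]_4 :=
  mx4 [:: [:: 1; 0; 0; 0]; [:: 0; -1; 0; 0]; [:: 0; 0; -1; 0]; [:: 0; 0; 0; -1]].

Lemma quat_conj_sqr : quat_conj *m quat_conj = 1%:M.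
Proof. mxring4. Qed.

Lemma quat_conj_tr : quat_conj^T = quat_conj.
Proof. mxring4. Qed.

Lemma quat_conj_l v : quat_conj *m lquat v = rquat v *m quat_conj.
Proof. mxring4. Qed.

Lemma quat_conj_r v : quat_conj *m rquat v = lquat v *m quat_conj.
Proof. mxring4. Qed.

Lemma row_tperm i j k x : row k (row_perm (tperm i j) x) = row (tperm i j k) x.
Proof. by apply/rowP => l; rewrite !mxE. Qed.

Lemma tperm_aut01 : exists2 t : lie_aut R, moves_rows t (tperm i0 i1)
   & (theta R * t = t * theta R)%g.
Proof.
apply: (@perm_aut_exists R (tperm i0 i1) (mulmx quat_conj)).
- exact: tperm2.
- by move=> a B C; rewrite linearP.
- by move=> B; rewrite mulmxA quat_conj_sqr mul1mx.
- move=> B C; rewrite trmx_mul quat_conj_tr -!mulmxA (mulmxA quat_conj).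
  by rewrite quat_conj_sqr mul1mx.
- move=> x B; rewrite /k_left /k_right !row_tperm tpermL tpermR !tpermD //.
  rewrite mulmxBr mulmxDl mulmxDr !mulmxA quat_conj_l quat_conj_r; congr (_ - _).
  by rewrite addrC !mulmxDl.
Qed.

Lemma tperm_aut23 : exists2 t : lie_aut R, moves_rows t (tperm i2 i3)
   & (theta R * t = t * theta R)%g.
Proof.
apply: (@perm_aut_exists R (tperm i2 i3) (mulmx^~ quat_conj)).
- exact: tperm2.
- by move=> a B C; rewrite mulmxDl scalemxAl.
- by move=> B; rewrite -mulmxA quat_conj_sqr mulmx1.
- move=> B C; rewrite trmx_mul quat_conj_tr mxtrace_mulC -!mulmxA.
  by rewrite (mulmxA quat_conj) quat_conj_sqr mul1mx mxtrace_mulC.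
- move=> x B; rewrite /k_left /k_right !row_tperm tpermL tpermR !tpermD //.
  rewrite mulmxBl; congr (_ - _); first by rewrite mulmxA.
  by rewrite -!mulmxA mulmxDl -quat_conj_l -quat_conj_r -mulmxDr addrC.
Qed.

(** As a representation of the second and third ideals, p is a multiple of the
    tensor product of two spin-1/2 representations.  The exchange of the two
    factors is (1 + sum_a sigma_a (x) sigma_a) / 2 in terms of the Pauli matrices;
    here sigma_a (x) sigma_a is B |-> R_a B L_a. *)
Definition triality_p B : 'M[R]_4 :=
  2^-1 *: (B + \sum_a rquat (basis3 R a) *m B *m lquat (basis3 R a)).

Lemma quat_basisM (q : 'rV[R]_3 -> 'M[R]_4) : linear q ->
  (forall v w, q v *m q w = q (cross v w) - (dot v w)%:M) ->
  let q0 := q (basis3 R c0) in let q1 := q (basis3 R c1) in let q2 := q (basis3 R c2) in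
  [/\ q0 *m q0 = -1, q1 *m q1 = -1 & q2 *m q2 = -1] /\
  [/\ q0 *m q1 = q2, q1 *m q2 = q0, q2 *m q0 = q1 &
     [/\ q1 *m q0 = - q2, q2 *m q1 = - q0 & q0 *m q2 = - q1]].
Proof.
move=> ql qM; pose Q : {linear 'rV[R]_3 -> 'M[R]_4} :=
  HB.pack q (GRing.isLinear.Build _ _ _ _ q ql).
have q0 : q 0 = 0 by exact: (linear0 Q).
have qN v : q (- v) = - q v by exact: (linearN Q).
have [b01 b12 b20] := cross_basis R.
have dot_basis a b : dot (basis3 R a) (basis3 R b) = (a == b)%:R.
  by move: a b; apply: forall_ord3; apply: forall_ord3; rewrite dotE !mxE /=; ring.
rewrite /= !qM !crossvv !(crossC (basis3 R c0) (basis3 R c1)).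
rewrite !(crossC (basis3 R c1) (basis3 R c2)) !(crossC (basis3 R c2) (basis3 R c0)).
by rewrite b01 b12 b20 !dot_basis /= q0 !qN raddf0 !subr0 !sub0r.
Qed.

Lemma triality_p_linear : linear triality_p.
Proof.
move=> a B C; rewrite /triality_p !sum_ord3 !mulmxDr !mulmxDl -!scalemxAr -!scalemxAl.
by apply/matrixP => i j; rewrite !mxE; ring.
Qed.

Lemma triality_l_basis a B : triality_p (rquat (basis3 R a) *m B) =
  - (triality_p B *m lquat (basis3 R a)).
Proof.
rewrite /triality_p -scalemxAl -scalerN; congr (_ *: _); rewrite !sum_ord3.
have [[r00 r11 r22] [r01 r12 r20 [r10 r21 r02]]] := quat_basisM (@rquat_linear R) (@rquatM R).
have [[l00 l11 l22] [l01 l12 l20 [l10 l21 l02]]] := quat_basisM (@lquat_linear R) (@lquatM R).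
move: a; apply: forall_ord3.
all: rewrite !mulmxA ?r00 ?r11 ?r22 ?r01 ?r12 ?r20 ?r10 ?r21 ?r02.
all: rewrite !mulmxDl -![_ *m _ *m lquat _ *m lquat _]mulmxA.
all: rewrite ?l00 ?l11 ?l22 ?l01 ?l12 ?l20 ?l10 ?l21 ?l02 !mulmxN !mulNmx ?mulmx1 ?mul1mx.
all: by apply/matrixP => i j; rewrite !mxE; ring.
Qed.

Lemma triality_pK B : triality_p (triality_p B) = B.
Proof.
have [[r00 r11 r22] [r01 r12 r20 [r10 r21 r02]]] := quat_basisM (@rquat_linear R) (@rquatM R).
have [[l00 l11 l22] [l01 l12 l20 [l10 l21 l02]]] := quat_basisM (@lquat_linear R) (@lquatM R).
pose S B := \sum_a rquat (basis3 R a) *m B *m lquat (basis3 R a).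
have SS : S (S B) = 3 *: B - 2 *: S B.
  rewrite /S !sum_ord3 !mulmxDr !mulmxDl !mulmxA.
  rewrite ?r00 ?r11 ?r22 ?r01 ?r12 ?r20 ?r10 ?r21 ?r02.
  rewrite -![_ *m _ *m lquat _ *m lquat _]mulmxA.
  rewrite ?l00 ?l11 ?l22 ?l01 ?l12 ?l20 ?l10 ?l21 ?l02 !(mulmxN, mulNmx) ?mulmx1 ?mul1mx.
  by apply/matrixP => i j; rewrite !mxE; ring.
have SD C D : S (C + D) = S C + S D.
  by rewrite /S -big_split; apply: eq_bigr => a _; rewrite mulmxDr mulmxDl.
have SZ k C : S (k *: C) = k *: S C.
  by rewrite /S scaler_sumr; apply: eq_bigr => a _; rewrite -scalemxAr -scalemxAl.
rewrite /triality_p -!/(S _) SZ SD SS; move: (S B) => C.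
by apply/matrixP => i j; rewrite !mxE; field.
Qed.

(** The exchange of factors intertwines the two ideals: left multiplication by R_v
    and right multiplication by - L_v are the actions of v in the second and in
    the third ideal. *)
Lemma triality_l v B : triality_p (rquat v *m B) = - (triality_p B *m lquat v).
Proof.
pose T : {linear 'M[R]_4 -> 'M[R]_4} :=
  HB.pack triality_p (GRing.isLinear.Build _ _ _ _ triality_p triality_p_linear).
have qE (q : 'rV[R]_3 -> 'M[R]_4) : linear q -> q v = \sum_a v 0 a *: q (basis3 R a).
  move=> ql; pose Q : {linear 'rV[R]_3 -> 'M[R]_4} :=
    HB.pack q (GRing.isLinear.Build _ _ _ _ q ql).
  rewrite -[q]/(Q : _ -> _) {1}[v]row_sum_delta linear_sum; apply: eq_bigr => a _.
  by rewrite linearZ.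
rewrite (qE _ (@rquat_linear R)) (qE _ (@lquat_linear R)) mulmx_suml mulmx_sumr.
rewrite -[triality_p]/(T : _ -> _) linear_sum -sumrN; apply: eq_bigr => a _.
by rewrite -scalemxAl linearZ /= triality_l_basis -scalemxAr scalerN.
Qed.

Lemma triality_r v B : triality_p (B *m lquat v) = - (rquat v *m triality_p B).
Proof.
pose T : {linear 'M[R]_4 -> 'M[R]_4} :=
  HB.pack triality_p (GRing.isLinear.Build _ _ _ _ triality_p triality_p_linear).
have TN C : triality_p (- C) = - triality_p C by exact: (linearN T).
have := congr1 triality_p (triality_l v (triality_p B)).
by rewrite !triality_pK TN => ->; rewrite opprK.
Qed.

Lemma triality_orth B C : \tr ((triality_p B)^T *m triality_p C) = \tr (B^T *m C).
Proof.
suff sym D E : \tr ((triality_p D)^T *m E) = \tr (D^T *m triality_p E).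
  by rewrite sym triality_pK.
rewrite /triality_p linearZ /= -scalemxAl -scalemxAr !mxtraceZ; congr (_ * _).
rewrite linearD /= mulmxDl mulmxDr !mxtraceD; congr (_ + _).
rewrite linear_sum mulmx_suml mulmx_sumr !raddf_sum; apply: eq_bigr => a _.
rewrite /= !trmx_mul lquat_tr rquat_tr !(mulmxN, mulNmx) opprK.
by rewrite -!mulmxA mxtrace_mulC !mulmxA.
Qed.

Lemma tperm_aut12 : exists2 t : lie_aut R, moves_rows t (tperm i1 i2)
   & (theta R * t = t * theta R)%g.
Proof.
apply: (@perm_aut_exists R (tperm i1 i2) triality_p).
- exact: tperm2.
- exact: triality_p_linear.
- exact: triality_pK.
- exact: triality_orth.
pose T : {linear 'M[R]_4 -> 'M[R]_4} :=
  HB.pack triality_p (GRing.isLinear.Build _ _ _ _ triality_p triality_p_linear).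
have TD C D : triality_p (C + D) = triality_p C + triality_p D by exact: (linearD T).
have TN C : triality_p (- C) = - triality_p C by exact: (linearN T).
have Tl v B : triality_p (lquat v *m B) = lquat v *m triality_p B.
  rewrite /triality_p -scalemxAr mulmxDr mulmx_sumr; congr (_ *: (_ + _)).
  by apply: eq_bigr => a _; rewrite !mulmxA lrquatC.
have Tr v B : triality_p (B *m rquat v) = triality_p B *m rquat v.
  rewrite /triality_p -scalemxAl mulmxDl mulmx_suml; congr (_ *: (_ + _)).
  by apply: eq_bigr => a _; rewrite -!mulmxA lrquatC.
move=> x B; rewrite /k_left /k_right !row_tperm tpermL tpermR !tpermD //.
rewrite !mulmxDl !mulmxDr TD TN !TD Tl Tr triality_l triality_r.
by apply/matrixP => i j; rewrite !mxE; ring.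
Qed.

End Transpositions.

(** * The Pfaffian of a 4 x 4 matrix *)

Section Pfaffian.
Context (R : realType).
Implicit Types (A B : 'M[R]_4) (v w : 'rV[R]_3).

Definition pfaff A : R := A i0 i1 * A i2 i3 - A i0 i2 * A i1 i3 + A i0 i3 * A i1 i2.

Lemma det3 (B : 'M[R]_3) : \det B =
  B c0 c0 * (B c1 c1 * B c2 c2 - B c1 c2 * B c2 c1)
  - B c0 c1 * (B c1 c0 * B c2 c2 - B c1 c2 * B c2 c0)
  + B c0 c2 * (B c1 c0 * B c2 c1 - B c1 c1 * B c2 c0).
Proof.
pose f (i j : nat) := B (inord i) (inord j).
have fE i j : B i j = f i j by rewrite /f !inord_val.
rewrite !fE (expand_det_row _ ord0) !big_ord_recl big_ord0 /cofactor.
rewrite !(expand_det_row _ ord0) !big_ord_recl !big_ord0 /cofactor !det_mx11.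
rewrite !mxE !fE /= /bump /=; ring.
Qed.

Lemma det4 A : \det A =
  A i0 i0 * (A i1 i1 * (A i2 i2 * A i3 i3 - A i2 i3 * A i3 i2)
    - A i1 i2 * (A i2 i1 * A i3 i3 - A i2 i3 * A i3 i1)
    + A i1 i3 * (A i2 i1 * A i3 i2 - A i2 i2 * A i3 i1))
  - A i0 i1 * (A i1 i0 * (A i2 i2 * A i3 i3 - A i2 i3 * A i3 i2)
    - A i1 i2 * (A i2 i0 * A i3 i3 - A i2 i3 * A i3 i0)
    + A i1 i3 * (A i2 i0 * A i3 i2 - A i2 i2 * A i3 i0))
  + A i0 i2 * (A i1 i0 * (A i2 i1 * A i3 i3 - A i2 i3 * A i3 i1)
    - A i1 i1 * (A i2 i0 * A i3 i3 - A i2 i3 * A i3 i0)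
    + A i1 i3 * (A i2 i0 * A i3 i1 - A i2 i1 * A i3 i0))
  - A i0 i3 * (A i1 i0 * (A i2 i1 * A i3 i2 - A i2 i2 * A i3 i1)
    - A i1 i1 * (A i2 i0 * A i3 i2 - A i2 i2 * A i3 i0)
    + A i1 i2 * (A i2 i0 * A i3 i1 - A i2 i1 * A i3 i0)).
Proof.
pose f (i j : nat) := A (inord i) (inord j).
have fE i j : A i j = f i j by rewrite /f !inord_val.
rewrite !fE (expand_det_row _ ord0) !big_ord_recl big_ord0 /cofactor !det3.
rewrite !mxE !fE /= /bump /=; ring.
Qed.

(** Pf (A X A^T) = det A Pf X, for the X of Pfaffian 1 given by the quaternion
    i. *)
Lemma pfaff_conj_lquat A : pfaff (A *m lquat (basis3 R c0) *m A^T) = \det A.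
Proof.
rewrite det4 /pfaff !mxE !sum_ord4 !mxE !sum_ord4 !mxE /= ; ring.
Qed.

Lemma pfaff_rquat v : pfaff (rquat v) <= 0.
Proof.
rewrite /pfaff !mxE /=; have := sqr_ge0 (v 0 c0); have := sqr_ge0 (v 0 c1).
by have := sqr_ge0 (v 0 c2); nra.
Qed.

End Pfaffian.

(** * Rotations as products of half-turns *)

Section HalfTurns.
Context (R : realType).
Implicit Types (v w a b c p q : 'rV[R]_3).

(** For a unit vector v, the rotation by the angle pi about v, which is
    w |-> v w v^-1 in terms of quaternions.  The factor sqn v makes the formula
    homogeneous, so that it respects the products for every v up to a factor. *)
Definition half_turn v w := (2 * dot v w) *: v - sqn v *: w.

Lemma half_turn_linear v : linear (half_turn v).
Proof.
move=> k a b; rewrite /half_turn dotDr dotZr.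
by apply/rowP => j; rewrite !mxE; ring.
Qed.

Lemma sqn3E v : sqn v = v 0 c0 ^+ 2 + v 0 c1 ^+ 2 + v 0 c2 ^+ 2.
Proof. by rewrite sqnE sum_ord3. Qed.

Lemma half_turn_cross v a b :
  cross (half_turn v a) (half_turn v b) = sqn v *: half_turn v (cross a b).
Proof.
by apply/rowP; apply: forall_ord3;
  rewrite !(mxE, sqn3E, dotE) /= ?(mxE, sqn3E, dotE) /= ?(mxE, sqn3E, dotE) /=; ring.
Qed.

Lemma half_turn_dot v a b : dot (half_turn v a) (half_turn v b) = sqn v ^+ 2 * dot a b.
Proof. by rewrite !(dotE, mxE, sqn3E); ring. Qed.

Lemma half_turnK v : sqn v = 1 -> involutive (half_turn v).
Proof.
move=> v1 w; rewrite /half_turn v1 !scale1r dotDr -scaleN1r dotZr dotZr dotvv v1.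
by apply/rowP => j; rewrite !mxE; ring.
Qed.

Lemma half_turn_orth v w : sqn v = 1 -> dot v w = 0 -> half_turn v w = - w.
Proof. by move=> v1 vw; rewrite /half_turn vw v1 mulr0 scale0r scale1r add0r. Qed.

(** The half-turn about the bisector of a and b exchanges them; if b = - a, any
    axis c orthogonal to a will do.  The last clause says that the axis lies in
    the span of a, b and c. *)
Lemma half_turn_reach a b c : sqn a = 1 -> sqn b = 1 -> sqn c = 1 -> dot a c = 0 ->
  exists q, [/\ sqn q = 1, half_turn q a = b &
    forall d, dot d a = 0 -> dot d b = 0 -> dot d c = 0 -> dot d q = 0].
Proof.
move=> a1 b1 cn1 ac; have [ab|ab0] := eqVneq (a + b) 0.
  exists c; split=> //; rewrite half_turn_orth // 1?dotC //.
  by apply/eqP; rewrite eq_sym -addr_eq0 addrC ab.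
have N_gt0 : 0 < sqn (a + b) by rewrite lt_def sqn_eq0 ab0 sqn_ge0.
have NE : sqn (a + b) = 2 * (1 + dot a b).
  by rewrite -dotvv !(dotDl, dotDr) !dotvv a1 b1 (dotC b a); ring.
pose k := (Num.sqrt (sqn (a + b)))^-1.
have k2 : k ^+ 2 = (sqn (a + b))^-1 by rewrite /k exprVn sqr_sqrtr // ltW.
have q1 : sqn (k *: (a + b)) = 1 by rewrite sqnZ k2 mulVf // gt_eqF.
exists (k *: (a + b)); split=> // [|d da db dc]; last by rewrite dotZr dotDr da db addr0 mulr0.
rewrite /half_turn q1 scale1r dotZl dotDl dotvv a1 (dotC b a) scalerA.
have -> : 2 * (k * (1 + dot a b)) * k = 1.
  have -> : 2 * (k * (1 + dot a b)) * k = k ^+ 2 * (2 * (1 + dot a b)) by ring.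
  by rewrite -NE k2 mulVf // gt_eqF.
by rewrite scale1r addrAC subrr add0r.
Qed.

(** A first half-turn brings F e0 back to e0.  A second one, about an axis
    orthogonal to e0, brings the image of e1 back to e1 and sends e0 to - e0.
    What remains sends (e0, e1, e2) to (- e0, e1, - e2): it is the half-turn
    about e1. *)
Lemma rotation_half_turns F : linear F -> {morph F : v w / cross v w} -> isometry3 F ->
  exists p q r, [/\ sqn p = 1, sqn q = 1, sqn r = 1 &
    forall v, F v = half_turn p (half_turn q (half_turn r v))].
Proof.
move=> Fl Fx Fiso; have [b01 b12 b20] := cross_basis R.
set e0 := basis3 R c0 in b01 b12 b20; set e1 := basis3 R c1 in b01 b12 b20.
set e2 := basis3 R c2 in b01 b12 b20.
have n0 : sqn e0 = 1 by rewrite sqn3E !mxE /=; ring.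
have n1 : sqn e1 = 1 by rewrite sqn3E !mxE /=; ring.
have n2 : sqn e2 = 1 by rewrite sqn3E !mxE /=; ring.
have d01 : dot e0 e1 = 0 by rewrite dotE !mxE /=; ring.
have d02 : dot e0 e2 = 0 by rewrite dotE !mxE /=; ring.
have d12 : dot e1 e2 = 0 by rewrite dotE !mxE /=; ring.
have [|p [p1 pF0 _]] := half_turn_reach n0 _ n1 d01 (b := F e0).
  by rewrite -dotvv Fiso.
pose F1 v := half_turn p (F v).
have F1_0 : F1 e0 = e0 by rewrite /F1 -pF0 half_turnK.
have F1iso v w : dot (F1 v) (F1 w) = dot v w.
  by rewrite /F1 half_turn_dot p1 expr1n mul1r Fiso.
have F1x v w : F1 (cross v w) = cross (F1 v) (F1 w).
  by rewrite /F1 half_turn_cross p1 scale1r Fx.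
have [|q [q1 qF1 qorth]] := half_turn_reach n1 _ n2 d12 (b := F1 e1).
  by rewrite -dotvv F1iso.
have qe0 : dot e0 q = 0 by apply: qorth => //; rewrite -F1_0 F1iso.
exists p, q, e1; split=> // v; apply: (can_inj (half_turnK p1)).
rewrite half_turnK //; apply: (can_inj (half_turnK q1)); rewrite half_turnK //.
pose F2 v := half_turn q (F1 v); rewrite -/(F1 v) -/(F2 v).
have F2_0 : F2 e0 = - e0 by rewrite /F2 F1_0 half_turn_orth // dotC.
have F2_1 : F2 e1 = e1 by rewrite /F2 -qF1 half_turnK.
have F2x a b : F2 (cross a b) = cross (F2 a) (F2 b).
  by rewrite /F2 half_turn_cross q1 scale1r F1x.
have F2_2 : F2 e2 = - e2.
  rewrite -b01 F2x F2_0 F2_1; apply/rowP; apply: forall_ord3; rewrite !mxE /= ?mxE /=; ring.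
have F2l : linear F2.
  by move=> k a b; rewrite /F2 /F1 Fl (half_turn_linear p) (half_turn_linear q).
pose G : {linear 'rV[R]_3 -> 'rV[R]_3} :=
  HB.pack F2 (GRing.isLinear.Build _ _ _ _ F2 F2l).
pose H : {linear 'rV[R]_3 -> 'rV[R]_3} :=
  HB.pack (half_turn e1) (GRing.isLinear.Build _ _ _ _ (half_turn e1) (half_turn_linear e1)).
rewrite -[F2 v]/(G v) -[RHS]/(H v) (row3_basis v) !linearD !linearZ /=.
have h0 : half_turn e1 e0 = - e0 by rewrite half_turn_orth // dotC.
have h1 : half_turn e1 e1 = e1.
  by rewrite /half_turn dotvv n1 scale1r mulr1 scaler_nat mulr2n addrK.
have h2 : half_turn e1 e2 = - e2 by rewrite half_turn_orth.
by rewrite -/e0 -/e1 -/e2 F2_0 F2_1 F2_2 h0 h1 h2.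
Qed.

(** Conjugation by v acts on left multiplications as a half-turn and commutes
    with right multiplications. *)
Lemma half_turn_quat v w z : sqn v = 1 ->
  lquat v *m (lquat w + rquat z) *m lquat v = - (lquat (half_turn v w) + rquat z).
Proof.
move=> v1.
pose L : {linear 'rV[R]_3 -> 'M[R]_4} :=
  HB.pack (@lquat R) (GRing.isLinear.Build _ _ _ _ (@lquat R) (@lquat_linear R)).
have LB a b : lquat (a - b) = lquat a - lquat b by exact: (linearB L).
have LZ k a : lquat (k *: a) = k *: lquat a by exact: (linearZZ L k a).
have L0 : lquat 0 = 0 :> 'M[R]_4 by exact: (linear0 L).
have vv : lquat v *m lquat v = - 1%:M by rewrite lquatM crossvv L0 dotvv v1 sub0r.
rewrite mulmxDr mulmxDl lrquatC -(mulmxA _ (lquat v)) vv mulmxN mulmx1 opprD.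
congr (_ - _); rewrite lquatM mulmxBl lquatM mul_scalar_mx.
have -> : cross (cross v w) v = w - dot v w *: v.
  rewrite -[cross _ _]opprK.
  have -> : - cross (cross v w) v = cross v (cross v w).
    by apply/rowP; apply: forall_ord3; rewrite !mxE /= ?mxE /=; ring.
  by rewrite cross_cross dotvv v1 scale1r opprB.
have -> : dot (cross v w) v = 0 by rewrite dot_cross_l.
rewrite /half_turn v1 scale1r !LB !LZ raddf0 subr0.
by apply/matrixP => i j; rewrite !mxE; ring.
Qed.

End HalfTurns.

(** * Inner automorphisms of compact type *)

Section Compact.
Context (R : realType).
Local Notation M := 'M[R]_8.
Local Notation I := (I44 R).
Local Notation blk := (@block_mx R 4 4 4 4).
Implicit Types (v w : 'rV[R]_3) (f g h n t : lie_aut R).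

Lemma mulmx_blk (A B C D A' B' C' D' : 'M[R]_4) :
  blk A B C D *m blk A' B' C' D' =
  blk (A *m A' + B *m C') (A *m B' + B *m D') (C *m A' + D *m C') (C *m B' + D *m D').
Proof. exact: mulmx_block. Qed.

Lemma lquat0 : lquat 0 = 0 :> 'M[R]_4.
Proof. by apply/matrixP; apply: forall_ord4; apply: forall_ord4; rewrite !mxE /= ?mxE ?oppr0. Qed.

Lemma rquat0 : rquat 0 = 0 :> 'M[R]_4.
Proof. by apply/matrixP; apply: forall_ord4; apply: forall_ord4; rewrite !mxE /= ?mxE ?oppr0. Qed.

Lemma in_k_row0 v : so44_mx (in_k (single_row i0 v)) = blk (lquat v) 0 0 0.
Proof. by rewrite /= /k_left /k_right !row_single_row /= lquat0 rquat0 !addr0. Qed.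

Lemma lquat_sqr v : sqn v = 1 -> lquat v *m lquat v = - 1%:M.
Proof.
by move=> v1; rewrite lquatM crossvv lquat0 dotvv v1 sub0r.
Qed.

(** The generator J satisfies J^3 = - J, so Rodrigues' formula applies; J^2 is - 1
    on the first R^4 and 0 on the second. *)
Lemma mexp_row0 (t : R) v : sqn v = 1 ->
  mexp (so44_mx (t *: in_k (single_row i0 v))) = blk ((cos t)%:M + sin t *: lquat v) 0 0 1%:M.
Proof.
move=> v1; rewrite [so44_mx _]/(t *: so44_mx (in_k (single_row i0 v))) in_k_row0.
set J := blk _ _ _ _.
have JJ : J *m J = blk (- 1%:M) 0 0 0.
  by rewrite /J mulmx_blk lquat_sqr // !mulmx0 !mul0mx !addr0.
rewrite mexp_rotation; last first.
  rewrite JJ /J mulmx_blk !mulmx0 !mul0mx !addr0 mulNmx mul1mx.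
  by rewrite (@opp_block_mx _ 4 4 4 4) !oppr0.
rewrite JJ /J (@scalar_mx_block _ 4 4) !(@scale_block_mx _ 4 4 4 4) !(@add_block_mx _ 4 4 4 4).
rewrite !scaler0 !addr0; congr (blk _ _ _ _).
by apply/matrixP => i j; rewrite !mxE; case: (i == j); rewrite ?mulr1n ?mulr0n; ring.
Qed.

(** At t = pi the one-parameter group reaches - I44, which acts like I44. *)
Lemma theta_exp : is_exp_ad (pi *: in_k (single_row i0 (basis3 R c0))) (theta R).
Proof.
have n0 : sqn (basis3 R c0) = 1 by rewrite sqn3E !mxE /=; ring.
apply/is_exp_adP.
have H := mexp_O44 (pi *: in_k (single_row i0 (basis3 R c0))).
split=> // X; rewrite theta_mx mexp_row0 // cospi sinpi scale0r addr0.
have -> : blk (-1)%:M 0 0 1%:M = - I.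
  by rewrite I44E (@opp_block_mx _ 4 4 4 4) !oppr0 opprK raddfN.
have -> : O44_inv (- I) = - I.
  by rewrite /O44_inv [(- I)^T]linearN /= I44_tr mulmxN mulNmx I44_sqr mul1mx.
by rewrite mulNmx mulmxN mulNmx opprK.
Qed.

Lemma theta_inner : inner_set R (theta R).
Proof. exact: inner_exp theta_exp. Qed.

Lemma half_turn_row0_inner v : sqn v = 1 -> exists2 h, inner_set R h &
  forall i w, h (in_k (single_row i w)) =
    in_k (single_row i (if i == i0 then half_turn v w else w)).
Proof.
move=> v1; pose X := (pi / 2) *: in_k (single_row i0 v).
exists (Ad (mexp_O44 X)); first by apply: (@inner_Ad_mexp R X); exact: is_Ad_Ad.
have uE : mexp (so44_mx X) = blk (lquat v) 0 0 1%:M.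
  by rewrite mexp_row0 // cos_pihalf sin_pihalf scale1r raddf0 add0r.
have vE : O44_inv (mexp (so44_mx X)) = blk (- lquat v) 0 0 1%:M.
  apply: O44_inv_unique; first exact: mexp_O44.
  rewrite uE mulmx_blk !mulmx0 !mul0mx !addr0 mulmxN lquat_sqr // opprK mulmx1 add0r.
  by rewrite (@scalar_mx_block _ 4 4).
move=> i w; apply: so44_mx_inj.
rewrite [LHS](_ : _ = mexp X *m in_k (single_row i w) *m O44_inv (mexp X)) //.
rewrite vE uE /= !mulmx_blk !(mulmx0, mul0mx, addr0, add0r, mulmx1, mul1mx) mulmxN.
have -> : k_left (single_row i w) =
    lquat (row i0 (single_row i w)) + rquat (row i1 (single_row i w)) by [].
rewrite half_turn_quat // opprK; congr (blk _ _ _ _).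
  have ht0 : half_turn v 0 = 0.
    by rewrite /half_turn /dot trmx0 mulmx0 mxE mulr0 !scaler0 scale0r subr0.
  rewrite /k_left !row_single_row.
  by move: i; apply: forall_ord4; rewrite /= ?ht0 ?lquat0 ?rquat0.
rewrite /k_right !row_single_row.
by move: i; apply: forall_ord4.
Qed.

(** The adjacent transpositions generate S_4. *)
Lemma perm_aut (s : 'S_4) : exists2 t, moves_rows t s & (theta R * t = t * theta R)%g.
Proof.
pose P s := exists2 t, moves_rows t s & (theta R * t = t * theta R)%g.
have P1 : P 1%g by exists 1%g => [i v|]; rewrite ?perm1 ?mulg1 ?mul1g.
have PM s1 s2 : P s1 -> P s2 -> P (s1 * s2)%g.
  move=> [t1 m1 h1] [t2 m2 h2]; exists (t2 * t1)%g; first exact: moves_rowsM.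
  by rewrite mulgA h2 -!mulgA h1.
have PJ i j k l m o : P (tperm i j) -> P (tperm k l) ->
    tperm k l i = m -> tperm k l j = o -> P (tperm m o).
  move=> Pij Pkl <- <-; rewrite -tpermJ conjgE tpermV.
  exact: (PM _ _ Pkl (PM _ _ Pij Pkl)).
have P01 : P (tperm i0 i1) := tperm_aut01 R.
have P12 : P (tperm i1 i2) := tperm_aut12 R.
have P23 : P (tperm i2 i3) := tperm_aut23 R.
have P02 : P (tperm i0 i2) by apply: (PJ _ _ _ _ _ _ P01 P12); rewrite ?tpermL ?tpermD.
have P13 : P (tperm i1 i3) by apply: (PJ _ _ _ _ _ _ P12 P23); rewrite ?tpermL ?tpermD.
have P03 : P (tperm i0 i3) by apply: (PJ _ _ _ _ _ _ P02 P23); rewrite ?tpermL ?tpermD.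
have Pt : forall i j, P (tperm i j).
  by apply: forall_ord4; apply: forall_ord4; rewrite ?tperm1 // tpermC.
have [ts -> _] := prod_tpermP s.
by elim: ts => [|[i j] ts IH]; rewrite ?big_nil ?big_cons //; apply: PM.
Qed.

(** The half-turns in the first ideal are exponentials; those in the others are
    their conjugates by an automorphism that exchanges two ideals. *)
Lemma half_turn_inner i v : sqn v = 1 -> exists2 h, inner_set R h &
  forall j w, h (in_k (single_row j w)) =
    in_k (single_row j (if j == i then half_turn v w else w)).
Proof.
move=> /half_turn_row0_inner[h hin hE]; have [t tE _] := perm_aut (tperm i i0).
exists (h ^ t)%g; first exact: innerJ.
move=> j w.
have -> : (h ^ t)%g (in_k (single_row j w)) =
    (t^-1)%g (h (t (in_k (single_row j w)))).
  by rewrite conjgE.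
apply: (@lie_aut_inj R t); rewrite [t (_ (h _))]lie_autK !tE hE.
suff -> : (tperm i i0 j == i0) = (j == i) by [].
by rewrite -[X in _ == X](tpermL i i0) (inj_eq (@perm_inj _ _)).
Qed.

Lemma rotation_inner i F : linear F -> {morph F : v w / cross v w} -> isometry3 F ->
  exists2 n, inner_set R n &
  forall j w, n (in_k (single_row j w)) = in_k (single_row j (if j == i then F w else w)).
Proof.
move=> Fl Fx Fiso; have [p [q [r [p1 q1 r1 FE]]]] := rotation_half_turns Fl Fx Fiso.
have [hp hpi hpE] := half_turn_inner i p1.
have [hq hqi hqE] := half_turn_inner i q1.
have [hr hri hrE] := half_turn_inner i r1.
exists (hp * (hq * hr))%g; first by apply: innerM => //; apply: innerM.
move=> j w; rewrite -[LHS]/(hp (hq (hr (in_k (single_row j w))))) hrE hqE hpE.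
by case: eqP => // _; rewrite FE.
Qed.

Lemma rotations_inner (F : 'I_4 -> 'rV[R]_3 -> 'rV[R]_3) :
  (forall i, [/\ linear (F i), {morph F i : v w / cross v w} & isometry3 (F i)]) ->
  exists2 n, inner_set R n & forall i v, n (in_k (single_row i v)) = in_k (single_row i (F i v)).
Proof.
move=> FP.
have nP i : exists n, inner_set R n /\
    forall j w, n (in_k (single_row j w)) = in_k (single_row j (if j == i then F i w else w)).
  by have [Fl Fx Fiso] := FP i; have [n] := rotation_inner i Fl Fx Fiso; exists n.
have [[m0 [m0i m0E]] [m1 [m1i m1E]]] := (nP i0, nP i1).
have [[m2 [m2i m2E]] [m3 [m3i m3E]]] := (nP i2, nP i3).
exists (m0 * (m1 * (m2 * m3)))%g; first by do 3![apply: innerM => //].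
move=> i v; rewrite -[LHS]/(m0 (m1 (m2 (m3 (in_k (single_row i v)))))) m3E m2E m1E m0E.
by move: i; apply: forall_ord4.
Qed.

Lemma fix_rows f : (forall i v, f (in_k (single_row i v)) = in_k (single_row i v)) ->
  forall x, f (in_k x) = in_k x.
Proof.
by move=> fE x; rewrite (sum_single_row x) !linear_sum; apply: eq_bigr => i _; exact: fE.
Qed.

End Compact.

(** * Automorphisms that are trivial on k *)

Section Generation.
Context (R : realType).
Implicit Types (A B : 'M[R]_4) (v w : 'rV[R]_3).

(** The matrix E_00 is (1 + sum_a L_a R_a) / 4, and E_ij is obtained from it by
    the multiplications that send the unit to the i-th and j-th basis
    quaternions: left and right multiplications generate all of End(R^4). *)
Lemma quat_generation (P : 'M[R]_4 -> Prop) :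
  P 1%:M -> (forall A B, P A -> P B -> P (A + B)) ->
  (forall a A, P A -> P (a *: A)) -> (forall A B, P A -> P B -> P (A *m B)) ->
  (forall v, P (lquat v)) -> (forall v, P (rquat v)) -> forall A, P A.
Proof.
move=> P1 PD PZ PM Pl Pr.
pose e := basis3 R.
pose E00 := 4^-1 *: (1%:M + (lquat (e c0) *m rquat (e c0) + lquat (e c1) *m rquat (e c1)
              + lquat (e c2) *m rquat (e c2))).
have Plr v : P (lquat v *m rquat v) by exact: PM (Pl v) (Pr v).
have PE : P E00 by exact: PZ _ _ (PD _ _ P1 (PD _ _ (PD _ _ (Plr _) (Plr _)) (Plr _))).
have E00E : E00 = delta_mx i0 i0.
  have LR0 : lquat (e c0) *m rquat (e c0) =
      mx4 [:: [:: 1; 0; 0; 0]; [:: 0; 1; 0; 0]; [:: 0; 0; -1; 0]; [:: 0; 0; 0; -1]].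
    by rewrite /e; mxring4.
  have LR1 : lquat (e c1) *m rquat (e c1) =
      mx4 [:: [:: 1; 0; 0; 0]; [:: 0; -1; 0; 0]; [:: 0; 0; 1; 0]; [:: 0; 0; 0; -1]].
    by rewrite /e; mxring4.
  have LR2 : lquat (e c2) *m rquat (e c2) =
      mx4 [:: [:: 1; 0; 0; 0]; [:: 0; -1; 0; 0]; [:: 0; 0; -1; 0]; [:: 0; 0; 0; 1]].
    by rewrite /e; mxring4.
  rewrite /E00 LR0 LR1 LR2; apply/matrixP; apply: forall_ord4; apply: forall_ord4;
  rewrite !mxE /=; by field.
pose q (i : 'I_4) : 'M[R]_4 := nth 1%:M [:: 1%:M; lquat (e c0); lquat (e c1); lquat (e c2)] i.
have Pq i : P (q i) by move: i; apply: forall_ord4; rewrite /q /=.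
have PqT i : P (q i)^T.
  move: i; apply: forall_ord4; rewrite /q /= ?trmx1 // lquat_tr -scaleN1r; exact: PZ.
have qcol i k : q i k i0 = (k == i)%:R.
  move: i k; apply: forall_ord4; apply: forall_ord4; rewrite /q /= !mxE /= ?mxE /= ?oppr0 //.
have deltaE i j : delta_mx i j = q i *m E00 *m (q j)^T.
  rewrite E00E; apply/matrixP => k l; rewrite mul_delta_entry !mxE !qcol.
  by rewrite -natrM mulnb.
move=> A; rewrite (matrix_sum_delta A).
have P0 : P 0 by rewrite -(scale0r 1%:M); exact: PZ.
apply: (big_ind P) => // i _; apply: (big_ind P) => // j _; apply: PZ.
by rewrite deltaE; apply: (PM _ _ _ (PqT j)); exact: PM (Pq i) PE.
Qed.

Lemma central_scalar (C : 'M[R]_4) : (forall A, A *m C = C *m A) -> exists c, C = c%:M.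
Proof.
move=> Ccomm; have E i j k l : (k == i)%:R * C j l = C k i * (j == l)%:R.
  have /matrixP/(_ k l) := Ccomm (delta_mx i j).
  rewrite -[X in X *m C]mul1mx mul_delta_entry -[C *m _]mulmx1 mul_delta_entry.
  by rewrite !mxE.
exists (C i0 i0); apply/matrixP => j l; rewrite mxE.
have := E i0 j i0 l; rewrite eqxx mul1r => ->.
by rewrite mulr_natr.
Qed.

End Generation.

Section FixesK.
Context (R : realType).
Implicit Types (v w : 'rV[R]_3) (f g h n t : lie_aut R).

Variable f : lie_aut R.
Hypothesis fK : forall x, f (in_k x) = in_k x.

(** p is the orthogonal of k for the trace form. *)
Lemma fixes_k_in_p B : f (in_p B) = in_p (p_coord (f (in_p B))).
Proof.
have [y [C E]] : exists y C, f (in_p B) = in_k y + in_p C.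
  by exists (k_coord (f (in_p B))), (p_coord (f (in_p B))); exact: so44_decomp.
rewrite E p_coordK; suff -> : y = 0 by rewrite linear0 add0r.
have := lie_aut_trace f (in_k y) (in_p B).
rewrite fK E trace_kp [so44_mx (_ + _)]/= mulmxDr mxtraceD trace_kp addr0.
rewrite trace_kk => /eqP; rewrite oppr_eq0 mulf_eq0 pnatr_eq0 /= => /eqP H.
by apply: sum_sqr_eq0; rewrite (_ : \sum_i _ = \sum_i \sum_j y i j * y i j) ?H //.
Qed.

Let phi B := p_coord (f (in_p B)).

Let phiE B : f (in_p B) = in_p (phi B).
Proof. exact: fixes_k_in_p. Qed.

Let phi_linear : linear phi.
Proof.
move=> a B C; have E : in_p (phi (a *: B + C)) = in_p (a *: phi B + phi C).
  by rewrite -phiE !linearP /= !phiE.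
by have := @in_k_in_p_inj R 0 0 _ _ (congr1 (+%R (in_k 0)) E) => -[].
Qed.

Let phi_equiv x B :
  phi (k_left x *m B - B *m k_right x) = k_left x *m phi B - phi B *m k_right x.
Proof.
have E : in_p (phi (k_left x *m B - B *m k_right x)) =
    in_p (k_left x *m phi B - phi B *m k_right x).
  by rewrite -bracket_kp -phiE -bracket_kp -phiE lie_aut_bracket fK.
by have := @in_k_in_p_inj R 0 0 _ _ (congr1 (+%R (in_k 0)) E) => -[].
Qed.

(** The action of k on p is by left and right multiplication, so phi commutes
    with all left multiplications, by generation. *)
Let phi_mul A B : phi (A *m B) = A *m phi B.
Proof.
pose F : {linear 'M[R]_4 -> 'M[R]_4} :=
  HB.pack phi (GRing.isLinear.Build _ _ _ _ phi phi_linear).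
have FD C D : phi (C + D) = phi C + phi D by exact: (linearD F).
have FZ a C : phi (a *: C) = a *: phi C by exact: (linearZZ F a C).
move: B; pose P A := forall B, phi (A *m B) = A *m phi B; rewrite -/(P A).
have kr0 i v : (i == i0) || (i == i1) -> k_right (single_row i v) = 0.
  by rewrite /k_right !row_single_row => /orP[] /eqP -> /=; rewrite lquat0 rquat0 addr0.
apply: (@quat_generation R P) => [B|C D PC PD B|a C PC B|C D PC PD B|v B|v B].
- by rewrite !mul1mx.
- by rewrite !mulmxDl FD PC PD.
- by rewrite -!scalemxAl FZ PC.
- by rewrite -!mulmxA PC PD.
- have := phi_equiv (single_row i0 v) B; rewrite kr0 // !mulmx0 !subr0.
  by rewrite /k_left !row_single_row /= rquat0 addr0.
- have := phi_equiv (single_row i1 v) B; rewrite kr0 // !mulmx0 !subr0.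
  by rewrite /k_left !row_single_row /= lquat0 add0r.
Qed.

Let phi_mulr A B : phi (B *m A) = phi B *m A.
Proof.
pose F : {linear 'M[R]_4 -> 'M[R]_4} :=
  HB.pack phi (GRing.isLinear.Build _ _ _ _ phi phi_linear).
have FD C D : phi (C + D) = phi C + phi D by exact: (linearD F).
have FN C : phi (- C) = - phi C by exact: (linearN F).
have FZ a C : phi (a *: C) = a *: phi C by exact: (linearZZ F a C).
move: B; pose P A := forall B, phi (B *m A) = phi B *m A; rewrite -/(P A).
have kl0 i v : (i == i2) || (i == i3) -> k_left (single_row i v) = 0.
  by rewrite /k_left !row_single_row => /orP[] /eqP -> /=; rewrite lquat0 rquat0 addr0.
apply: (@quat_generation R P) => [B|C D PC PD B|a C PC B|C D PC PD B|v B|v B].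
- by rewrite !mulmx1.
- by rewrite !mulmxDr FD PC PD.
- by rewrite -!scalemxAr FZ PC.
- by rewrite !mulmxA PD PC.
- have := phi_equiv (single_row i2 v) B; rewrite kl0 // !mul0mx !sub0r FN => /oppr_inj.
  by rewrite /k_right !row_single_row /= rquat0 addr0.
- have := phi_equiv (single_row i3 v) B; rewrite kl0 // !mul0mx !sub0r FN => /oppr_inj.
  by rewrite /k_right !row_single_row /= lquat0 add0r.
Qed.

(** Schur's lemma: phi is a scalar, which is 1 or - 1 because the trace form is
    preserved. *)
Lemma fixes_k_inner : inner_set R f.
Proof.
have [c cE] : exists c, phi 1%:M = c%:M.
  by apply: central_scalar => A; rewrite -phi_mul -phi_mulr mulmx1 mul1mx.
have phiB B : phi B = c *: B by rewrite -{1}[B]mulmx1 phi_mul cE mul_mx_scalar.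
have c2 : c ^+ 2 = 1.
  have := lie_aut_trace f (in_p 1%:M) (in_p 1%:M).
  rewrite phiE phiB !trace_pp [(c *: _)^T]linearZ /= -scalemxAl -scalemxAr scalerA mxtraceZ.
  rewrite trmx1 mulmx1 mxtrace1 => E; move: E; rewrite expr2; lra.
have fE x B : f (in_k x + in_p B) = in_k x + c *: in_p B.
  by rewrite linearD /= fK phiE phiB linearZ.
move/eqP: c2; rewrite sqrf_eq1 => /orP[/eqP cN|/eqP cN].
  suff -> : f = 1%g by exact: inner1.
  by apply: lie_aut_ext => X; rewrite {1}[X]so44_decomp fE cN scale1r -so44_decomp.
suff -> : f = theta R by exact: theta_inner.
apply: lie_aut_ext => X; have [x [B ->]] : exists x B, X = in_k x + in_p B.
  by exists (k_coord X), (p_coord X); exact: so44_decomp.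
by rewrite fE thetaE cN scaleN1r.
Qed.

End FixesK.

(** * The outer automorphism group *)

Section Main.
Context (R : realType).
Implicit Types (v w : 'rV[R]_3) (f g h n t k : lie_aut R).

Lemma permutes1_inner k : (theta R * k = k * theta R)%g -> permutes k 1%g -> inner_set R k.
Proof.
move=> kth k1.
have FE i := cid (theta_comm_isometry kth i k1).
have [|n nin nE] := @rotations_inner R (fun i => sval (FE i)).
  by move=> i; have [] := svalP (FE i).
have -> : (k = n * (n^-1 * k))%g by rewrite mulKVg.
apply: innerM => //; apply: fixes_k_inner; apply: fix_rows => i v.
have [_ _ _ kE] := svalP (FE i).
by apply: (@lie_aut_inj R n); rewrite [n _]lie_autK kE nE.
Qed.

(** The matrix I u^-1 I u commutes with so(4,4), so it is a scalar; comparison of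
    the upper left blocks, which are invertible, shows that the scalar is 1. *)
Lemma Ad_theta_comm_block (u : 'M[R]_8) n : is_Ad u n -> (theta R * n = n * theta R)%g ->
  urblock u = 0 /\ dlblock u = 0.
Proof.
move=> [uO uE] nth.
have uV := O44_mulmxV uO; have Vu := O44_mulVmx uO.
move: uE uV Vu; set u' := O44_inv u; clearbody u' => uE uV Vu.
pose I := I44 R; have II : I *m I = 1%:M := I44_sqr R.
pose y := u' *m I *m u.
have yy : y *m y = 1%:M.
  by rewrite /y -!mulmxA (mulmxA u u') uV mul1mx (mulmxA I I) II mul1mx.
have yX X : y *m so44_mx X *m y = I *m X *m I.
  have : so44_mx (theta R (n X)) = so44_mx (n (theta R X)).
    by rewrite -[theta R (n X)]/((theta R * n)%g X) nth.
  rewrite theta_mx uE uE theta_mx => /(congr1 (fun A => u' *m A *m u)) => E.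
  transitivity (u' *m (I *m (u *m X *m u') *m I) *m u); first by rewrite /y !mulmxA.
  by rewrite E !mulmxA Vu mul1mx -!mulmxA Vu mulmx1.
have zC X : I *m y *m so44_mx X = so44_mx X *m (I *m y).
  move: (y) yy yX => y' yy yX; rewrite -[LHS]mulmx1 -yy.
  have -> : I *m y' *m X *m (y' *m y') = I *m (y' *m X *m y') *m y' by rewrite !mulmxA.
  by rewrite yX !mulmxA II mul1mx.
have [c zc] := commutant_so44_scalar zC.
have Iu : I *m u = c *: (u *m I).
  have : u *m I *m (I *m y) = I *m u.
    by rewrite mulmxA -(mulmxA u I I) II mulmx1 /y !mulmxA uV mul1mx.
  by rewrite zc mul_mx_scalar => <-.
have det0 := det_ulblock_neq0 uO.
move: Iu det0; rewrite -{1 2}(blockK u) /I I44E !(@mulmx_block _ 4 4 4 4 4 4).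
rewrite (@scale_block_mx _ 4 4 4 4) !mul1mx !mul0mx !mulmx0 !mulmx1 !addr0 !add0r.
rewrite !mulNmx !mulmxN !mul1mx !mulmx1.
case/(@eq_block_mx _ 4 4 4 4) => Ea Eb Ec _ det0.
have c1 : c = 1.
  apply/eqP; rewrite -subr_eq0; apply: contraNT det0 => c1.
  have : (c - 1) *: ulblock u = 0 by rewrite scalerBl scale1r -Ea subrr.
  by move/eqP; rewrite scaler_eq0 (negbTE c1) /= => /eqP ->; rewrite det0 ?eqxx.
have half (A : 'M[R]_4) : A = - A -> A = 0.
  move=> AN; apply/matrixP => i j; have /matrixP/(_ i j) := AN.
  by rewrite !mxE => ?; lra.
rewrite c1 !scale1r in Eb Ec; split; apply: half => //.
Qed.

(** The Pfaffian of the upper left block of the image of i is a determinant, hence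
    positive; on the other three ideals it is at most 0. *)
Lemma inner_permutes_fix0 n s : inner_set R n -> (theta R * n = n * theta R)%g ->
  permutes n s -> s i0 = i0.
Proof.
move=> /inner_Ad_pos[u [uAd det_gt0]] nth ns.
have [ur0 dl0] := Ad_theta_comm_block uAd nth; have [uO uE] := uAd.
have [w E] := ns i0 (basis3 R c0).
have := congr1 (fun X => pfaff (ulblock (so44_mx X))) E.
rewrite uE in_k_row0 /O44_inv.
have -> : ulblock (u *m @block_mx R 4 4 4 4 (lquat (basis3 R c0)) 0 0 0
                   *m (I44 R *m u^T *m I44 R)) =
    ulblock u *m lquat (basis3 R c0) *m (ulblock u)^T.
  rewrite -[in LHS](blockK u) ur0 dl0 (@tr_block_mx _ 4 4 4 4) !trmx0 I44_conj_blk.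
  rewrite !(@mulmx_block _ 4 4 4 4 4 4) !(mulmx0, mul0mx, addr0, add0r, oppr0).
  by rewrite /ulblock block_mxKul.
rewrite pfaff_conj_lquat => detE; apply/eqP; apply/negPn/negP => s0.
have : pfaff (ulblock (in_k (single_row (s i0) w))) <= 0.
  rewrite /ulblock /= (@block_mxKul _ 4 4 4 4) /k_left !row_single_row.
  rewrite eq_sym (negbTE s0) lquat0 add0r.
  exact: pfaff_rquat.
by rewrite -detE leNgt det_gt0.
Qed.

Lemma inner_permutes1 n s : inner_set R n -> (theta R * n = n * theta R)%g ->
  permutes n s -> s = 1%g.
Proof.
move=> nin nth ns; apply/permP => i; rewrite perm1.
have [t tE tth] := perm_aut R (tperm i0 i).
have tiE : permutes (t^-1)%g (tperm i0 i).
  move=> j v; exists v; apply: (@lie_aut_inj R t).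
  by rewrite [t (t^-1 _)%g]lie_autK tE tpermK.
have tith : (theta R * t^-1 = t^-1 * theta R)%g.
  by apply: (mulgI t); rewrite !mulgA mulgV mul1g -tth -mulgA mulgV mulg1.
have := @inner_permutes_fix0 (n ^ t)%g (tperm i0 i * (s * tperm i0 i))%g (innerJ t nin).
rewrite !permM tpermL => H.
have {}H : tperm i0 i (s i) = i0.
  apply: H.
    by rewrite conjgE !mulgA tith -!mulgA; congr (_ * _)%g; rewrite mulgA nth -mulgA tth mulgA.
  rewrite conjgE mulgA; apply: permutesM; last exact: moves_rows_permutes.
  exact: permutesM.
by rewrite -[s i](tpermK i0 i) H tpermL.
Qed.

Lemma theta_inv k : (theta R * k = k * theta R)%g -> (theta R * k^-1 = k^-1 * theta R)%g.
Proof.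
by move=> kth; apply: (mulgI k); rewrite !mulgA mulgV mul1g -kth -mulgA mulgV mulg1.
Qed.

(** The factors k and n are not unique; that s does not depend on them follows
    from induces_inner. *)
Definition induces f (s : 'S_4) := exists k n,
  [/\ f = (k * n)%g, inner_set R n, (theta R * k = k * theta R)%g & permutes k s].

Lemma induces_exists f : exists s, induces f s.
Proof.
have [k [n [fE nin kth]]] := polar_decomposition f (@theta_exp R).
by have [s ks] := theta_comm_permutes kth; exists s, k, n.
Qed.

Lemma inducesV f s : induces f s -> induces (f^-1)%g (s^-1)%g.
Proof.
move=> [k [n [-> nin kth ks]]].
exists (k^-1)%g, ((n^-1) ^ (k^-1))%g; split; last first.
- have [s' ks'] := theta_comm_permutes (theta_inv kth).
  suff <- : s' = (s^-1)%g by [].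
  have := permutes_unique (permutesM ks ks') _; rewrite mulgV => /(_ _ (@permutes1 R)) H.
  by apply: (mulIg s); rewrite H mulVg.
- exact: theta_inv.
- by apply: innerJ; exact: innerV.
- by rewrite conjgE invgK mulKg invgM.
Qed.

Lemma inducesM f g s r : induces f s -> induces g r -> induces (f * g)%g (r * s)%g.
Proof.
move=> [k [n [-> nin kth ks]]] [l [m [-> mi lth lr]]].
exists (k * l)%g, ((n ^ l) * m)%g; split.
- by rewrite conjgE -!mulgA mulKVg.
- by apply: innerM => //; exact: innerJ.
- by rewrite mulgA kth -!mulgA lth.
- exact: permutesM.
Qed.

Lemma induces_inner f s : induces f s -> inner_set R f <-> s = 1%g.
Proof.
move=> [k [n [-> nin kth ks]]]; split=> [kn|s1].
  have kin : inner_set R k.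
    by rewrite -[k](mulgK n); apply: innerM => //; exact: innerV.
  exact: inner_permutes1 kin kth ks.
by apply: innerM => //; apply: permutes1_inner => //; rewrite -s1.
Qed.

End Main.

Theorem theorem2 (R : realType) : group_isomorphic (outer_aut R) 'S_4.
Proof.
pose N := inner_subgroup R.
pose sg (f : lie_aut R) : 'S_4 := sval (cid (induces_exists f)).
have sgP f : induces f (sg f) by rewrite /sg; case: cid.
have sgU f s : induces f s -> sg f = s.
  move=> fs; have := inducesM (sgP f) (inducesV fs); rewrite mulgV.
  move=> /induces_inner[/(_ (@inner1 R)) E _].
  by apply: (mulgI (s^-1)%g); rewrite E mulVg.
have sgM f g : sg (f * g)%g = (sg g * sg f)%g by apply: sgU; exact: inducesM.
have sgV f : sg (f^-1)%g = ((sg f)^-1)%g by apply: sgU; exact: inducesV.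
have sg1 f : sg f = 1%g <-> inner_set R f.
  by rewrite (induces_inner (sgP f)).
have sg_coset f g : coset_class N f = coset_class N g <-> sg f = sg g.
  have -> : coset_class N f = coset_class N g <-> inner_set R (f^-1 * g)%g.
    by split=> [/coset_classP|H]; [rewrite inE|apply/coset_classP; rewrite inE].
  rewrite -sg1 sgM sgV; split=> [E|->]; last by rewrite mulgV.
  by apply: (mulIg ((sg f)^-1)%g); rewrite E mulgV.
(* the inverse compensates the opposite conventions for products of
   automorphisms and of permutations *)
pose F (a : Defs.quotient_group N) : 'S_4 := ((sg (generic_quotient.repr a))^-1)%g.
have FE f : F (coset_class N f) = ((sg f)^-1)%g.
  by congr (_^-1)%g; apply/sg_coset; exact: repr_coset.
exists F; split; last first.
  elim/qind => f; elim/qind => g.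
  by rewrite -[(coset_class N f * coset_class N g)%g]/(qmul _ _) qmulE !FE sgM invgM.
pose G (s : 'S_4) : outer_aut R := coset_class N (sval (cid2 (perm_aut R (s^-1)%g))).
have GE s : F (G s) = s.
  rewrite /G FE; case: cid2 => t tE tth /=; apply: (canLR invgK); apply: sgU.
  by exists t, 1%g; split; rewrite ?mulg1 //; [exact: inner1|exact: moves_rows_permutes].
exists G => // a; elim/qind: a => f.
apply/sg_coset; apply: invg_inj; rewrite -FE GE FE //.
Qed.
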